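(* Let $M$ be a closed connected manifold of dimension $n$. Then there exist a compact smooth manifold $\mathcal{H}$, possibly with boundary, and a map $\psi:\mathcal{H}\to\mathrm{Diff}^1(M)$ such that $(\mathcal{H},\psi)$ is a $C^1$ family of diffeomorphisms of $M$ satisfying: (A1) the map $ev:\mathcal{H}\times M\to M\times M$, $ev(h,p)=(p,\psi(h)(p))$, is a submersion; (A2) for every $0\le k\le n$, the map $\operatorname{int}(\mathcal{H})\times \mathrm{Gr}_k(TM)\to \mathrm{Gr}_k(TM)\times \mathrm{Gr}_k(TM)$, $(h,\sigma)\mapsto(\sigma,d(\psi(h))(\sigma))$, is surjective.
   Context: A $C^1$ family of diffeomorphisms of $M$ is a pair $(\mathcal{H},\psi)$ where $\mathcal{H}$ is a smooth manifold, possibly with boundary, and $\psi:\mathcal{H}\to \mathrm{Diff}^1(M)$ is a map such that the evaluation map $\mathcal{H}\times M\to M$, $(h,p)\mapsto\psi(h)(p)$, is $C^1$. $\operatorname{int}(\mathcal{H})$ is the manifold interior of $\mathcal{H}$. $\mathrm{Gr}_k(TM)$ is the $k$-Grassmannian bundle over $M$, i.e. the set of $k$-planes tangent to $M$ ($\mathrm{Gr}_0(TM)\cong M$). *)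

(* Defs.v *)
From HB Require Import structures.
From mathcomp Require Import all_boot all_order all_algebra.
From mathcomp Require Import all_classical all_reals all_analysis.

Set Implicit Arguments.
Unset Strict Implicit.
Unset Printing Implicit Defensive.

Import Order.TTheory GRing.Theory Num.Theory.
Import numFieldNormedType.Exports.

Local Open Scope classical_set_scope.
Local Open Scope ring_scope.

Section Calculus.
Context {R : realType} {E F : normedModType R}.

(* f is of class C^k on the open set U. Only used for finite-dimensional E,
   where continuity of all the maps x |-> 'd f x v is continuity of 'd f. *)
Fixpoint Ck (k : nat) (U : set E) (f : E -> F) : Prop :=
  match k with
  | 0 => forall x, U x -> {for x, continuous f}
  | k'.+1 => (forall x, U x -> differentiable f x) /\
             (forall v, Ck k' U (fun x => 'd f x v))
  end.

Definition Cinfty (U : set E) (f : E -> F) : Prop := forall k, Ck k U f.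

(* g is an extension, of the class described by C, of the germ at x of the
   restriction of f to S. *)
Definition germ_extension (C : set E -> (E -> F) -> Prop)
    (S : set E) (f : E -> F) (x : E) (g : E -> F) : Prop :=
  exists U : set E, [/\ open U, U x, C U g & forall y, S y -> U y -> g y = f y].

(* C-regularity on a set S that need not be open (S is going to be a relatively
   open subset of a half-space): local extendability to open sets. *)
Definition regular_on (C : set E -> (E -> F) -> Prop)
    (S : set E) (f : E -> F) : Prop :=
  forall x, S x -> exists g, germ_extension C S f x g.

(* The derivative at x of a function f of class C^1 on S, computed on any local
   C^1 extension. When S is relatively open in a half-space (or in a product
   of half-spaces with vector spaces) it is contained in the closure of its
   interior, so that the value does not depend on the extension; when S is open
   it is 'd f x. The value is 0 when there is no C^1 extension. *)
Definition derivative_on (S : set E) (f : E -> F) (x : E) : E -> F :=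
  'd (xget (fun=> 0) [set g | germ_extension (Ck 1) S f x g]) x.

End Calculus.

(* chart_inv is meaningful only on chart_map @` chart_dom. *)
Record chart (R : realType) (E : normedModType R) (T : topologicalType) :=
  Chart {
    chart_dom : set T;
    chart_map : T -> E;
    chart_inv : E -> T
  }.

Section Charts.
Context {R : realType} {E : normedModType R} {T : topologicalType}.

(* c is a homeomorphism from an open set of T onto a relatively open subset of
   the model space X. *)
Definition is_chart (X : set E) (c : chart E T) : Prop :=
  [/\ open (chart_dom c),
      exists2 V : set E, open V & chart_map c @` chart_dom c = V `&` X,
      forall p, chart_dom c p -> chart_inv c (chart_map c p) = p,
      {within chart_dom c, continuous (chart_map c)} &
      {within chart_map c @` chart_dom c, continuous (chart_inv c)}].

Definition smooth_transition (c c' : chart E T) : Prop :=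
  regular_on Cinfty (chart_map c @` (chart_dom c `&` chart_dom c'))
    (chart_map c' \o chart_inv c).

Definition smooth_atlas (X : set E) (A : set (chart E T)) : Prop :=
  [/\ forall c, A c -> is_chart X c,
      forall p, exists2 c, A c & chart_dom c p &
      forall c c', A c -> A c' -> smooth_transition c c'].

End Charts.

(* A smooth manifold modelled on the subset X of E. *)
Record manifold (R : realType) (E : normedModType R) (X : set E) := Manifold {
  manifold_sort :> topologicalType;
  atlas : set (chart E manifold_sort);
  manifold_hausdorff : hausdorff_space manifold_sort;
  manifold_second_countable : @second_countable manifold_sort;
  manifold_atlas : smooth_atlas X atlas
}.
Arguments atlas {R E X} _.

(* The half-space {x | 0 <= x_0} of R^m, which is all of R^0 when m = 0. *)
Definition half_space (R : realType) (m : nat) : set 'rV[R]_m :=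
  [set x | forall i : 'I_m, i = 0%N :> nat -> 0 <= x ord0 i].
Arguments half_space : clear implicits.

Definition manifold_without_boundary (R : realType) (n : nat) :=
  manifold [set: 'rV[R]_n].

Definition manifold_with_boundary (R : realType) (m : nat) :=
  manifold (half_space R m).

(* The manifold interior: points sent by some chart of the atlas into the
   topological interior of the model. *)
Definition manifold_interior (R : realType) (E : normedModType R) (X : set E)
    (M : manifold X) : set M :=
  [set p | exists c, [/\ atlas M c, chart_dom c p & X° (chart_map c p)]].
Arguments manifold_interior {R E X} M.

Section ProductAtlas.
Context {R : realType} {E1 E2 : normedModType R} {T1 T2 : topologicalType}.

Definition prod_chart (c1 : chart E1 T1) (c2 : chart E2 T2) :
    chart (E1 * E2)%type (T1 * T2)%type :=
  Chart (chart_dom c1 `*` chart_dom c2)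
    (fun p => (chart_map c1 p.1, chart_map c2 p.2))
    (fun x => (chart_inv c1 x.1, chart_inv c2 x.2)).

(* The product smooth structure, modelled on the product of the two models
   (there are no corners if one of the factors has no boundary). *)
Definition prod_atlas (A1 : set (chart E1 T1)) (A2 : set (chart E2 T2)) :
    set (chart (E1 * E2)%type (T1 * T2)%type) :=
  [set prod_chart c1 c2 | c1 in A1 & c2 in A2].

End ProductAtlas.

Section TangentSpaces.
Context {R : realType} {E : normedModType R} {T : topologicalType}.
Variable A : set (chart E T).

Definition chart_at (p : T) : set (chart E T) :=
  [set c | A c /\ chart_dom c p].

(* A tangent vector at p is the family of its components in all the charts
   around p, related by the derivatives of the transition maps. Components in
   the other charts are set to 0, so that T_p is a linear subspace of the
   function space chart E T -> E. *)
Definition tangent_space (p : T) : set (chart E T -> E) :=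
  [set v | (forall c, ~ chart_at p c -> v c = 0) /\
           (forall c c', chart_at p c -> chart_at p c' ->
              v c' = derivative_on
                       (chart_map c @` (chart_dom c `&` chart_dom c'))
                       (chart_map c' \o chart_inv c) (chart_map c p) (v c))].

(* A point of the k-Grassmannian bundle Gr_k: a point p together with a
   k-dimensional linear subspace of T_p, i.e. the span of k linearly
   independent tangent vectors at p. *)
Definition Grassmannian (k : nat) : set (T * set (chart E T -> E)) :=
  [set s | exists e : 'I_k -> (chart E T -> E),
     [/\ forall i, tangent_space s.1 (e i),
         forall a : 'I_k -> R, \sum_(i < k) a i *: e i = 0 -> forall i, a i = 0 &
         s.2 = [set \sum_(i < k) a i *: e i | a in [set: 'I_k -> R]]]].

End TangentSpaces.

Section Maps.
Context {R : realType} {E1 E2 : normedModType R} {T1 T2 : topologicalType}.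
Variables (A1 : set (chart E1 T1)) (A2 : set (chart E2 T2)).

(* The expression of f : T1 -> T2 in charts, and where it is defined. *)
Definition chart_expr (f : T1 -> T2) (c : chart E1 T1) (d : chart E2 T2) :
  E1 -> E2 := chart_map d \o f \o chart_inv c.

Definition chart_expr_dom (f : T1 -> T2) (c : chart E1 T1) (d : chart E2 T2) :
  set E1 := chart_map c @` (chart_dom c `&` f @^-1` chart_dom d).

Definition C1_map (f : T1 -> T2) : Prop :=
  continuous f /\
  forall c d, A1 c -> A2 d ->
    regular_on (Ck 1) (chart_expr_dom f c d) (chart_expr f c d).

(* [differential f p v w] means w = df_p(v): w is the tangent vector at f p
   whose components are the images of those of v under the derivatives of f
   in charts. *)
Definition differential (f : T1 -> T2) (p : T1)
    (v : chart E1 T1 -> E1) (w : chart E2 T2 -> E2) : Prop :=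
  tangent_space A2 (f p) w /\
  forall c d, chart_at A1 p c -> chart_at A2 (f p) d ->
    w d = derivative_on (chart_expr_dom f c d) (chart_expr f c d)
            (chart_map c p) (v c).

Definition submersion (f : T1 -> T2) : Prop :=
  C1_map f /\
  forall p w, tangent_space A2 (f p) w ->
    exists2 v, tangent_space A1 p v & differential f p v w.

(* The action of f on planes: (p, P) |-> (f p, df_p(P)). *)
Definition plane_map (f : T1 -> T2) (s : T1 * set (chart E1 T1 -> E1)) :
    T2 * set (chart E2 T2 -> E2) :=
  (f s.1, [set w | exists2 v, s.2 v & differential f s.1 v w]).

End Maps.

Section Families.
Context {R : realType} {E : normedModType R} {X : set E}.
Variable M : manifold X.

Definition Diff1 : set (M -> M) :=
  [set f | C1_map (atlas M) (atlas M) f /\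
           exists g : M -> M,
             [/\ cancel f g, cancel g f & C1_map (atlas M) (atlas M) g]].

Definition C1_family {E' : normedModType R} {Y : set E'} (H : manifold Y)
    (psi : H -> M -> M) : Prop :=
  (forall h, Diff1 (psi h)) /\
  C1_map (prod_atlas (atlas H) (atlas M)) (atlas M)
    (fun hp : H * M => psi hp.1 hp.2).

End Families.

(* Main.v *)
Require Import Defs.
From HB Require Import structures.
From mathcomp Require Import all_boot all_order all_algebra.
From mathcomp Require Import all_classical all_reals all_analysis.
From mathcomp Require Import ring lra.
Set Implicit Arguments.
Unset Strict Implicit.
Unset Printing Implicit Defensive.
Import Order.TTheory GRing.Theory Num.Theory.
Import numFieldNormedType.Exports.
Local Open Scope ring_scope.

(**
In a chart, the vector field [b(|x'|^2) f(x_i) d/dx_i], where [x'] are the other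
coordinates and [f] is a C^1 function on [[-1, 1]] with an explicit flow, has a
flow which is C^1, explicit, and supported in a box, so that it extends by the
identity to [M]. Its translates move the points of the box, and the variant
[x_j b(|x'|^2) f(x_i) d/dx_i] fixes the centre of the box, where its
differential is a transvection. Finitely many boxes cover [M]. Every tangent
[k]-plane is moved to the centre of a box, then to the coordinate [k]-plane by
Gaussian elimination with pivots of maximal absolute value, and the centres are
joined by connectedness; this takes a bounded number of moves with parameters
in [[-1, 1]]. Hence one composition [F_t] of all the moves, repeated
sufficiently often, is transitive on all the Grassmannians, and the identity is
obtained for [t = 0].

Let [E_s] be the composition of all the moves once. At [s = 0] the derivatives
of [E_s(p)] in the parameters span the tangent space, hence also for [|s| <= e],
uniformly in [p], by compactness. The family is [E_(e s) o F_(K t)] for [(s, t)]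
in the closed unit ball: it is submersive thanks to [s], and transitive for
[s = 0] thanks to [t], the scale [K] being such that the ball contains all the
needed values of [t]. The ball is charted by inversions centred at two of its
boundary points, which exchange it with a half-space; the transition maps are
then rational.
*)

(** * Reduction of row spaces by transvections *)

(** Compactness of the parameter space shapes the proof. The times of the moves must be bounded, so
    transitivity has to be reached by a number of bounded moves that is the same for all pairs of
    planes and all [k]. Compactness also opposes the two properties: transitivity takes large
    parameters, at which the derivative in the parameters is not controlled, whereas submersivity is
    an open condition, known near the parameter 0. The two blocks of parameters resolve this: the
    submersive block acts last, hence on the point reached, whatever the other block has done
    before. A cube of parameters would have corners; hence the ball. The flows are closed formulas,
    so that their joint regularity in time and point follows from the rules of calculus; a double
    zero of the field at the end points makes the extension by the identity C^1. The families are
    studied over the whole vector space of parameters and restricted to the ball at the end. At its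
    boundary derivatives are those of extensions, and the inclusion of the ball still has a
    surjective derivative. *)

Section Transvections.
Context {F : realFieldType} {n : nat}.
Implicit Types (i j l : 'I_n) (t : F).

(** Row vectors are multiplied on the right, so this is [x_i += t x_j]; hence the order of the
    indices in [delta_mx j i]. *)
Definition transvection i j t : 'M[F]_n := 1%:M + t *: delta_mx j i.

Lemma mul_transvection k (B : 'M[F]_(k, n)) i j t r s :
  (B *m transvection i j t) r s = B r s + t * B r j * (s == i)%:R.
Proof.
rewrite mulmxDr mulmx1 -scalemxAr [LHS]mxE; congr (_ + _).
rewrite mxE [X in _ * X]mxE (bigD1 j) //= mxE eqxx /= big1 ?addr0; last first.
  by move=> l /negbTE lj; rewrite mxE lj /= mulr0.
by rewrite mulrA.
Qed.

Lemma row_mul_transvection (v : 'rV[F]_n) i j t :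
  v *m transvection i j t = v + (t * v ord0 j) *: delta_mx ord0 i.
Proof. by apply/rowP => s; rewrite mul_transvection !mxE eqxx. Qed.

Lemma transvection_unit i j t : i != j -> transvection i j t \in unitmx.
Proof.
move=> ij; have /mulmx1_unit[] // : transvection i j t *m transvection i j (- t) = 1%:M.
apply/matrixP => r s; rewrite mul_transvection !mxE.
rewrite (negbTE (_ : j != i)) ?andbF 1?eq_sym // mulr0 addr0.
case: (eqVneq r j) => [->|_]; case: (eqVneq s i) => [->|_];
  rewrite ?andbT ?andbF /= ?mulr1n ?mulr0n; ring.
Qed.

(* Bounded coefficients, because the parameters of the family are bounded. *)
Fixpoint reducible k (L : nat) (B B' : 'M[F]_(k, n)) : Prop :=
  if L is L'.+1 then (B :=: B')%MS \/ exists i j t,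
      [/\ i != j, `|t| <= 1 & reducible L' (B *m transvection i j t) B']
  else (B :=: B')%MS.

Lemma reducible_refl k L (B : 'M[F]_(k, n)) : reducible L B B.
Proof. by case: L => [|L]; [|left]. Qed.

Lemma reducible_eqmx k L (B B0 B' : 'M[F]_(k, n)) : (B :=: B0)%MS ->
  reducible L B0 B' -> reducible L B B'.
Proof.
elim: L B B0 => [|L IH] B B0 BB /=; first exact: eqmx_trans.
move=> [H|[i [j [t [ij t1 H]]]]]; first by left; exact: eqmx_trans H.
by right; exists i, j, t; split=> //; apply: IH H; exact: eqmxMr.
Qed.

Lemma reducible_mono k L L' (B B' : 'M[F]_(k, n)) : (L <= L')%N ->
  reducible L B B' -> reducible L' B B'.
Proof.
elim: L L' B => [|L IH] [|L'] B //=; first by move=> _; left.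
move=> LL [H|[i [j [t [ij t1 H]]]]]; first by left.
by right; exists i, j, t; split=> //; exact: IH H.
Qed.

Lemma reducible_trans k L L' (B B0 B' : 'M[F]_(k, n)) :
  reducible L B B0 -> reducible L' B0 B' -> reducible (L + L') B B'.
Proof.
elim: L B => [|L IH] B /=; first exact: reducible_eqmx.
move=> [H|[i [j [t [ij t1 H]]]]] H'.
  by apply: (reducible_mono (leq_addl L.+1 L')); exact: reducible_eqmx H'.
by right; exists i, j, t; split=> //; exact: IH.
Qed.

(** The measure of progress of the elimination: a row space of rank [k] that contains the first [k]
    axes is the coordinate plane. *)
Definition axes k (B : 'M[F]_(k, n)) : {set 'I_n} :=
  [set j | (delta_mx (ord0 : 'I_1) j <= B)%MS].

(** Each transvection reads the coordinate [l] and writes another one, so that coordinate [l] never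
    changes and the effects add up. If [w] is normalised to [w_l = 1] and [s] lists all other
    indices, the product sends [w] to [e_l]. *)
Lemma clear_coordinates k (B : 'M[F]_(k, n)) l (w : 'rV[F]_n) (s : seq 'I_n) :
  l \notin s -> (forall i, `|w ord0 i| <= 1) ->
  exists T : 'M[F]_n, [/\ T \in unitmx, reducible (size s) B (B *m T) &
    forall v : 'rV[F]_n, v *m T = v - v ord0 l *: \sum_(i <- s) w ord0 i *: delta_mx ord0 i].
Proof.
move=> ls w1; elim: s ls B => [|i s IH] ls B.
  exists 1%:M; split; [exact: unitmx1|by rewrite mulmx1|].
  by move=> v; rewrite big_nil scaler0 subr0 mulmx1.
move: ls; rewrite inE negb_or => /andP[li ls].
have [T [uT rT TE]] := IH ls (B *m transvection i l (- w ord0 i)).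
exists (transvection i l (- w ord0 i) *m T); split.
- by rewrite unitmx_mul uT andbT transvection_unit // eq_sym.
- right; exists i, l, (- w ord0 i); split; rewrite 1?eq_sym ?normrN //.
  by rewrite mulmxA.
move=> v; rewrite mulmxA TE row_mul_transvection big_cons.
have -> : (v + (- w ord0 i * v ord0 l) *: delta_mx ord0 i) ord0 l = v ord0 l.
  by rewrite !mxE (negbTE li) andbF mulr0 addr0.
by rewrite scalerDr opprD addrA scalerA mulNr scaleNr [w _ _ * _]mulrC.
Qed.

Lemma delta_row_coord j l : (delta_mx (ord0 : 'I_1) j : 'rV[F]_n) ord0 l = (l == j)%:R.
Proof. by rewrite mxE eqxx. Qed.

(* Pivoting on a coordinate of maximal absolute value keeps the coefficients of
   the transvections in [[-1, 1]]. *)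
Lemma add_axis k (B : 'M[F]_(k, n)) : (#|axes B| < \rank B)%N ->
  exists B' l, [/\ reducible n B B', \rank B' = \rank B, l \notin axes B &
    l |: axes B \subset axes B'].
Proof.
set J := axes B => JB.
pose S := (\sum_(j in J) <<delta_mx (ord0 : 'I_1) j : 'rV[F]_n>>)%MS.
have SB : (S <= B)%MS.
  by apply/sumsmx_subP => j; rewrite inE genmxE.
have nBS : ~~ (B <= S)%MS.
  apply: contraL JB => /mxrankS rBS; rewrite -leqNgt; apply: leq_trans rBS _.
  apply: leq_trans (mxrank_sum_leqif _).1 _ => /=.
  rewrite -sum1_card; apply: leq_sum => j _; rewrite mxrank_gen; exact: rank_leq_row.
have /row_subPn[i0 ni0] := nBS.
set u := row i0 B in ni0.
(* The row [u] lies outside the span of the known axes. Clearing its coordinates in [J] leaves a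
   nonzero vector [w0] of the row space, whose pivot lies outside [J]; the elimination then
   preserves the axes already found. *)
pose uJ := \sum_(j in J) u ord0 j *: (delta_mx ord0 j : 'rV[F]_n).
pose w0 := u - uJ.
have SJ : (uJ <= S)%MS.
  apply: summx_sub => j jJ; apply: scalemx_sub.
  by apply: (sumsmx_sup j) => //; rewrite genmxE.
have w0B : (w0 <= B)%MS.
  apply: addmx_sub; first exact: row_sub.
  by rewrite eqmx_opp; exact: submx_trans SJ SB.
have w0J j : j \in J -> w0 ord0 j = 0.
  move=> jJ; rewrite !mxE summxE (bigD1 j) //= big1 => [|l /andP[_ lj]].
    by rewrite !mxE !eqxx mulr1 addr0 subrr.
  by rewrite !mxE eq_sym (negbTE lj) andbF mulr0.
have w0n0 : w0 != 0.
  by apply: contraNneq ni0 => /eqP; rewrite subr_eq0 => /eqP ->.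
have /rV0Pn[a wa] := w0n0.
pose l := [arg max_(i > a) `|w0 ord0 i|]%O.
have lmax i : `|w0 ord0 i| <= `|w0 ord0 l|.
  by rewrite /l; case: arg_maxP => //= j _ /(_ i isT).
have wl : w0 ord0 l != 0.
  by rewrite -normr_gt0; apply: lt_le_trans (lmax a); rewrite normr_gt0.
pose w := (w0 ord0 l)^-1 *: w0.
have w1 i : `|w ord0 i| <= 1.
  by rewrite mxE normrM normfV mulrC ler_pdivrMr ?normr_gt0 // mul1r.
have lJ : l \notin J by apply: contraNN wl => /w0J ->.
have lrem : l \notin rem l (enum 'I_n) by rewrite mem_rem_uniqF // enum_uniq.
have [T [uT rT TE]] := clear_coordinates B lrem w1.
exists (B *m T), l; split=> //.
- apply: reducible_mono rT; rewrite size_rem ?mem_enum // size_enum_ord.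
  exact: leq_pred.
- by rewrite mxrankMfree // row_free_unit.
have wB : (w <= B)%MS by exact: scalemx_sub.
have wT : w *m T = delta_mx ord0 l.
  rewrite TE mxE mulVf // scale1r rem_filter ?enum_uniq // big_filter.
  rewrite big_enum_cond /=; apply/rowP => j; rewrite delta_row_coord [LHS]mxE [X in _ + X]mxE summxE.
  have [->|jl] := eqVneq j l.
    rewrite big1 ?subr0 => [|i il]; first by rewrite mxE mulVf.
    by rewrite mxE delta_row_coord eq_sym (negbTE il) mulr0.
  rewrite (bigD1 j) //= big1 => [|i /andP[_ ij]].
    by rewrite !mxE !eqxx mulr1 addr0 subrr.
  by rewrite mxE delta_row_coord eq_sym (negbTE ij) mulr0.
apply/fintype.subsetP => j; rewrite !inE => /orP[/eqP ->|jB].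
  by rewrite -wT submxMr.
have jl : j != l by apply: contraNneq lJ => <-; rewrite inE.
suff <- : delta_mx (ord0 : 'I_1) j *m T = delta_mx ord0 j by rewrite submxMr.
by rewrite TE delta_row_coord eq_sym (negbTE jl) scale0r subr0.
Qed.

Lemma exchange_axis k (B : 'M[F]_(k, n)) i j : i \in axes B -> j \notin axes B ->
  exists B', [/\ reducible 2 B B', \rank B' = \rank B &
    j |: (axes B :\ i) \subset axes B'].
Proof.
move=> iB jB; have ij : i != j by apply: contraNneq jB => <-.
have ji : j != i by rewrite eq_sym.
(* [x_j += x_i] maps [e_i] to [e_i + e_j], which [x_i -= x_j] maps to [e_j]. *)
exists (B *m transvection j i 1 *m transvection i j (-1)); split.
- right; exists j, i, 1; split; rewrite ?normr1 //.
  right; exists i, j, (-1); split; rewrite ?normrN1 //.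
- by rewrite !mxrankMfree // row_free_unit transvection_unit.
apply/fintype.subsetP => l; rewrite !inE => /orP[/eqP ->|/andP[li lB]].
  rewrite inE in iB.
  suff <- : delta_mx (ord0 : 'I_1) i *m transvection j i 1 *m transvection i j (-1) =
      delta_mx ord0 j by rewrite -!mulmxA submxMr.
  rewrite !row_mul_transvection; apply/rowP => s; rewrite !mxE !eqxx /=.
  rewrite ?eqxx ?(negbTE ji) ?(negbTE ij) /=; ring.
have lj : l != j by apply: contraNneq jB => <-; rewrite inE.
suff <- : delta_mx (ord0 : 'I_1) l *m transvection j i 1 *m transvection i j (-1) =
    delta_mx ord0 l by rewrite -!mulmxA submxMr.
rewrite !row_mul_transvection; apply/rowP => s; rewrite !mxE !eqxx /=.
rewrite ?(eq_sym _ l) ?(negbTE li) ?(negbTE lj) ?(negbTE ji) ?(negbTE ij) /=; ring.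
Qed.

Lemma reduce_axes k m (B : 'M[F]_(k, n)) : \rank B = k -> (k <= #|axes B| + m)%N ->
  exists B', [/\ reducible (m * n) B B', \rank B' = k & (k <= #|axes B'|)%N].
Proof.
elim: m B => [|m IH] B rB kB.
  by exists B; split; [exact: reducible_refl|exact: rB|rewrite addn0 in kB].
have [kJ|Jk] := leqP k #|axes B|; first by exists B; split; [exact: reducible_refl|exact: rB|].
have := @add_axis k B; rewrite rB => /(_ Jk)[B1 [l [r1 rB1 lB lB1]]].
have [|B' [r' rB' kB']] := IH B1 rB1.
  have := subset_leq_card lB1; rewrite cardsU1 lB add1n => H.
  by apply: leq_trans kB _; rewrite addnS -addSn leq_add2r.
exists B'; split=> //; rewrite mulSn; exact: reducible_trans r1 r'.
Qed.

Lemma exchange_axes k m (B : 'M[F]_(k, n)) : \rank B = k -> (k <= #|axes B|)%N ->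
  (#|[set j : 'I_n | (j < k)%N] :\: axes B| <= m)%N ->
  exists B', [/\ reducible (m * 2) B B', \rank B' = k &
    [set j : 'I_n | (j < k)%N] \subset axes B'].
Proof.
set K := [set j : 'I_n | (j < k)%N].
have cK : (#|K| <= k)%N.
  have : (size (map val (enum K)) <= size (iota 0 k))%N.
    apply: uniq_leq_size; first by rewrite map_inj_uniq ?enum_uniq //; exact: val_inj.
    by move=> x /mapP[j]; rewrite mem_enum inE mem_iota => jk ->.
  by rewrite size_map size_iota -cardE.
elim: m B => [|m IH] B rB kB mB.
  exists B; split; [exact: reducible_refl|exact: rB|].
  by move: mB; rewrite leqn0 cards_eq0 finset.setD_eq0.
have [KB|/subsetPn[j jK jB]] := boolP (K \subset axes B).
  by exists B; split; [exact: reducible_refl|exact: rB|].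
(* There are at least [k] axes and at most [k] wanted ones, so a missing wanted axis leaves an
   unwanted one to trade for it. *)
have /subsetPn[i iB iK] : ~~ (axes B \subset K).
  apply: contraNN jB => BK; suff -> : axes B = K by [].
  by apply/eqP; rewrite eqEcard BK (leq_trans cK).
have [B1 [r1 rB1 sB1]] := exchange_axis iB jB.
have [| | |B' [r' rB' KB']] := IH B1.
- by rewrite rB1.
- apply: leq_trans (subset_leq_card sB1).
  have jBi : j \notin axes B :\ i by rewrite in_setD1 negb_and jB orbT.
  by rewrite cardsU1 jBi add1n -[X in (k <= X)%N]/(1 + #|axes B :\ i|)%N; move: kB; rewrite (cardsD1 i) iB.
- rewrite -ltnS; apply: leq_trans mB.
  apply: proper_card; apply/properP; split.
    apply/fintype.subsetP => l; rewrite !inE => /andP[lB1 lK]; rewrite lK andbT.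
    apply: contraNN lB1 => lB; move/fintype.subsetP: sB1 => /(_ l); rewrite !inE; apply.
    apply/orP; right; rewrite lB andbT; apply: contraNneq iK => <-; by rewrite inE.
  exists j; first by rewrite !inE in jB jK *; rewrite jB.
  rewrite !inE negb_and negbK; apply/orP; left.
  by move/fintype.subsetP: sB1 => /(_ j); rewrite !inE; apply; rewrite eqxx.
exists B'; split=> //.
by rewrite mulSn; exact: reducible_trans r1 r'.
Qed.

(** At most [k] pivots of [n] transvections each, then at most [n] exchanges of two transvections
    each. What matters is that the count does not depend on [B]. *)
Lemma reducible_pid k (B : 'M[F]_(k, n)) : \rank B = k ->
  reducible (k * n + n * 2) B (pid_mx k).
Proof.
move=> rB; have kn : (k <= n)%N by rewrite -{1}rB rank_leq_col.
have [|B1 [r1 rB1 kB1]] := @reduce_axes k k B rB; first by rewrite leq_addl.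
have [|B2 [r2 rB2 KB2]] := @exchange_axes k n B1 rB1 kB1.
  by apply: leq_trans (max_card _) _; rewrite card_ord.
apply: reducible_trans r1 _.
rewrite -[(n * 2)%N]addn0; apply: reducible_trans r2 _ => /=.
apply: eqmx_sym; apply/eqmxP; rewrite -mxrank_leqif_eq.
  by rewrite rB2 rank_pid_mx.
apply/row_subP => i; have ik : (i < n)%N by exact: leq_trans kn.
have -> : row i (pid_mx k : 'M[F]_(k, n)) = delta_mx ord0 (Ordinal ik).
  apply/rowP => j; rewrite !mxE eqxx ltn_ord andbT /=.
  by rewrite eq_sym -val_eqE.
by move/fintype.subsetP: KB2 => /(_ (Ordinal ik)); rewrite !inE; apply => /=.
Qed.

End Transvections.

Local Open Scope classical_set_scope.

(** * Maps of class C^1 *)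

Section ContinuouslyDifferentiable.
Context {R : realType}.
Implicit Types E F G : normedModType R.

Lemma near_eq_diff {E F} (f g : E -> F) x :
  (\forall y \near x, f y = g y) -> differentiable f x ->
  differentiable g x /\ 'd g x = 'd f x :> (E -> F).
Proof.
move=> fg df.
have [cdf dfE] := (diff_locallyP x f).1 df.
have gE : g \o shift x = cst (g x) + 'd f x +o_ 0 id.
  apply/eqaddoP => e e0.
  have /eqaddoP/(_ e e0) := dfE.
  have fg' : \forall y \near (0 : E), f (y + x) = g (y + x).
    by move: fg; rewrite (near_shift 0) subr0.
  move: fg' => /[swap]; apply: filterS2 => y /= + fgy.
  by rewrite /= !fctE /= fgy (nbhs_singleton fg).
have dg : 'd g x = 'd f x :> (E -> F) by apply: diff_unique.
split; last exact: dg.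
by apply/diff_locallyP; rewrite dg; split; [exact: cdf|exact: gE].
Qed.

Lemma near_eq_continuous {S T : topologicalType} (f g : S -> T) x :
  (\forall y \near x, f y = g y) -> {for x, continuous f} -> {for x, continuous g}.
Proof.
move=> fg cf; have fgx : f x = g x := nbhs_singleton fg.
rewrite /continuous_at /prop_for -fgx.
apply: cvg_trans cf; exact: near_eq_cvg.
Qed.

Definition C1pt {E F} (f : E -> F) (x : E) :=
  differentiable f x /\ forall v, {for x, continuous (fun y => 'd f y v)}.

(* An inductive wrapper, to keep unification from unfolding filters. *)
Variant C1at {E F} (f : E -> F) (x : E) : Prop :=
  C1atI of \forall y \near x, C1pt f y.

Lemma C1at_nearpt {E F} (f : E -> F) (x : E) : C1at f x -> \forall y \near x, C1pt f y.
Proof. by case. Qed.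

Lemma C1at_Ck {E F} (f : E -> F) x :
  C1at f x <-> exists U : set E, [/\ open U, U x & Ck 1 U f].
Proof.
split.
  move=> [fx]; have : nbhs x [set y | C1pt f y] := fx.
  rewrite nbhsE => -[U [oU Ux] fU]; exists U; split; [exact: oU|exact: Ux|split].
    by move=> y /fU[].
  by move=> v y /fU[_]; exact.
move=> [U [oU Ux [df cf]]]; constructor; have := open_nbhs_nbhs (conj oU Ux).
by apply: filterS => y Uy; split; [exact: df|move=> v; exact: cf].
Qed.

Lemma C1at_near {E F} (f : E -> F) x : C1at f x -> \forall y \near x, C1at f y.
Proof. by move=> /C1at_nearpt/near_join; apply: filterS => y; constructor. Qed.

Lemma C1at_pt {E F} (f : E -> F) x : C1at f x -> C1pt f x.
Proof. by move=> /C1at_nearpt; exact: nbhs_singleton. Qed.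

Lemma C1at_diff {E F} (f : E -> F) x : C1at f x -> differentiable f x.
Proof. by move=> /C1at_pt[]. Qed.

Lemma C1at_cont {E F} (f : E -> F) x : C1at f x -> {for x, continuous f}.
Proof. by move=> /C1at_diff/differentiable_continuous. Qed.

Lemma C1at_eq {E F} (f g : E -> F) x :
  (\forall y \near x, f y = g y) -> C1at f x -> C1at g x.
Proof.
move=> fg cf; have fg' := near_join fg.
constructor; near=> y.
have fgy : \forall z \near y, f z = g z by near: y.
have [df cdf] : C1pt f y by near: y; exact: C1at_nearpt.
have [dg dgE] := near_eq_diff fgy df.
split; first exact: dg.
move=> v; have fg2 := near_join fgy.
have cg : \forall z \near y, C1at f z by apply: C1at_near; near: y; exact: C1at_near.
apply: near_eq_continuous (cdf v).
near=> z.
have fgz : \forall z' \near z, f z' = g z' by near: z.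
have cz : C1at f z by near: z.
by have [_ ->] := near_eq_diff fgz (C1at_diff cz).
Unshelve. all: by end_near. Qed.

(** A finite spanning family with continuous coefficients. It upgrades the continuity of each
    [y |-> 'd f y v] to joint continuity in [y] and [v], on which the chain rule for C^1 maps
    relies. *)
Definition fin_dim E := exists (I : finType) (b : I -> E) (phi : I -> E -> R),
  (forall i, continuous (phi i)) /\ forall v, v = \sum_i phi i v *: b i.

Lemma continuous_sum_at {T : topologicalType} {E} (t : T) (I : Type) (r : seq I)
    (f : I -> T -> E) : (forall i, {for t, continuous (f i)}) ->
  {for t, continuous (fun s => \sum_(i <- r) f i s)}.
Proof.
move=> cf; elim: r => [|i r IH].
  apply: (@near_eq_continuous _ _ (cst 0)); last exact: cst_continuous.
  by apply: nearW => s; rewrite big_nil.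
apply: (@near_eq_continuous _ _ (fun s => f i s + \sum_(i <- r) f i s)).
  by apply: nearW => s; rewrite big_cons.
by apply: cvgD; [exact: cf|exact: IH].
Qed.

Lemma C1at_diff_jointly {E F} {T : topologicalType} (f : E -> F) (g h : T -> E) (t : T) :
  fin_dim E -> C1at f (g t) -> {for t, continuous g} -> {for t, continuous h} ->
  {for t, continuous (fun s => 'd f (g s) (h s))}.
Proof.
move=> [k [b [phi [cphi bE]]]] cf cg ch.
have -> : (fun s => 'd f (g s) (h s)) =
    (fun s => \sum_i phi i (h s) *: 'd f (g s) (b i)).
  apply/funext => s; rewrite [in LHS](bE (h s)) linear_sum.
  by apply: eq_bigr => i _; rewrite linearZ.
apply: continuous_sum_at => i; apply: cvgZ.
  apply: (@continuous_comp _ _ _ h (phi i)) => //; exact: cphi.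
have [_ /(_ (b i)) c2] := C1at_pt cf.
exact: (@continuous_comp _ _ _ g (fun y => 'd f y (b i))).
Qed.

Lemma C1at_comp {E F G} (f : E -> F) (g : F -> G) x :
  fin_dim F -> C1at f x -> C1at g (f x) -> C1at (g \o f) x.
Proof.
move=> fF cf cg.
have cgf : \forall y \near x, C1at g (f y).
  by apply: (C1at_cont cf); exact: C1at_near.
constructor; near=> y.
have cfy : C1at f y by near: y; exact (C1at_near cf).
have cgy : \forall z \near y, C1at g (f z) by near: y; exact: near_join.
have cgfy := nbhs_singleton cgy.
have dfy := C1at_diff cfy.
split; first by apply: differentiable_comp; [exact: dfy|exact: (C1at_diff cgfy)].
move=> v.
have H : \forall z \near y, 'd g (f z) ('d f z v) = 'd (g \o f) z v.
  near=> z.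
  have dfz : differentiable f z by apply: C1at_diff; near: z; exact (C1at_near cfy).
  have dgz : differentiable g (f z) by apply: C1at_diff; near: z.
  exact (esym (congr1 (fun h => h v) (diff_comp dfz dgz))).
apply: (near_eq_continuous H).
apply: (C1at_diff_jointly fF cgfy (C1at_cont cfy)).
by have [_] := C1at_pt cfy; exact.
Unshelve. all: by end_near. Qed.

Lemma diff_compC1 {E F G} (f : E -> F) (g : F -> G) x v :
  C1at f x -> C1at g (f x) -> 'd (g \o f) x v = 'd g (f x) ('d f x v).
Proof. by move=> /C1at_diff df /C1at_diff dg; rewrite (diff_comp df dg). Qed.

Lemma C1at_lin {E F} (f : {linear E -> F}) x : continuous f -> C1at f x.
Proof.
move=> cf; constructor; apply: nearW => y; split; first exact: linear_differentiable.
move=> v; rewrite (_ : (fun y0 : E => 'd f y0 v) = cst (f v)); first exact: cst_continuous.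
by apply/funext => z; rewrite diff_lin.
Qed.

Lemma C1at_cst {E F} (a : F) (x : E) : C1at (cst a) x.
Proof.
constructor; apply: nearW => y; split; first exact: differentiable_cst.
move=> v; rewrite (_ : (fun y0 : E => 'd (cst a) y0 v) = cst 0); first exact: cst_continuous.
by apply/funext => z; rewrite diff_cst.
Qed.

Lemma C1at_id {E} (x : E) : C1at id x.
Proof. by apply: (@C1at_lin _ _ idfun) => y; exact: cvg_id. Qed.

Lemma C1at_pair {E F G} (f : E -> F) (g : E -> G) x :
  C1at f x -> C1at g x -> C1at (fun y => (f y, g y)) x.
Proof.
move=> cf cg; constructor; near=> y.
have cfy : C1at f y by near: y; exact (C1at_near cf).
have cgy : C1at g y by near: y; exact (C1at_near cg).
split; first by exact (differentiable_pair (C1at_diff cfy) (C1at_diff cgy)).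
move=> v.
have H : \forall z \near y, ('d f z v, 'd g z v) = 'd (fun y => (f y, g y)) z v.
  near=> z.
  have dfz : differentiable f z by apply: C1at_diff; near: z; exact (C1at_near cfy).
  have dgz : differentiable g z by apply: C1at_diff; near: z; exact (C1at_near cgy).
  exact (esym (congr1 (fun h => h v) (diff_pair dfz dgz))).
apply: (near_eq_continuous H).
have [_ c1] := C1at_pt cfy; have [_ c2] := C1at_pt cgy.
by apply: cvg_pair; [exact (c1 v)|exact (c2 v)].
Unshelve. all: by end_near. Qed.

Lemma C1at_fst {E F} (x : E * F) : C1at fst x.
Proof. by apply: (@C1at_lin _ _ fst) => y; exact: cvg_fst. Qed.

Lemma C1at_snd {E F} (x : E * F) : C1at snd x.
Proof. by apply: (@C1at_lin _ _ snd) => y; exact: cvg_snd. Qed.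

Lemma C1at_add {E F} (f g : E -> F) x :
  C1at f x -> C1at g x -> C1at (fun y => f y + g y) x.
Proof.
move=> cf cg; constructor; near=> y.
have cfy : C1at f y by near: y; exact (C1at_near cf).
have cgy : C1at g y by near: y; exact (C1at_near cg).
split; first by exact (differentiableD (C1at_diff cfy) (C1at_diff cgy)).
move=> v.
have H : \forall z \near y, 'd f z v + 'd g z v = 'd (f + g) z v.
  near=> z.
  have dfz : differentiable f z by apply: C1at_diff; near: z; exact (C1at_near cfy).
  have dgz : differentiable g z by apply: C1at_diff; near: z; exact (C1at_near cgy).
  exact (esym (congr1 (fun h => h v) (diffD dfz dgz))).
apply: (near_eq_continuous H).
have [_ c1] := C1at_pt cfy; have [_ c2] := C1at_pt cgy.
by apply: cvgD; [exact (c1 v)|exact (c2 v)].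
Unshelve. all: by end_near. Qed.

Lemma C1at_mul {E} (f g : E -> R) x :
  C1at f x -> C1at g x -> C1at (fun y => f y * g y) x.
Proof.
move=> cf cg; constructor; near=> y.
have cfy : C1at f y by near: y; exact (C1at_near cf).
have cgy : C1at g y by near: y; exact (C1at_near cg).
split; first by exact (differentiableM (C1at_diff cfy) (C1at_diff cgy)).
move=> v.
have H : \forall z \near y, f z * 'd g z v + g z * 'd f z v = 'd (f * g) z v.
  near=> z.
  have dfz : differentiable f z by apply: C1at_diff; near: z; exact (C1at_near cfy).
  have dgz : differentiable g z by apply: C1at_diff; near: z; exact (C1at_near cgy).
  exact (esym (congr1 (fun h => h v) (diffM dfz dgz))).
apply: (near_eq_continuous H).
have [_ c1] := C1at_pt cfy; have [_ c2] := C1at_pt cgy.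
apply: cvgD; [apply: cvgM|apply: cvgM]; [exact (C1at_cont cfy)|exact (c2 v)|exact (C1at_cont cgy)|exact (c1 v)].
Unshelve. all: by end_near. Qed.

Lemma C1at_scale {E F} (f : E -> F) (a : R) x :
  C1at f x -> C1at (fun y => a *: f y) x.
Proof.
move=> cf; constructor; near=> y.
have cfy : C1at f y by near: y; exact (C1at_near cf).
split; first by apply: (@differentiableZ _ _ _ f); exact: C1at_diff.
move=> v.
have H : \forall z \near y, a *: 'd f z v = 'd (a *: f) z v.
  near=> z.
  have dfz : differentiable f z by apply: C1at_diff; near: z; exact (C1at_near cfy).
  exact (esym (congr1 (fun h => h v) (diffZ _ dfz))).
apply: (near_eq_continuous H).
have [_ c1] := C1at_pt cfy.
by apply: cvgZl_tmp; exact: c1.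
Unshelve. all: by end_near. Qed.

Lemma C1at_opp {E F} (f : E -> F) x : C1at f x -> C1at (fun y => - f y) x.
Proof.
move=> /(C1at_scale (-1)); apply: C1at_eq; apply: nearW => y.
by rewrite scaleN1r.
Qed.

Lemma C1at_sub {E F} (f g : E -> F) x :
  C1at f x -> C1at g x -> C1at (fun y => f y - g y) x.
Proof. by move=> cf cg; apply: C1at_add => //; exact: C1at_opp. Qed.

Lemma C1at_sum {E F} (I : Type) (r : seq I) (P : pred I) (f : I -> E -> F) x :
  (forall i, P i -> C1at (f i) x) -> C1at (fun y => \sum_(i <- r | P i) f i y) x.
Proof.
move=> cf; elim: r => [|i r IH].
  by apply: C1at_eq (C1at_cst 0 x); apply: nearW => y; rewrite big_nil.
have [Pi|Pi] := boolP (P i).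
  apply: C1at_eq (C1at_add (cf _ Pi) IH).
  by apply: nearW => y; rewrite big_cons Pi.
apply: C1at_eq IH.
by apply: nearW => y; rewrite big_cons (negbTE Pi).
Qed.

Lemma C1at_inv {E} (f : E -> R) x : f x != 0 ->
  C1at f x -> C1at (fun y => (f y)^-1) x.
Proof.
move=> fx0 cf.
have f0 : \forall y \near x, f y != 0.
  have := C1at_cont cf; move/(_ [set r | r != 0]); apply.
  apply: open_nbhs_nbhs; split => //; exact: open_neq.
have f0' := near_join f0.
constructor; near=> y.
have cfy : C1at f y by near: y; exact (C1at_near cf).
have fy0 : \forall z \near y, f z != 0 by near: y.
split; first by apply: differentiableV; [exact: C1at_diff|exact: nbhs_singleton fy0].
move=> v.
have H : \forall z \near y, - (f z) ^- 2 * 'd f z v = 'd (fun y => (f y)^-1) z v.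
  near=> z.
  have dfz : differentiable f z by apply: C1at_diff; near: z; exact (C1at_near cfy).
  have fz0 : f z != 0 by near: z.
  exact (esym (congr1 (fun h => h v) (diffV dfz fz0))).
apply: (near_eq_continuous H).
have [_ c1] := C1at_pt cfy.
apply: cvgM; last exact: c1.
apply: cvgN; apply: cvgV; first by rewrite expf_neq0 // (nbhs_singleton fy0).
by apply: cvgM; exact: (C1at_cont cfy).
Unshelve. all: by end_near. Qed.

Lemma fin_dim_R : fin_dim R.
Proof.
exists 'I_1, (fun=> 1), (fun=> id); split=> [i x|v]; first exact: cvg_id.
by rewrite big_ord1 /= -[_ *: _]/(v * 1) mulr1.
Qed.

Lemma fin_dim_rV n : fin_dim 'rV[R]_n.
Proof.
exists 'I_n, (fun i => delta_mx ord0 i), (fun i (v : 'rV[R]_n) => v ord0 i); split.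
  by move=> i; exact: coord_continuous.
by move=> v; exact: row_sum_delta.
Qed.

Lemma fin_dim_prod E F : fin_dim E -> fin_dim F -> fin_dim (E * F)%type.
Proof.
move=> [k [b [phi [cphi bE]]]] [k' [b' [phi' [cphi' bE']]]].
exists (k + k')%type,
  (fun i => match i with inl j => (b j, 0) | inr j => (0, b' j) end),
  (fun i v => match i with inl j => phi j v.1 | inr j => phi' j v.2 end).
split.
  case=> j v.
    by apply: (@continuous_comp _ _ _ fst (phi j)); [exact: cvg_fst|exact: cphi].
  by apply: (@continuous_comp _ _ _ snd (phi' j)); [exact: cvg_snd|exact: cphi'].
move=> v; rewrite big_sumType /=.
have E1 : \sum_i phi i v.1 *: (b i, 0 : F) = (v.1, 0).
  rewrite [in RHS](bE v.1); elim/big_ind2: _ => [|x1 x2 y1 y2 -> ->|i _] //.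
    by rewrite -[LHS]/(_, _) /= addr0.
  by rewrite -[LHS]/(_, _) /= scaler0.
have E2 : \sum_i phi' i v.2 *: (0 : E, b' i) = (0, v.2).
  rewrite [in RHS](bE' v.2); elim/big_ind2: _ => [|x1 x2 y1 y2 -> ->|i _] //.
    by rewrite -[LHS]/(_, _) /= addr0.
  by rewrite -[LHS]/(_, _) /= scaler0.
rewrite E1 E2 -[RHS]/(v.1 + 0, 0 + v.2) addr0 add0r; exact: surjective_pairing.
Qed.

Lemma C1at_coord {E} n (f : E -> 'rV[R]_n) x :
  (forall j, C1at (fun y => f y ord0 j) x) -> C1at f x.
Proof.
move=> cf.
have H : C1at (fun y => \sum_(j < n) f y ord0 j *: delta_mx ord0 j : 'rV[R]_n) x.
  apply: C1at_sum => j _.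
  have := @C1at_comp _ _ _ (fun y => f y ord0 j)
    (fun a : R => a *: (delta_mx ord0 j : 'rV[R]_n)) x fin_dim_R (cf j).
  apply.
  have sl : linear (fun a : R => a *: (delta_mx ord0 j : 'rV[R]_n)).
    by move=> a u v; rewrite scalerDl scalerA.
  pose sM := GRing.isLinear.Build _ _ _ _ _ sl.
  pose sL : {linear _ -> _} := HB.pack (fun a : R => a *: (delta_mx ord0 j : 'rV[R]_n)) sM.
  apply: (@C1at_lin _ _ sL); exact: scalel_continuous.
apply: C1at_eq H; apply: nearW => y; exact/esym/row_sum_delta.
Qed.

Lemma C1at_rVcoord n (j : 'I_n) (x : 'rV[R]_n) : C1at (fun y : 'rV[R]_n => y ord0 j) x.
Proof.
have sl : linear (fun y : 'rV[R]_n => y ord0 j : R).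
  by move=> a u v; rewrite !mxE.
pose sM := GRing.isLinear.Build _ _ _ _ _ sl.
pose sL : {linear _ -> _} := HB.pack (fun y : 'rV[R]_n => y ord0 j : R) sM.
apply: (@C1at_lin _ _ sL); exact: coord_continuous.
Qed.

Lemma C1at_R (f f' : R -> R) x :
  (\forall y \near x, is_derive y (1 : R) f (f' y)) ->
  (\forall y \near x, {for y, continuous f'}) -> C1at f x.
Proof.
move=> df cf'; have df' := near_join df.
constructor; near=> y.
have dy : \forall z \near y, is_derive z (1 : R) f (f' z) by near: y.
have cy : {for y, continuous f'} by near: y.
split.
  by apply/derivable1_diffP; have [] := nbhs_singleton dy.
move=> v.
have H : \forall z \near y, v * f' z = 'd f z v.
  apply: filterS dy => z [d1 d2].
  by rewrite deriv1E // derive1E d2.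
apply: (near_eq_continuous H).
by apply: cvgM; [exact: cvg_cst|exact: cy].
Unshelve. all: by end_near. Qed.

Lemma C1at_sqrt {E} (f : E -> R) x : 0 < f x ->
  C1at f x -> C1at (fun y => Num.sqrt (f y)) x.
Proof.
move=> fx cf; apply: (C1at_comp (g := Num.sqrt) fin_dim_R) => //.
have P0 : \forall y \near f x, 0 < y by exact: lt_nbhsr.
apply: (C1at_R (f' := fun y => (2 * Num.sqrt y)^-1)).
  by apply: filterS P0 => y; exact: is_derive1_sqrt.
apply: filterS P0 => y y0; apply: cvgV; first by rewrite mulf_neq0 // gt_eqF // sqrtr_gt0.
by apply: cvgM; [exact: cvg_cst|exact: sqrt_continuous].
Qed.

End ContinuouslyDifferentiable.

(** * C^1 atlases *)

Lemma Cinfty_C1 {R : realType} {E F : normedModType R} (U : set E) (f : E -> F) :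
  Cinfty U f -> Ck 1 U f.
Proof. by move/(_ 1%N). Qed.

Section DerivativeOn.
Context {R : realType} {E F : normedModType R}.

Lemma germ_extensionP (S : set E) (f : E -> F) x g :
  germ_extension (Ck 1) S f x g <->
  C1at g x /\ \forall y \near x, S y -> g y = f y.
Proof.
split.
  move=> [U [oU Ux cU gf]]; split; first by apply/C1at_Ck; exists U.
  have := open_nbhs_nbhs (conj oU Ux).
  by apply: filterS => y Uy Sy; exact: gf.
move=> [/C1at_Ck[U [oU Ux cU]]] ngf.
have : nbhs x [set y | S y -> g y = f y] := ngf.
rewrite nbhsE => -[V [oV Vx] gf].
exists (U `&` V); split; [exact: openI|by split| |].
  case: cU => cU1 cU2; split=> [y [Uy _]|v y [Uy _]]; first exact: cU1.
  exact: (cU2 v y Uy).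
by move=> y Sy [_ Vy]; exact: gf.
Qed.

(** The derivatives agree on the interior of [S], by locality, and then at its limit points, by
    continuity. *)
Lemma diff_eq_closure_interior (S : set E) (g g' : E -> F) x :
  C1at g x -> C1at g' x -> closure (S°) x ->
  (\forall y \near x, S y -> g y = g' y) -> 'd g x = 'd g' x :> (E -> F).
Proof.
move=> cg cg' Sx gg'; apply/funext => v; apply/eqP; rewrite -subr_eq0.
apply/negPn/negP => neq.
pose h y := `|'d g y v - 'd g' y v|.
have ch : {for x, continuous h}.
  apply: cvg_norm; apply: cvgB.
    by have [_ c] := C1at_pt cg; exact (c v).
  by have [_ c] := C1at_pt cg'; exact (c v).
have hx : \forall y \near x, 0 < h y.
  by apply: (ch [set r | 0 < r]); apply: lt_nbhsr; rewrite normr_gt0.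
have H : \forall y \near x, [/\ 0 < h y, C1at g y, C1at g' y & \forall z \near y, S z -> g z = g' z].
  near=> y; split; first by near: y.
  - by near: y; exact (C1at_near cg).
  - by near: y; exact (C1at_near cg').
  - by near: y; exact (near_join gg').
have [] := Sx _ H.
move=> y [Sy [hy gy g'y ggy]].
suff E1 : 'd g y = 'd g' y :> (E -> F) by rewrite /h E1 subrr normr0 ltxx in hy.
have ggy' : \forall z \near y, g' z = g z.
  by move: Sy ggy; apply: filterS2 => z Sz /(_ Sz).
by have [_] := near_eq_diff ggy' (C1at_diff g'y).
Unshelve. all: by end_near. Qed.

(** The extension picked by [xget] is unknown, but by the previous lemma all C^1 extensions have the
    same derivative at such a point. *)
Lemma derivative_onE (S : set E) (f : E -> F) x g :
  closure (S°) x -> C1at g x -> (\forall y \near x, S y -> g y = f y) ->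
  derivative_on S f x = 'd g x.
Proof.
move=> Sx cg gf; rewrite /derivative_on; case: xgetP => [g' _ /germ_extensionP[cg' gf']|].
  apply: (@diff_eq_closure_interior S) => //.
  by move: gf gf'; apply: filterS2 => y h1 h2 Sy; rewrite h1 ?h2.
by move=> /(_ g) []; exact/germ_extensionP.
Qed.

End DerivativeOn.

Section Atlases.
Context {R : realType}.

(** [chart_inv_near] packs the relative openness of the image, the second inverse law and the
    continuity of the inverse into one statement on ordinary neighbourhoods restricted to [X], which
    keeps subspace topologies out of the sequel. *)
Record C1_chart {E : normedModType R} {T : topologicalType} (X : set E)
    (c : chart E T) : Prop := {
  chart_dom_open : open (chart_dom c);
  chart_map_model : forall p, chart_dom c p -> X (chart_map c p);
  chart_mapK : forall p, chart_dom c p -> chart_inv c (chart_map c p) = p;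
  chart_map_cont : forall p, chart_dom c p -> {for p, continuous (chart_map c)};
  chart_inv_near : forall p W, chart_dom c p -> nbhs p W ->
    \forall y \near chart_map c p, X y ->
      [/\ chart_dom c (chart_inv c y), chart_map c (chart_inv c y) = y &
          W (chart_inv c y)]
}.

Section Extensions.
Context {E1 E2 : normedModType R} {T1 T2 : topologicalType}.
Variables (X1 : set E1) (X2 : set E2).
Implicit Types (f : T1 -> T2) (c : chart E1 T1) (d : chart E2 T2).

(* [g] is a C^1 extension of [f] read in charts near [p], beyond the model. *)
Definition is_ext (f : T1 -> T2) (c : chart E1 T1) (d : chart E2 T2) (p : T1)
    (g : E1 -> E2) : Prop :=
  C1at g (chart_map c p) /\
  \forall y \near chart_map c p, X1 y -> g y = chart_map d (f (chart_inv c y)).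

(** For [f = id] this is convertible to the transition derivative in [tangent_space], so that one
    chain rule serves tangent vectors and differentials. *)
Definition Dexpr f c d p : E1 -> E2 :=
  derivative_on (chart_expr_dom f c d) (chart_expr f c d) (chart_map c p).

Lemma is_ext_pt f c d p g : C1_chart X1 c -> chart_dom c p ->
  is_ext f c d p g -> g (chart_map c p) = chart_map d (f p).
Proof.
move=> cc cp [_ /nbhs_singleton ->]; last exact: (chart_map_model cc).
by rewrite (chart_mapK cc).
Qed.

Lemma chart_expr_domS f c d : C1_chart X1 c -> chart_expr_dom f c d `<=` X1.
Proof. by move=> cc _ [p [cp _] <-]; exact: (chart_map_model cc). Qed.

Lemma near_chart_expr_dom f c d p : C1_chart X1 c -> C1_chart X2 d ->
  chart_dom c p -> chart_dom d (f p) -> {for p, continuous f} ->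
  \forall y \near chart_map c p, X1 y -> chart_expr_dom f c d y.
Proof.
move=> cc cd cp dp cf.
have W : nbhs p (f @^-1` chart_dom d).
  by apply: cf; apply: open_nbhs_nbhs; split => //; exact: (chart_dom_open cd).
have := chart_inv_near cc cp W; apply: filterS => y H Xy.
by have [h1 h2 h3] := H Xy; exists (chart_inv c y).
Qed.

Lemma is_ext_germ f c d p g : C1_chart X1 c -> C1_chart X2 d ->
  chart_dom c p -> chart_dom d (f p) -> {for p, continuous f} ->
  is_ext f c d p g <->
  germ_extension (Ck 1) (chart_expr_dom f c d) (chart_expr f c d) (chart_map c p) g.
Proof.
move=> cc cd cp dp cf; split.
  move=> [cg gf]; apply/germ_extensionP; split=> //.
  by apply: filterS gf => y H /(chart_expr_domS cc); exact: H.
move=> /germ_extensionP[cg gf]; split=> //.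
have := near_chart_expr_dom cc cd cp dp cf.
by move: gf; apply: filterS2 => y H1 H2 /H2/H1.
Qed.

(** The domain is a neighbourhood of the point relative to [X1], and inherits from [X1] the density
    of the interior. *)
Lemma chart_expr_dom_acc f c d p : X1 `<=` closure (X1°) -> C1_chart X1 c -> C1_chart X2 d ->
  chart_dom c p -> chart_dom d (f p) -> {for p, continuous f} ->
  closure ((chart_expr_dom f c d)°) (chart_map c p).
Proof.
move=> fX cc cd cp dp cf B nB.
have := near_join (near_chart_expr_dom cc cd cp dp cf).
move=> H; have [y [Xy [By Hy]]] := fX _ (chart_map_model cc cp) _ (filterI nB H).
exists y; split=> //.
by move: Xy Hy; rewrite /interior /=; apply: filterS2 => z Xz /(_ Xz).
Qed.

Lemma DexprE f c d p g : X1 `<=` closure (X1°) -> C1_chart X1 c -> C1_chart X2 d ->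
  chart_dom c p -> chart_dom d (f p) -> {for p, continuous f} ->
  is_ext f c d p g -> Dexpr f c d p = 'd g (chart_map c p).
Proof.
move=> fX cc cd cp dp cf eg.
have /germ_extensionP[cg gf] := (is_ext_germ g cc cd cp dp cf).1 eg.
apply: derivative_onE => //; exact: chart_expr_dom_acc.
Qed.

End Extensions.

(** On the model [g] coincides with a chart expression, hence takes values in [X2], which is where
    [g'] is known to extend [f']. *)
Lemma is_ext_comp {E1 E2 E3 : normedModType R} {T1 T2 T3 : topologicalType}
  (X1 : set E1) (X2 : set E2) (f : T1 -> T2) (f' : T2 -> T3)
  (c : chart E1 T1) (d : chart E2 T2) (e : chart E3 T3) p g g' :
  fin_dim E2 -> C1_chart X1 c -> C1_chart X2 d ->
  chart_dom c p -> chart_dom d (f p) -> {for p, continuous f} ->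
  is_ext X1 f c d p g -> is_ext X2 f' d e (f p) g' ->
  is_ext X1 (f' \o f) c e p (g' \o g).
Proof.
move=> f2 cc cd cp dp cf eg eg'.
have gx := is_ext_pt cc cp eg.
case: eg eg' => cg gf [cg' gf']; split.
  by apply: C1at_comp => //; rewrite gx.
have gf'' : \forall y \near chart_map c p, X2 (g y) -> g' (g y) = chart_map e (f' (chart_inv d (g y))).
  by rewrite -gx in gf'; exact: (C1at_cont cg gf').
have W : nbhs p (f @^-1` chart_dom d).
  by apply: cf; apply: open_nbhs_nbhs; split => //; exact: (chart_dom_open cd).
have W' := chart_inv_near cc cp W.
near=> y => Xy.
have gy : g y = chart_map d (f (chart_inv c y)) by move: Xy; near: y.
have [q1 q2 q3] : [/\ chart_dom c (chart_inv c y), chart_map c (chart_inv c y) = y &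
          (f @^-1` chart_dom d) (chart_inv c y)] by move: Xy; near: y.
have g'y : X2 (g y) -> g' (g y) = chart_map e (f' (chart_inv d (g y))) by near: y.
rewrite /= g'y gy; last exact: (chart_map_model cd).
by rewrite (chart_mapK cd).
Unshelve. all: by end_near. Qed.

(** The C^1 content of a smooth atlas, in a form that also covers vector spaces, products and the
    ball. [atlas_fat] makes derivatives at boundary points independent of the extension. *)
Record C1_atlas {E : normedModType R} {T : topologicalType} (X : set E)
    (A : set (chart E T)) : Prop := {
  atlas_fin : fin_dim E;
  atlas_fat : X `<=` closure (X°);
  atlas_chart : forall c, A c -> C1_chart X c;
  atlas_cover : forall p, exists2 c, A c & chart_dom c p;
  atlas_trans : forall c c' p, A c -> A c' -> chart_dom c p -> chart_dom c' p ->
    exists g, is_ext X id c c' p g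
}.

Definition C1_near {E1 E2 : normedModType R} {T1 T2 : topologicalType} (X1 : set E1)
    (A1 : set (chart E1 T1)) (A2 : set (chart E2 T2)) (f : T1 -> T2) (p : T1) : Prop :=
  {for p, continuous f} /\
  forall c d, chart_at A1 p c -> chart_at A2 (f p) d -> exists g, is_ext X1 f c d p g.

Section C1Maps.
Context {E1 E2 E3 : normedModType R} {T1 T2 T3 : topologicalType}.
Context {X1 : set E1} {X2 : set E2} {X3 : set E3}.
Context {A1 : set (chart E1 T1)} {A2 : set (chart E2 T2)} {A3 : set (chart E3 T3)}.
Hypotheses (at1 : C1_atlas X1 A1) (at2 : C1_atlas X2 A2) (at3 : C1_atlas X3 A3).

Lemma C1_mapP (f : T1 -> T2) :
  C1_map A1 A2 f <-> forall p, C1_near X1 A1 A2 f p.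
Proof.
split.
  move=> [cf rf] p; split; first exact: cf.
  move=> c d [Ac cp] [Ad dp].
  have [|g gf] := rf c d Ac Ad (chart_map c p); first by exists p.
  exists g; apply/(is_ext_germ _ (atlas_chart at1 Ac) (atlas_chart at2 Ad)) => //.
  exact: cf.
move=> H; split; first by move=> p; have [] := H p.
move=> c d Ac Ad _ [p [cp dp] <-].
have [cf /(_ c d (conj Ac cp) (conj Ad dp)) [g eg]] := H p.
exists g; exact/(is_ext_germ _ (atlas_chart at1 Ac) (atlas_chart at2 Ad)).
Qed.

(** One pair of charts suffices, since the others differ by transition maps composed on both
    sides. *)
Lemma C1_near_intro (f : T1 -> T2) p c d g :
  {for p, continuous f} -> chart_at A1 p c -> chart_at A2 (f p) d ->
  is_ext X1 f c d p g -> C1_near X1 A1 A2 f p.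
Proof.
move=> cf [Ac cp] [Ad dp] eg; split=> // c' d' [Ac' cp'] [Ad' dp'].
have [t et] := atlas_trans at1 Ac' Ac cp' cp.
have [t' et'] := atlas_trans at2 Ad Ad' dp dp'.
exists (t' \o (g \o t)).
have cid : {for p, continuous (@id T1)} by exact: (@cvg_id T1).
have e1 : is_ext X1 (f \o id) c' d p (g \o t) :=
  is_ext_comp (atlas_fin at1) (atlas_chart at1 Ac') (atlas_chart at1 Ac) cp' cp cid et eg.
exact: (is_ext_comp (atlas_fin at2) (atlas_chart at1 Ac') (atlas_chart at2 Ad)
  cp' dp cf e1 et').
Qed.

Lemma C1_near_eq (f f' : T1 -> T2) p :
  (\forall q \near p, f q = f' q) -> C1_near X1 A1 A2 f p -> C1_near X1 A1 A2 f' p.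
Proof.
move=> ff [cf ef]; split; first exact: near_eq_continuous ff cf.
rewrite -(nbhs_singleton ff) => c d [Ac cp] [Ad dp].
have [g [cg eg]] := ef c d (conj Ac cp) (conj Ad dp).
exists g; split=> //.
have := chart_inv_near (atlas_chart at1 Ac) cp ff.
by move: eg; apply: filterS2 => y H1 H2 Xy; have [_ _ <-] := H2 Xy; exact: H1.
Qed.

Lemma C1_near_comp (f : T1 -> T2) (f' : T2 -> T3) p :
  C1_near X1 A1 A2 f p -> C1_near X2 A2 A3 f' (f p) -> C1_near X1 A1 A3 (f' \o f) p.
Proof.
move=> [cf ef] [cf' ef']; split; first exact: continuous_comp.
move=> c e [Ac cp] [Ae ep].
have [d Ad dp] := atlas_cover at2 (f p).
have [g eg] := ef c d (conj Ac cp) (conj Ad dp).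
have [g' eg'] := ef' d e (conj Ad dp) (conj Ae ep).
exists (g' \o g).
exact: (is_ext_comp (atlas_fin at2) (atlas_chart at1 Ac) (atlas_chart at2 Ad) cp dp cf eg eg').
Qed.

Lemma Dexpr_comp (f : T1 -> T2) (f' : T2 -> T3) p c d e v :
  C1_near X1 A1 A2 f p -> C1_near X2 A2 A3 f' (f p) ->
  chart_at A1 p c -> chart_at A2 (f p) d -> chart_at A3 (f' (f p)) e ->
  Dexpr (f' \o f) c e p v = Dexpr f' d e (f p) (Dexpr f c d p v).
Proof.
move=> [cf ef] [cf' ef'] [Ac cp] [Ad dp] [Ae ep].
have [g eg] := ef c d (conj Ac cp) (conj Ad dp).
have [g' eg'] := ef' d e (conj Ad dp) (conj Ae ep).
have cc := atlas_chart at1 Ac; have cd := atlas_chart at2 Ad.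
have ce := atlas_chart at3 Ae.
have egg := is_ext_comp (atlas_fin at2) cc cd cp dp cf eg eg'.
rewrite (DexprE (atlas_fat at1) cc ce cp ep _ egg); last exact: continuous_comp.
rewrite (DexprE (atlas_fat at1) cc cd cp dp cf eg).
rewrite (DexprE (atlas_fat at2) cd ce dp ep cf' eg').
case: (eg) (eg') => cg _ [cg' _].
by rewrite -(is_ext_pt cc cp eg) in cg' *; exact: diff_compC1.
Qed.

Lemma C1_near_cst (a : T2) p : C1_near X1 A1 A2 (cst a) p.
Proof.
have [c Ac cp] := atlas_cover at1 p.
have [d Ad dp] := atlas_cover at2 a.
apply: (@C1_near_intro _ _ c d (cst (chart_map d a))) => //.
  exact: cst_continuous.
split; first exact: C1at_cst.
by apply: nearW => y.
Qed.

Lemma Dexpr_lin (f : T1 -> T2) p c d :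
  C1_near X1 A1 A2 f p -> chart_at A1 p c -> chart_at A2 (f p) d ->
  exists D : {linear E1 -> E2}, Dexpr f c d p = D.
Proof.
move=> [cf ef] [Ac cp] [Ad dp].
have [g eg] := ef c d (conj Ac cp) (conj Ad dp).
exists ('d g (chart_map c p)).
by rewrite (DexprE (atlas_fat at1) (atlas_chart at1 Ac) (atlas_chart at2 Ad) cp dp cf eg).
Qed.

End C1Maps.

Section Identity.
Context {E : normedModType R} {T : topologicalType} {X : set E} {A : set (chart E T)}.
Hypothesis (at1 : C1_atlas X A).

Lemma C1_near_id p : C1_near X A A id p.
Proof.
split; first exact: cvg_id.
by move=> c d [Ac cp] [Ad dp]; exact: (atlas_trans at1).
Qed.

Lemma Dexpr_id p c v : chart_at A p c -> Dexpr id c c p v = v.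
Proof.
move=> [Ac cp]; have cc := atlas_chart at1 Ac.
have cid : {for p, continuous (@id T)} by exact: (@cvg_id T).
have eid : is_ext X id c c p id.
  split; first exact: C1at_id.
  have nT : nbhs p [set: T] by exact: filterT.
  have := chart_inv_near cc cp nT.
  by apply: filterS => y H Xy; have [_ ->] := H Xy.
rewrite (DexprE (atlas_fat at1) cc cc cp cp cid eid).
by rewrite (@diff_lin _ _ _ idfun) // => y; exact: (@cvg_id E).
Qed.

End Identity.

Section Tangent.
Context {E : normedModType R} {T : topologicalType} {X : set E} {A : set (chart E T)}.
Hypothesis (at1 : C1_atlas X A).

(** The other components are the images of [e] under the transitions; their compatibility is the
    chain rule for [id \o id]. *)
Lemma tangent_lift p c e : chart_at A p c ->
  exists2 v, tangent_space A p v & v c = e.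
Proof.
move=> cp.
exists (fun c' => if `[< chart_at A p c' >] then Dexpr id c c' p e else 0); last first.
  by rewrite asboolT // (Dexpr_id at1).
split=> [c' nc'|c1 c2 c1p c2p]; first by rewrite asboolF.
rewrite !asboolT //.
exact: (Dexpr_comp at1 at1 at1 _ (C1_near_id at1 p) (C1_near_id at1 p) cp c1p c2p).
Qed.

Lemma tangent_ext p c v w : chart_at A p c ->
  tangent_space A p v -> tangent_space A p w -> v c = w c -> v = w.
Proof.
move=> cp [v0 v1] [w0 w1] vw; apply/funext => c'.
have [c'p|c'p] := pselect (chart_at A p c'); last by rewrite v0 // w0.
by rewrite (v1 c c') // (w1 c c') // vw.
Qed.

Lemma tangent_sum p (I : finType) (a : I -> R) (v : I -> chart E T -> E) :
  (forall i, tangent_space A p (v i)) ->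
  tangent_space A p (\sum_i a i *: v i).
Proof.
move=> tv.
have sumE c : (\sum_i a i *: v i) c = \sum_i a i *: v i c by rewrite fct_sumE.
split=> [c nc|c c' cp c'p].
  by rewrite sumE big1 // => i _; rewrite (tv i).1 // scaler0.
have [D DE] := Dexpr_lin at1 at1 (C1_near_id at1 p) cp c'p.
rewrite -[derivative_on _ _ _]/(Dexpr id c c' p) DE !sumE linear_sum.
apply: eq_bigr => i _; rewrite linearZ; congr (_ *: _).
by rewrite ((tv i).2 c c') // -[derivative_on _ _ _]/(Dexpr id c c' p) DE.
Qed.

End Tangent.

Section Differential.
Context {E1 E2 E3 : normedModType R} {T1 T2 T3 : topologicalType}.
Context {X1 : set E1} {X2 : set E2} {X3 : set E3}.
Context {A1 : set (chart E1 T1)} {A2 : set (chart E2 T2)} {A3 : set (chart E3 T3)}.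
Hypotheses (at1 : C1_atlas X1 A1) (at2 : C1_atlas X2 A2) (at3 : C1_atlas X3 A3).

Lemma differential_intro (f : T1 -> T2) p c d v w :
  C1_near X1 A1 A2 f p -> chart_at A1 p c -> chart_at A2 (f p) d ->
  tangent_space A1 p v -> tangent_space A2 (f p) w ->
  w d = Dexpr f c d p (v c) -> differential A1 A2 f p v w.
Proof.
move=> cf cp dp tv tw wv; split=> // c' d' c'p d'p.
have cfid : C1_near X1 A1 A2 (f \o id) p by [].
rewrite (tw.2 d d') // wv (tv.2 c' c) //.
rewrite -[LHS]/(Dexpr id d d' (f p) (Dexpr f c d p (Dexpr id c' c p (v c')))).
rewrite -[Dexpr f c d p _](Dexpr_comp at1 at1 at2 _ (C1_near_id at1 p) cf c'p cp dp).
exact: (esym (Dexpr_comp at1 at2 at2 _ cfid (C1_near_id at2 (f p)) c'p dp d'p)).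
Qed.

Lemma differential_ex (f : T1 -> T2) p v :
  C1_near X1 A1 A2 f p -> tangent_space A1 p v -> exists w, differential A1 A2 f p v w.
Proof.
move=> cf tv.
have [c Ac cp] := atlas_cover at1 p; have [d Ad dp] := atlas_cover at2 (f p).
have [w tw we] := tangent_lift at2 (Dexpr f c d p (v c)) (conj Ad dp).
by exists w; exact: (differential_intro cf (conj Ac cp) (conj Ad dp)).
Qed.

Lemma differential_uniq (f : T1 -> T2) p v w w' :
  differential A1 A2 f p v w -> differential A1 A2 f p v w' -> w = w'.
Proof.
move=> [tw w1] [tw' w2].
have [c Ac cp] := atlas_cover at1 p; have [d Ad dp] := atlas_cover at2 (f p).
apply: (tangent_ext (conj Ad dp) tw tw').
by rewrite (w1 c d (conj Ac cp) (conj Ad dp)) (w2 c d (conj Ac cp) (conj Ad dp)).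
Qed.

Lemma differential_comp (f : T1 -> T2) (f' : T2 -> T3) p v w u :
  C1_near X1 A1 A2 f p -> C1_near X2 A2 A3 f' (f p) -> tangent_space A1 p v ->
  differential A1 A2 f p v w -> differential A2 A3 f' (f p) w u ->
  differential A1 A3 (f' \o f) p v u.
Proof.
move=> cf cf' tv [tw wv] [tu uw]; split=> // c e cp ep.
have [d Ad dp] := atlas_cover at2 (f p).
rewrite (uw d e (conj Ad dp) ep) (wv c d cp (conj Ad dp)).
exact: (esym (Dexpr_comp at1 at2 at3 _ cf cf' cp (conj Ad dp) ep)).
Qed.

End Differential.

End Atlases.

Lemma near_fst {T1 T2 : topologicalType} (p : T1 * T2) (P : set T1) :
  (\forall x \near p.1, P x) -> \forall y \near p, P y.1.
Proof. by move=> H; exact: (@cvg_fst _ _ (nbhs p.1) (nbhs p.2) _ P H). Qed.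

Lemma near_snd {T1 T2 : topologicalType} (p : T1 * T2) (P : set T2) :
  (\forall x \near p.2, P x) -> \forall y \near p, P y.2.
Proof. by move=> H; exact: (@cvg_snd _ _ (nbhs p.1) (nbhs p.2) _ P H). Qed.

Section AtlasInstances.
Context {R : realType}.

Lemma is_chart_C1 {E : normedModType R} {T : topologicalType} (X : set E) (c : chart E T) :
  is_chart X c -> C1_chart X c.
Proof.
move=> [oc [V oV imc] ck cc ci]; split=> //.
- by move=> p cp; have [] : (V `&` X) (chart_map c p) by rewrite -imc; exists p.
- move=> p cp; move: cc; rewrite continuous_open_subspace // => cc.
  by apply: cc; rewrite inE.
move=> p W cp Wp.
have imp : (chart_map c @` chart_dom c) (chart_map c p) by exists p.
have Vp : V (chart_map c p) by move: imp; rewrite imc => -[].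
have Wp' : nbhs (chart_inv c (chart_map c p)) W by rewrite ck.
have := ci (chart_map c p) W Wp'.
rewrite -[X in X -> _]/(nbhs_subspace (A := chart_map c @` chart_dom c) (chart_map c p)
  (chart_inv c @^-1` W)) -nbhs_subspace_in // imc => H.
have nV : nbhs (chart_map c p) V by apply: open_nbhs_nbhs.
have {}H : \forall y \near chart_map c p, (V `&` X) y -> W (chart_inv c y) := H.
move: H nV; apply: filterS2 => y H Vy Xy.
have : (chart_map c @` chart_dom c) y by rewrite imc.
move=> [q cq qy]; rewrite -qy ck //; split=> //.
by have := H (conj Vy Xy); rewrite /= -qy ck.
Qed.

Lemma smooth_atlas_C1 {E : normedModType R} {T : topologicalType} (X : set E)
    (A : set (chart E T)) :
  fin_dim E -> X `<=` closure (X°) -> smooth_atlas X A -> C1_atlas X A.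
Proof.
move=> fE fX [cA covA tA]; split=> //.
  by move=> c /cA; exact: is_chart_C1.
move=> c c' p Ac Ac' cp c'p.
have [|g [U [oU Up cU gf]]] := tA c c' Ac Ac' (chart_map c p); first by exists p.
have cid : {for p, continuous (@id T)} by exact: (@cvg_id T).
exists g; apply/(is_ext_germ g (is_chart_C1 (cA _ Ac)) (is_chart_C1 (cA _ Ac')) cp c'p cid).
by exists U; split=> //; exact: Cinfty_C1.
Qed.

Section Product.
Context {E1 E2 : normedModType R} {T1 T2 : topologicalType}.
Context {X1 : set E1} {X2 : set E2}.
Context {A1 : set (chart E1 T1)} {A2 : set (chart E2 T2)}.
Hypotheses (at1 : C1_atlas X1 A1) (at2 : C1_atlas X2 A2).

Lemma prod_chart_C1 c1 c2 : C1_chart X1 c1 -> C1_chart X2 c2 ->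
  C1_chart (X1 `*` X2) (@prod_chart R E1 E2 T1 T2 c1 c2).
Proof.
move=> h1 h2; split.
- rewrite openE => -[p1 p2] [/= c1p c2p]; exists (chart_dom c1, chart_dom c2) => //=.
  by split; apply: open_nbhs_nbhs; split=> //; [exact: (chart_dom_open h1)|exact: (chart_dom_open h2)].
- by move=> p [c1p c2p]; split; [exact: (chart_map_model h1)|exact: (chart_map_model h2)].
- by move=> [p1 p2] [/= c1p c2p]; rewrite (chart_mapK h1 c1p) (chart_mapK h2 c2p).
- move=> [p1 p2] [/= c1p c2p].
  apply: cvg_pair.
    by apply: (@continuous_comp _ _ _ fst (chart_map c1)); [exact: cvg_fst|exact: (chart_map_cont h1 c1p)].
  by apply: (@continuous_comp _ _ _ snd (chart_map c2)); [exact: cvg_snd|exact: (chart_map_cont h2 c2p)].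
move=> [p1 p2] W [/= c1p c2p] [[W1 W2] /= [n1 n2] W12].
have H1 := chart_inv_near h1 c1p n1; have H2 := chart_inv_near h2 c2p n2.
have K1 := near_fst (p := (chart_map c1 p1, chart_map c2 p2)) H1.
have K2 := near_snd (p := (chart_map c1 p1, chart_map c2 p2)) H2.
near=> y.
have L1 : X1 y.1 -> [/\ chart_dom c1 (chart_inv c1 y.1),
  chart_map c1 (chart_inv c1 y.1) = y.1 & W1 (chart_inv c1 y.1)] by near: y.
have L2 : X2 y.2 -> [/\ chart_dom c2 (chart_inv c2 y.2),
  chart_map c2 (chart_inv c2 y.2) = y.2 & W2 (chart_inv c2 y.2)] by near: y.
move=> [/= Xy1 Xy2].
have [a1 a2 a3] := L1 Xy1; have [b1 b2 b3] := L2 Xy2.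
split=> //=; last by apply: W12.
by rewrite a2 b2 -surjective_pairing.
Unshelve. all: by end_near. Qed.

Lemma C1_atlas_prod : C1_atlas (X1 `*` X2) (prod_atlas A1 A2).
Proof.
split.
- exact: fin_dim_prod (atlas_fin at1) (atlas_fin at2).
- move=> [x1 x2] [/= Xx1 Xx2] B [[B1 B2] /= [n1 n2] B12].
  have [y1 [Y1 By1]] := atlas_fat at1 Xx1 n1.
  have [y2 [Y2 By2]] := atlas_fat at2 Xx2 n2.
  exists (y1, y2); split; last exact: B12.
  by exists (X1, X2).
- by move=> _ [c1 Ac1 [c2 Ac2 <-]]; apply: prod_chart_C1; [exact: (atlas_chart at1)|exact: (atlas_chart at2)].
- move=> p; have [c1 Ac1 c1p] := atlas_cover at1 p.1; have [c2 Ac2 c2p] := atlas_cover at2 p.2.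
  by exists (prod_chart c1 c2) => //; exists c1 => //; exists c2.
move=> _ _ p [c1 Ac1 [c2 Ac2 <-]] [d1 Ad1 [d2 Ad2 <-]] [/= c1p c2p] [/= d1p d2p].
have [g1 [cg1 eg1]] := atlas_trans at1 Ac1 Ad1 c1p d1p.
have [g2 [cg2 eg2]] := atlas_trans at2 Ac2 Ad2 c2p d2p.
exists (fun y => (g1 y.1, g2 y.2)); split.
  apply: C1at_pair.
    apply: (@C1at_comp _ _ _ _ fst g1) => //; [exact: (atlas_fin at1)|exact: C1at_fst].
  apply: (@C1at_comp _ _ _ _ snd g2) => //; [exact: (atlas_fin at2)|exact: C1at_snd].
move: (near_fst (p := (chart_map c1 p.1, chart_map c2 p.2)) eg1)
  (near_snd (p := (chart_map c1 p.1, chart_map c2 p.2)) eg2).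
by apply: filterS2 => y /= h1 h2 [/= X1y X2y]; rewrite h1 // h2.
Qed.

Lemma C1_near_fst p : C1_near (X1 `*` X2) (prod_atlas A1 A2) A1 fst p.
Proof.
have [c1 Ac1 c1p] := atlas_cover at1 p.1; have [c2 Ac2 c2p] := atlas_cover at2 p.2.
apply: (C1_near_intro (c := prod_chart c1 c2) (d := c1) (g := fst) C1_atlas_prod at1) => //.
- exact: cvg_fst.
- by split=> //; exists c1 => //; exists c2.
split; first exact: C1at_fst.
have nT : nbhs p.1 [set: T1] by exact: filterT.
have := near_fst (p := (chart_map c1 p.1, chart_map c2 p.2)) (chart_inv_near (atlas_chart at1 Ac1) c1p nT).
by apply: filterS => y H [/H[_ /= -> _]].
Qed.

Lemma C1_near_snd p : C1_near (X1 `*` X2) (prod_atlas A1 A2) A2 snd p.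
Proof.
have [c1 Ac1 c1p] := atlas_cover at1 p.1; have [c2 Ac2 c2p] := atlas_cover at2 p.2.
apply: (C1_near_intro (c := prod_chart c1 c2) (d := c2) (g := snd) C1_atlas_prod at2) => //.
- exact: cvg_snd.
- by split=> //; exists c1 => //; exists c2.
split; first exact: C1at_snd.
have nT : nbhs p.2 [set: T2] by exact: filterT.
have := near_snd (p := (chart_map c1 p.1, chart_map c2 p.2)) (chart_inv_near (atlas_chart at2 Ac2) c2p nT).
by apply: filterS => y H [_ /H[_ /= -> _]].
Qed.

Lemma C1_near_pair {E : normedModType R} {T : topologicalType} {X : set E}
    {A : set (chart E T)} (f : T -> T1) (g : T -> T2) p : C1_atlas X A ->
  C1_near X A A1 f p -> C1_near X A A2 g p ->
  C1_near X A (prod_atlas A1 A2) (fun q => (f q, g q)) p.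
Proof.
move=> at0 [cf ef] [cg eg]; split; first exact: cvg_pair.
move=> c _ cp [[d1 Ad1 [d2 Ad2 <-]] [/= d1p d2p]].
have [h1 [ch1 e1]] := ef c d1 cp (conj Ad1 d1p).
have [h2 [ch2 e2]] := eg c d2 cp (conj Ad2 d2p).
exists (fun y => (h1 y, h2 y)); split; first exact: C1at_pair.
by move: e1 e2; apply: filterS2 => y k1 k2 Xy /=; rewrite k1 // k2.
Qed.

End Product.

Section VectorSpace.

(** Spaces of parameters are manifolds with a single chart, so that the lemmas on [C1_near] apply to
    families of maps. *)
Definition vect_chart (E : normedModType R) : chart E E := Chart setT id id.
Definition vect_atlas (E : normedModType R) : set (chart E E) := [set vect_chart E].

Lemma C1_atlas_vect (E : normedModType R) : fin_dim E -> C1_atlas setT (@vect_atlas E).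
Proof.
move=> fE; split=> //.
- by move=> x _; rewrite interiorT; exact: subset_closure.
- move=> _ ->; split=> //; first exact: openT.
    by move=> p _; exact: (@cvg_id E).
  by move=> p W _; apply: filterS => y Wy _.
- by move=> p; exists (vect_chart E).
move=> _ _ p -> -> _ _; exists id; split; first exact: C1at_id.
by apply: nearW.
Qed.

Lemma C1_near_vect (E F : normedModType R) (f : E -> F) x :
  C1at f x -> C1_near setT (@vect_atlas E) (@vect_atlas F) f x.
Proof.
move=> cf; split; first exact: C1at_cont.
move=> _ _ [-> _] [-> _]; exists f; split=> //.
exact: nearW.
Qed.

End VectorSpace.

End AtlasInstances.

(** * A flow on the line *)

Section LineFlow.
Context {R : realType}.
Implicit Types (s x u z : R).

(** A cutoff of class C^1: it vanishes to second order at 0, with derivative [2 max(0, u)]. *)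
Definition sqpos u : R := (Num.max 0 u) ^+ 2.

Lemma sqpos_gt0 u : 0 < u -> sqpos u = u ^+ 2.
Proof. by move=> u0; rewrite /sqpos max_r // ltW. Qed.

Lemma sqpos_le0 u : u <= 0 -> sqpos u = 0.
Proof. by move=> u0; rewrite /sqpos max_l // expr0n. Qed.

Lemma max0_continuous : continuous (Num.max 0 : R -> R).
Proof.
by move=> x; apply: (@continuous_max _ _ (cst 0) id); [exact: cvg_cst|exact: cvg_id].
Qed.

Lemma is_derive_sqpos u : is_derive u (1 : R) sqpos (2 * Num.max 0 u).
Proof.
have [u0|u0|->] := ltgtP u 0.
- apply: (@near_eq_is_derive _ _ _ (cst 0)).
    by near=> y; rewrite sqpos_le0 //; apply/ltW; near: y; exact: lt_nbhsl.
  by apply: is_derive_eq; rewrite ?max_l ?mulr0 // ltW.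
- apply: (@near_eq_is_derive _ _ _ (fun y : R => y ^+ 2 : R)).
    by near=> y; rewrite sqpos_gt0 //; near: y; exact: lt_nbhsr.
  apply: is_derive_eq.
  by rewrite /= -[u%:A]/(u * 1) mulr1 mulr_natl mulr2n.
have -> : 2 * 0 = 0 :> R by rewrite mulr0.
have H : h^-1 *: ((sqpos \o shift 0) (h *: 1) - sqpos 0) @[h --> (0 : R)^'] --> (0 : R).
  have c0 : Num.max 0 h @[h --> (0 : R)^'] --> (0 : R).
    apply: cvg_trans (cvg_app _ (@nbhs_dnbhs _ (0 : R))) _.
    by rewrite -[X in _ --> X](maxxx (0 : R)); exact: max0_continuous.
  apply: cvg_trans c0; apply: near_eq_cvg; near=> h.
  have h0 : h != 0 by near: h; exact: nbhs_dnbhs_neq.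
  rewrite /= (sqpos_le0 (lexx 0)) subr0 addr0 -[h *: 1]/(h * 1) mulr1.
  rewrite -[_ *: _]/(_ * _) /sqpos.
  have [|hp] := leP h 0; first by rewrite expr0n mulr0.
  by rewrite expr2 mulKf.
split; first by apply/cvg_ex; exists 0; exact: H.
by apply: (cvg_lim _ H); exact: norm_hausdorff.
Unshelve. all: by end_near. Qed.

Lemma C1at_sqpos {E : normedModType R} (f : E -> R) y : C1at f y ->
  C1at (fun y => sqpos (f y)) y.
Proof.
move=> cf; apply: (C1at_comp (g := sqpos) fin_dim_R cf).
apply: (C1at_R (f' := fun u => 2 * Num.max 0 u)).
  by near=> u; exact: is_derive_sqpos.
near=> u; apply: cvgM; [exact: cvg_cst|exact: max0_continuous].
Unshelve. all: by end_near. Qed.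

(* The flow of the vector field [(1 - x^2)^2 / (1 + x^2)] on [(-1, 1)], which
   [x / (1 - x^2)] conjugates to translations, extended by the identity. *)
Definition flow_den s x : R :=
  let u := 1 - x ^+ 2 in let z := x + s * u in
  u + Num.sqrt (u ^+ 2 + 4 * z ^+ 2) + 2 * x * z.
(** Solving [y/(1 - y^2) = x/u + s = z/u] gives [y = 2z/(u + sqrt(u^2 + 4z^2))]. This is the
    difference quotient [(y - x)/s], rewritten so that no denominator vanishes at [s = 0] or at
    [x^2 = 1]; at [s = 0] it is the velocity. *)
Definition flow_speed s x : R := 2 * sqpos (1 - x ^+ 2) / flow_den s x.
Definition flow s x : R := x + s * flow_speed s x.

(** The radicand must be positive for the square root to be C^1. Its two terms do not vanish
    together: [u = 0] forces [z = x] and [x^2 = 1]. *)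
Lemma flow_root_gt0 s x (u := 1 - x ^+ 2) (z := x + s * u) :
  0 < u ^+ 2 + 4 * z ^+ 2.
Proof.
have [u0|u0] := eqVneq u 0; last first.
  have : 0 < u ^+ 2 by rewrite exprn_even_gt0 //= u0.
  by have := sqr_ge0 z; lra.
have -> : z = x by rewrite /z u0 mulr0 addr0.
have : x ^+ 2 = 1 by rewrite /u in u0; lra.
by move=> ->; rewrite u0; lra.
Qed.

Lemma root_ge (u z : R) : 2 * `|z| <= Num.sqrt (u ^+ 2 + 4 * z ^+ 2).
Proof.
rewrite -[leLHS]ger0_norm ?mulr_ge0 // -sqrtr_sqr ler_wsqrtr //.
by rewrite exprMn real_normK ?num_real //; have := sqr_ge0 u; lra.
Qed.

(** The square root dominates [2|z|], hence [-2xz], which leaves at least [u]. If [u = 0], then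
    [2xz = 2x^2 = 2] is positive by itself. *)
Lemma flow_den_gt0 s x : x ^+ 2 <= 1 -> 0 < flow_den s x.
Proof.
move=> x1; rewrite /flow_den; set u := 1 - x ^+ 2; set z := x + s * u.
have xz : `|x * z| <= `|z|.
  rewrite normrM ler_piMl // -(@expr_le1 _ 2) // real_normK ?num_real //.
have := root_ge u z; set r := Num.sqrt _ => rz.
have [u0|u0] := eqVneq u 0; last first.
  have {}u0 : 0 < u by rewrite lt_neqAle eq_sym u0 /u subr_ge0.
  have : - `|x * z| <= x * z by rewrite lerNnormlW.
  by lra.
have zx : z = x by rewrite /z u0 mulr0 addr0.
have xx : x ^+ 2 = 1 by rewrite /u in u0; lra.
rewrite zx u0 add0r -mulrA -expr2 xx mulr1.
suff : 0 <= r by lra.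
exact: sqrtr_ge0.
Qed.

Lemma C1at_flow_speed {E : normedModType R} (f g : E -> R) y :
  C1at f y -> C1at g y -> g y ^+ 2 <= 1 -> C1at (fun y => flow_speed (f y) (g y)) y.
Proof.
move=> cf cg g1.
have cg2 : C1at (fun y => g y ^+ 2) y.
  by apply: C1at_eq (C1at_mul cg cg); apply: nearW => t; rewrite expr2.
have cu : C1at (fun y => 1 - g y ^+ 2) y by apply: C1at_sub => //; exact: (C1at_cst (1 : R) y).
have cz : C1at (fun y => g y + f y * (1 - g y ^+ 2)) y.
  by apply: C1at_add => //; exact: C1at_mul.
have csq (h : E -> R) : C1at h y -> C1at (fun y => h y ^+ 2) y.
  by move=> ch; apply: C1at_eq (C1at_mul ch ch); apply: nearW => t; rewrite expr2.
have cm (a : R) (h : E -> R) : C1at h y -> C1at (fun y => a * h y) y.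
  by move=> ch; apply: C1at_mul => //; exact: (C1at_cst (a : R) y).
apply: C1at_mul; first by apply: cm; exact: C1at_sqpos.
apply: C1at_inv; first by rewrite gt_eqF // flow_den_gt0.
apply: C1at_add; last by apply: C1at_mul => //; exact: cm.
apply: C1at_add => //; apply: C1at_sqrt; first exact: flow_root_gt0.
apply: C1at_add; first exact: csq.
by apply: cm; exact: csq.
Qed.

Lemma flow_out s x : 1 <= x ^+ 2 -> flow s x = x.
Proof.
by move=> x1; rewrite /flow /flow_speed sqpos_le0 ?subr_le0 // mulr0 mul0r mulr0 addr0.
Qed.

(** Where [g y ^+ 2 <= 1], end points included, the closed formula is C^1 in a full neighbourhood;
    elsewhere the flow is locally the identity in [g]. *)
Lemma C1at_flow {E : normedModType R} (f g : E -> R) y :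
  C1at f y -> C1at g y -> C1at (fun y => flow (f y) (g y)) y.
Proof.
move=> cf cg; have [g1|g1] := leP (g y ^+ 2) 1.
  apply: C1at_add => //; apply: C1at_mul => //; exact: C1at_flow_speed.
have cg2 : C1at (fun y => g y * g y) y by exact: C1at_mul.
have n1 : \forall z \near y, 1 < g z * g z.
  have N : nbhs (g y * g y) [set r | 1 < r] by rewrite expr2 in g1; exact: lt_nbhsr.
  exact: (C1at_cont cg2 N).
apply: C1at_eq cg; move: n1; apply: filterS => z.
by rewrite -expr2 => z1; rewrite flow_out // ltW.
Qed.

Lemma flow0 x : flow 0 x = x.
Proof. by rewrite /flow mul0r addr0. Qed.

Definition flow_coord x : R := x / (1 - x ^+ 2).

Lemma flow_coord_inj x y : x ^+ 2 < 1 -> y ^+ 2 < 1 -> flow_coord x = flow_coord y -> x = y.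
Proof.
move=> x1 y1 /eqP; rewrite /flow_coord eqr_div; last 2 first.
- by rewrite gt_eqF // subr_gt0.
- by rewrite gt_eqF // subr_gt0.
move=> /eqP xy; have /eqP : (x - y) * (1 + x * y) = 0 by lra.
rewrite mulf_eq0 subr_eq0 => /orP[/eqP //|/eqP xy1]; exfalso.
have : 0 <= (x + y) ^+ 2 by exact: sqr_ge0.
by lra.
Qed.

Lemma flow_coordE s x : x ^+ 2 < 1 ->
  (flow s x) ^+ 2 < 1 /\ flow_coord (flow s x) = flow_coord x + s.
Proof.
move=> x1; set u := 1 - x ^+ 2; set z := x + s * u.
have u0 : 0 < u by rewrite /u subr_gt0.
set r := Num.sqrt (u ^+ 2 + 4 * z ^+ 2).
have r2 : r ^+ 2 = u ^+ 2 + 4 * z ^+ 2.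
  by rewrite sqr_sqrtr // addr_ge0 ?sqr_ge0 // mulr_ge0 ?sqr_ge0.
have rz : 2 * `|z| <= r := root_ge u z.
pose D := u + r.
have D0 : 0 < D by rewrite /D; have := normr_ge0 z; lra.
have Q0 : 0 < D + 2 * x * z by have := flow_den_gt0 s (ltW x1).
(* This is the quadratic equation [z y^2 + u y - z = 0], that is [y/(1 - y^2) = z/u], written for
   [y = 2z/D]. *)
have D2 : D ^+ 2 = 2 * u * D + 4 * z ^+ 2 by rewrite /D sqrrD r2; ring.
have E : flow s x = 2 * z / D.
  rewrite /flow /flow_speed (sqpos_gt0 u0) -/u.
  have -> : flow_den s x = D + 2 * x * z by [].
  apply/eqP; rewrite -subr_eq0.
  have -> : x + s * (2 * u ^+ 2 / (D + 2 * x * z)) - 2 * z / D =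
     ((x * (D + 2 * x * z) + 2 * s * u ^+ 2) * D - 2 * z * (D + 2 * x * z)) /
     ((D + 2 * x * z) * D).
    by field; rewrite !gt_eqF.
  rewrite mulf_eq0; apply/orP; left; apply/eqP.
  have -> : (x * (D + 2 * x * z) + 2 * s * u ^+ 2) * D - 2 * z * (D + 2 * x * z) =
    x * D ^+ 2 + 2 * x ^+ 2 * z * D + 2 * s * u ^+ 2 * D - 2 * z * D - 4 * x * z ^+ 2 by ring.
  by rewrite D2 /z /u; ring.
have N2 : 1 - (2 * z / D) ^+ 2 = 2 * u / D.
  rewrite expr_div_n; apply/eqP; rewrite -subr_eq0.
  have -> : 1 - (2 * z) ^+ 2 / D ^+ 2 - 2 * u / D = (D ^+ 2 - 4 * z ^+ 2 - 2 * u * D) / D ^+ 2.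
    by field; rewrite gt_eqF.
  by rewrite mulf_eq0 D2; apply/orP; left; apply/eqP; ring.
rewrite E; split.
  by rewrite -subr_gt0 N2 divr_gt0 // mulr_gt0.
rewrite /flow_coord N2 -/u.
have -> : 2 * z / D / (2 * u / D) = z / u by field; rewrite !gt_eqF.
by rewrite /z; field; rewrite gt_eqF.
Qed.

Lemma flowK s x : flow (- s) (flow s x) = x.
Proof.
have [x1|x1] := ltP (x ^+ 2) 1; last by rewrite !flow_out // flow_out.
have [y1 yE] := flow_coordE s x1; have [z1 zE] := flow_coordE (- s) y1.
by apply: flow_coord_inj => //; rewrite zE yE addrK.
Qed.

Lemma flow_transitive x y : x ^+ 2 < 1 -> y ^+ 2 < 1 ->
  flow (flow_coord y - flow_coord x) x = y.
Proof.
move=> x1 y1; have [z1 zE] := flow_coordE (flow_coord y - flow_coord x) x1.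
by apply: flow_coord_inj => //; rewrite zE addrC subrK.
Qed.

Lemma flow_speed_gt0 s x : x ^+ 2 < 1 -> 0 < flow_speed s x.
Proof.
move=> x1; rewrite /flow_speed divr_gt0 ?flow_den_gt0 ?ltW // sqpos_gt0 ?subr_gt0 //.
by rewrite mulr_gt0 // exprn_gt0 // subr_gt0.
Qed.

Lemma flow_speed00 : flow_speed 0 0 = 1.
Proof.
have H : flow_den 0 0 = 2 :> R.
  by rewrite /flow_den !(expr0n, mul0r, mulr0, addr0, subr0, expr1n) /= sqrtr1.
by rewrite /flow_speed H expr0n subr0 sqpos_gt0 // expr1n mulr1 divff // pnatr_eq0.
Qed.

Lemma diff_flow {E : normedModType R} (f g : E -> R) y v :
  C1at f y -> C1at g y -> g y ^+ 2 <= 1 -> f y = 0 ->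
  'd (fun y => flow (f y) (g y)) y v = 'd g y v + flow_speed 0 (g y) * 'd f y v.
Proof.
move=> cf cg g1 f0; have cs := C1at_flow_speed cf cg g1.
have cfs : C1at (f * (fun y => flow_speed (f y) (g y))) y := C1at_mul cf cs.
have -> : (fun y => flow (f y) (g y)) = g + f * (fun y => flow_speed (f y) (g y)) by [].
apply: etrans (congr1 (fun h : E -> R => h v) (diffD (C1at_diff cg) (C1at_diff cfs))) _.
congr (_ + _).
apply: etrans (congr1 (fun h : E -> R => h v) (diffM (C1at_diff cf) (C1at_diff cs))) _.
by rewrite -[LHS]/(f y * _ + flow_speed (f y) (g y) * _) f0 mul0r add0r.
Qed.

End LineFlow.

(** * Damped translations and transvections *)

Section DifferentialRules.
Context {R : realType}.
Implicit Types E F : normedModType R.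

Lemma C1at_ext {E F} (f g : E -> F) x : f =1 g -> C1at f x -> C1at g x.
Proof. by move=> /funext ->. Qed.

Lemma diffM_root {E} (f g : E -> R) y v : C1at f y -> C1at g y -> f y = 0 ->
  'd (fun y => f y * g y) y v = g y * 'd f y v.
Proof.
move=> cf cg f0.
apply: etrans (congr1 (fun h : E -> R => h v) (diffM (C1at_diff cf) (C1at_diff cg))) _.
by rewrite -[LHS]/(f y * _ + g y * _) f0 mul0r add0r.
Qed.

Lemma diff_rVcoord {E} n (f : E -> 'rV[R]_n) y v j : C1at f y ->
  'd f y v ord0 j = 'd (fun z => f z ord0 j) y v.
Proof.
move=> cf.
have sl : linear (fun y : 'rV[R]_n => y ord0 j : R).
  by move=> a u w; rewrite !mxE.
pose sM := GRing.isLinear.Build _ _ _ _ _ sl.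
pose sL : {linear 'rV[R]_n -> R} := HB.pack (fun y : 'rV[R]_n => y ord0 j : R) sM.
have E1 : 'd sL (f y) = sL :> ('rV[R]_n -> R).
  by rewrite diff_lin //; exact: coord_continuous.
have E2 := diff_compC1 v cf (C1at_rVcoord j (f y)).
exact: etrans (esym (congr1 (fun h => h ('d f y v)) E1)) (esym E2).
Qed.

Lemma C1at_affine {E F} (b : F) (a : R) (f : E -> F) x : C1at f x ->
  C1at (fun x => b + a *: f x) x.
Proof.
move=> cf; apply: C1at_add; last exact: C1at_scale.
exact: (C1at_cst b x).
Qed.

Lemma diff_affine {E} (b : E) (a : R) x v : 'd (fun x => b + a *: x) x v = a *: v.
Proof.
have cs : continuous ( *:%R a : E -> E) by move=> y; apply: cvgZl_tmp; exact: cvg_id.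
have d1 := linear_differentiable (f := *:%R a) x cs.
apply: etrans (congr1 (fun h : E -> E => h v) (diffD (differentiable_cst b x) d1)) _.
have -> : ('d (cst b) x \+ 'd ( *:%R a) x) v = 'd (cst b) x v + 'd ( *:%R a : E -> E) x v by [].
by rewrite diff_cst add0r (diff_lin _ cs).
Qed.

Lemma diff_affine_comp {E F} (b : F) (a : R) (f : E -> F) x v : C1at f x ->
  'd (fun x => b + a *: f x) x v = a *: 'd f x v.
Proof.
move=> cf; have ca : C1at (fun z => b + a *: z) (f x) by apply: C1at_affine; exact: C1at_id.
by rewrite -[RHS](diff_affine b a (f x)); exact: (diff_compC1 v cf ca).
Qed.

End DifferentialRules.

Section BoxFlow.
Context {R : realType} {n : nat}.
Implicit Types (i : 'I_n) (o : option 'I_n) (x y v : 'rV[R]_n) (t : R).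

Definition sumsq_but i x : R := \sum_(j | j != i) (x ord0 j) ^+ 2.

Definition box_factor o x : R := if o is Some j then x ord0 j else 1.

Definition box_amp i o x : R := box_factor o x * sqpos (1 - sumsq_but i x).

(* [o = None] gives a translation in the direction [e_i], damped in the other
   directions, and [o = Some j] the damped transvection [x_i += t x_j]. *)
Definition unit_box_flow i o t x : 'rV[R]_n :=
  \row_j (if j == i then flow (t * box_amp i o x) (x ord0 i) else x ord0 j).

Lemma unit_box_flowE i o t x j : unit_box_flow i o t x ord0 j =
  if j == i then flow (t * box_amp i o x) (x ord0 i) else x ord0 j.
Proof. by rewrite mxE. Qed.

Lemma sumsq_but_eq i x y : (forall j, j != i -> x ord0 j = y ord0 j) ->
  sumsq_but i x = sumsq_but i y.
Proof. by move=> xy; apply: eq_bigr => j ji; rewrite xy. Qed.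

(** For [o != Some i] the amplitude depends only on coordinates that the flow fixes. It is thus
    constant along the flow, and [-t] inverts [t]. *)
Lemma box_amp_eq i o x y : o != Some i -> (forall j, j != i -> x ord0 j = y ord0 j) ->
  box_amp i o x = box_amp i o y.
Proof.
move=> oi xy; rewrite /box_amp (sumsq_but_eq xy); congr (_ * _).
by case: o oi => //= j ji; rewrite xy //; apply: contraNneq ji => ->.
Qed.

Lemma C1at_sumsq_but i x : C1at (sumsq_but i) x.
Proof.
apply: C1at_sum => j _; apply: C1at_ext (C1at_mul (C1at_rVcoord j x) (C1at_rVcoord j x)).
by move=> y; rewrite expr2.
Qed.

Lemma C1at_box_factor o x : C1at (box_factor o) x.
Proof. by case: o => [j|]; [exact: C1at_rVcoord|exact: (C1at_cst (1 : R) x)]. Qed.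

Lemma C1at_bump i x : C1at (fun x => sqpos (1 - sumsq_but i x)) x.
Proof.
apply: C1at_sqpos; apply: C1at_sub; last exact: C1at_sumsq_but.
exact: (C1at_cst (1 : R) x).
Qed.

Lemma C1at_box_amp i o x : C1at (box_amp i o) x.
Proof. by apply: C1at_mul; [exact: C1at_box_factor|exact: C1at_bump]. Qed.

Lemma C1at_amp_time i o (p : R * 'rV[R]_n) :
  C1at (fun p : R * 'rV[R]_n => p.1 * box_amp i o p.2) p.
Proof.
apply: C1at_mul; first exact: C1at_fst.
exact: (C1at_comp (fin_dim_rV n) (C1at_snd p) (C1at_box_amp i o p.2)).
Qed.

Lemma C1at_coord_snd j (p : R * 'rV[R]_n) :
  C1at (fun p : R * 'rV[R]_n => p.2 ord0 j) p.
Proof. exact: (C1at_comp (fin_dim_rV n) (C1at_snd p) (C1at_rVcoord j p.2)). Qed.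

Lemma C1at_unit_box_flow i o (p : R * 'rV[R]_n) :
  C1at (fun p => unit_box_flow i o p.1 p.2) p.
Proof.
apply: C1at_coord => j; have [->|ji] := eqVneq j i.
  apply: C1at_ext (C1at_flow (C1at_amp_time i o p) (C1at_coord_snd i p)).
  by move=> y; rewrite unit_box_flowE eqxx.
apply: C1at_ext (C1at_coord_snd j p) => y.
by rewrite unit_box_flowE (negbTE ji).
Qed.

Lemma unit_box_flow0 i o x : unit_box_flow i o 0 x = x.
Proof.
apply/rowP => j; rewrite unit_box_flowE mul0r flow0.
by case: eqVneq => // ->.
Qed.

Lemma unit_box_flowK i o t x : o != Some i ->
  unit_box_flow i o (- t) (unit_box_flow i o t x) = x.
Proof.
move=> oi; apply/rowP => j; rewrite unit_box_flowE.
have [->|ji] := eqVneq j i; last by rewrite unit_box_flowE (negbTE ji).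
rewrite unit_box_flowE eqxx (@box_amp_eq i o (unit_box_flow i o t x) x) //.
  by rewrite mulNr flowK.
by move=> k ki; rewrite unit_box_flowE (negbTE ki).
Qed.

(** If [j = i] the line flow is the identity there; if [j != i] the damping factor vanishes. This is
    what lets the flow be extended by the identity. *)
Lemma unit_box_flow_out i o t x j : 1 <= (x ord0 j) ^+ 2 -> unit_box_flow i o t x = x.
Proof.
move=> xj; apply/rowP => k; rewrite unit_box_flowE; case: eqVneq => // ->.
have [ji|ji] := eqVneq j i; first by rewrite flow_out // -ji.
rewrite /box_amp sqpos_le0 ?mulr0 ?flow0 // subr_le0 (le_trans xj) //.
rewrite /sumsq_but (bigD1 j) //= lerDl sumr_ge0 // => l _; exact: sqr_ge0.
Qed.

Lemma unit_box_flow_in i o t x : (forall j, (x ord0 j) ^+ 2 < 1) ->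
  forall j, (unit_box_flow i o t x ord0 j) ^+ 2 < 1.
Proof.
move=> xj j; rewrite unit_box_flowE; case: eqVneq => // _.
by have [] := flow_coordE (t * box_amp i o x) (xj i).
Qed.

(** The hypothesis [t * box_amp i o x = 0] covers two situations: zero time, and the centre of the
    box for [o = Some j], where the amplitude vanishes for every [t]. *)
Lemma diff_unit_box_flow i o t x s v :
  t * box_amp i o x = 0 -> (x ord0 i) ^+ 2 <= 1 ->
  'd (fun p : R * 'rV[R]_n => unit_box_flow i o p.1 p.2) (t, x) (s, v) =
  v + (flow_speed 0 (x ord0 i) *
       'd (fun p : R * 'rV[R]_n => p.1 * box_amp i o p.2) (t, x) (s, v)) *: delta_mx ord0 i.
Proof.
move=> t0 x1; apply/rowP => j; rewrite (diff_rVcoord _ _ (C1at_unit_box_flow i o (t, x))).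
have dcoord k : 'd (fun p : R * 'rV[R]_n => p.2 ord0 k) (t, x) (s, v) = v ord0 k.
  rewrite -(diff_rVcoord _ _ (C1at_snd (t, x))).
  by rewrite (@diff_lin _ _ _ snd) // => y; exact: cvg_snd.
rewrite !mxE eqxx /=; have [->|ji] := eqVneq j i.
  rewrite mulr1 -(dcoord i).
  rewrite -(diff_flow _ (C1at_amp_time i o (t, x)) (C1at_coord_snd i (t, x))) //.
  by congr ('d _ _ _); apply/funext => y; rewrite unit_box_flowE eqxx.
rewrite mulr0 addr0 -(dcoord j).
by congr ('d _ _ _); apply/funext => y; rewrite unit_box_flowE (negbTE ji).
Qed.

Lemma diff_unit_box_flow_time i o x : (x ord0 i) ^+ 2 <= 1 ->
  'd (fun p : R * 'rV[R]_n => unit_box_flow i o p.1 p.2) (0, x) (1, 0) =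
  (flow_speed 0 (x ord0 i) * box_amp i o x) *: delta_mx ord0 i.
Proof.
move=> x1; rewrite diff_unit_box_flow ?mul0r // add0r; congr (_ * _ *: _).
rewrite (@diffM_root _ _ fst (fun p : R * 'rV[R]_n => box_amp i o p.2)) //=.
- by rewrite (@diff_lin _ _ _ fst) /= ?mulr1 // => y; exact: cvg_fst.
- exact: C1at_fst.
exact: (C1at_comp (fin_dim_rV n) (C1at_snd (0, x)) (C1at_box_amp i o x)).
Qed.

(** The factor [x_j] of the amplitude vanishes at the centre, so it alone is differentiated, while
    the speed and the damping contribute their value 1. The differential is therefore an exact
    transvection for every [t], not just to first order in [t]. *)
Lemma diff_unit_box_flow_center i j t v : j != i ->
  'd (unit_box_flow i (Some j) t) 0 v = v + (t * v ord0 j) *: delta_mx ord0 i.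
Proof.
move=> ji.
have ct : C1at (fun x : 'rV[R]_n => (t, x)) 0.
  by apply: C1at_pair; [exact: (C1at_cst (t : R))|exact: C1at_id].
have dt : 'd (fun x : 'rV[R]_n => (t, x)) 0 v = (0, v).
  apply: etrans (congr1 (fun h => h v) (diff_pair (differentiable_cst t 0) (C1at_diff (C1at_id 0)))) _.
  congr (_, _); first by rewrite diff_cst.
  by rewrite (@diff_lin _ _ _ idfun) // => y; exact: (@cvg_id 'rV[R]_n).
have a0 : box_amp i (Some j) 0 = 0 by rewrite /box_amp /= mxE mul0r.
apply: etrans (diff_compC1 v ct (C1at_unit_box_flow i (Some j) (t, 0))) _.
rewrite dt diff_unit_box_flow; last 2 first.
- by rewrite a0 mulr0.
- by rewrite mxE expr0n ler01.
rewrite mxE flow_speed00 mul1r; congr (_ + _ *: _).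
have cb : C1at (fun p : R * 'rV[R]_n => p.1 * sqpos (1 - sumsq_but i p.2)) (t, 0).
  apply: C1at_mul; first exact: C1at_fst.
  exact: (C1at_comp (fin_dim_rV n) (C1at_snd (t, 0)) (C1at_bump i 0)).
have -> : (fun p : R * 'rV[R]_n => p.1 * box_amp i (Some j) p.2) =
  (fun p => p.2 ord0 j * (p.1 * sqpos (1 - sumsq_but i p.2))).
  by apply/funext => p; rewrite /box_amp /= mulrCA.
rewrite diffM_root ?mxE //; last exact: C1at_coord_snd.
rewrite -(diff_rVcoord _ _ (C1at_snd (t, 0))).
rewrite (@diff_lin _ _ _ snd) /= => [|y]; last exact: cvg_snd.
rewrite /sumsq_but big1 => [|k _]; last by rewrite mxE expr0n.
by rewrite subr0 sqpos_gt0 // expr1n mulr1.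
Qed.

(** The time needed is [a / (1 - a^2)] divided by the amplitude [(1 - q)^2], up to sign. The radius
    1/3 keeps it below 1, because [|a| <= 1/2] while [(1 - a^2) (1 - q)^2 >= 8/9 * 3/4]. *)
Lemma unit_box_flow_null i x :
  \sum_j (x ord0 j) ^+ 2 < 9^-1 ->
  exists2 t, `|t| <= 1 &
    unit_box_flow i None t x = \row_j (if j == i then 0 else x ord0 j).
Proof.
rewrite (bigD1 i) //= -/(sumsq_but i x); set q := sumsq_but i x; set a := x ord0 i => xq.
have q0 : 0 <= q by apply: sumr_ge0 => j _; exact: sqr_ge0.
have a0 : 0 <= a ^+ 2 by exact: sqr_ge0.
have q1 : 0 < 1 - q by lra.
have a1 : a ^+ 2 < 1 by lra.
have amp : box_amp i None x = (1 - q) ^+ 2 by rewrite /box_amp /= mul1r sqpos_gt0.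
have z1 : (0 : R) ^+ 2 < 1 by rewrite expr0n ltr01.
exists (- flow_coord a / (1 - q) ^+ 2); last first.
  apply/rowP => j; rewrite unit_box_flowE mxE; case: eqVneq => // _.
  rewrite amp divfK ?gt_eqF ?exprn_gt0 // -/a -[RHS](flow_transitive a1 z1).
  by rewrite {2}/flow_coord mul0r sub0r.
have na : `|a| <= 1 / 2.
  rewrite -(@ler_pXn2r _ 2) ?nnegrE // ?divr_ge0 //.
  by rewrite real_normK ?num_real //; lra.
rewrite normrM normrN normfV (ger0_norm (x := (1 - q) ^+ 2)) ?sqr_ge0 //.
rewrite /flow_coord normrM normfV (ger0_norm (x := 1 - a ^+ 2)); last by lra.
rewrite ler_pdivrMr ?exprn_gt0 // mul1r ler_pdivrMr ?subr_gt0 //.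
have h1 : 3 / 4 <= (1 - q) ^+ 2 by nra.
have h2 : 8 / 9 <= 1 - a ^+ 2 by lra.
by nra.
Qed.

End BoxFlow.

Section AffineBoxFlow.
Context {R : realType} {n : nat}.
Variables (x0 : 'rV[R]_n) (r : R).
Hypothesis r0 : 0 < r.
Implicit Types (i : 'I_n) (o : option 'I_n) (x y v : 'rV[R]_n) (t : R).

(** Written in the form [b + a *: x], to which [C1at_affine] and [diff_affine] apply. *)
Definition box_coord x : 'rV[R]_n := - (r^-1 *: x0) + r^-1 *: x.

Definition box_flow i o t x : 'rV[R]_n := x0 + r *: unit_box_flow i o t (box_coord x).

Lemma box_coord_inv y : box_coord (x0 + r *: y) = y.
Proof. by rewrite /box_coord scalerDr scalerK ?gt_eqF // addrA addNr add0r. Qed.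

Lemma box_coordK x : x0 + r *: box_coord x = x.
Proof.
by rewrite /box_coord scalerDr scalerN !scalerA divff ?gt_eqF // !scale1r addrA addrN add0r.
Qed.

Lemma box_coord_center : box_coord x0 = 0.
Proof. by rewrite /box_coord addNr. Qed.

Lemma box_flow_coord i o t x :
  box_coord (box_flow i o t x) = unit_box_flow i o t (box_coord x).
Proof. exact: box_coord_inv. Qed.

Lemma box_flow0 i o x : box_flow i o 0 x = x.
Proof. by rewrite /box_flow unit_box_flow0 box_coordK. Qed.

Lemma box_flowK i o t x : o != Some i -> box_flow i o (- t) (box_flow i o t x) = x.
Proof.
by move=> oi; rewrite {1}/box_flow box_flow_coord unit_box_flowK // box_coordK.
Qed.

Definition unit_box : set 'rV[R]_n := [set x | forall j, (box_coord x ord0 j) ^+ 2 <= 1].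

Lemma box_flow_out i o t x : ~ unit_box x -> box_flow i o t x = x.
Proof.
move=> /existsNP[j /negP]; rewrite -ltNge => xj.
by rewrite /box_flow (unit_box_flow_out _ _ _ (ltW xj)) box_coordK.
Qed.

Lemma box_flow_in i o t x : unit_box x -> unit_box (box_flow i o t x).
Proof.
move=> Kx j; rewrite box_flow_coord.
have [/forallP H|/forallPn[k]] := boolP [forall j, (box_coord x ord0 j) ^+ 2 < 1].
  by apply/ltW/unit_box_flow_in.
by rewrite -leNgt => xk; rewrite (unit_box_flow_out _ _ _ xk); exact: Kx.
Qed.

Lemma C1at_box_coord x : C1at box_coord x.
Proof. by apply: C1at_affine; exact: C1at_id. Qed.

Lemma C1at_box_time (p : R * 'rV[R]_n) :
  C1at (fun p : R * 'rV[R]_n => (p.1, box_coord p.2)) p.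
Proof.
apply: C1at_pair; first exact: C1at_fst.
exact: (C1at_comp (fin_dim_rV n) (C1at_snd p) (C1at_box_coord p.2)).
Qed.

Lemma C1at_box_flow_aux i o (p : R * 'rV[R]_n) :
  C1at (fun p => unit_box_flow i o p.1 (box_coord p.2)) p.
Proof.
exact: (C1at_comp (fin_dim_prod fin_dim_R (fin_dim_rV n)) (C1at_box_time p)
  (C1at_unit_box_flow i o (p.1, box_coord p.2))).
Qed.

Lemma C1at_box_flow i o (p : R * 'rV[R]_n) : C1at (fun p => box_flow i o p.1 p.2) p.
Proof. by apply: C1at_affine; exact: C1at_box_flow_aux. Qed.

Lemma C1at_box_flow_t i o t x : C1at (box_flow i o t) x.
Proof.
apply: (C1at_comp (f := fun y => (t, y)) (fin_dim_prod fin_dim_R (fin_dim_rV n)) _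
  (C1at_box_flow i o (t, x))).
by apply: C1at_pair; [exact: (C1at_cst t x)|exact: C1at_id].
Qed.

Lemma diff_box_coord x v : 'd box_coord x v = r^-1 *: v.
Proof. exact: diff_affine. Qed.

Lemma diff_box_flow_time i o x : (box_coord x ord0 i) ^+ 2 <= 1 ->
  'd (fun p : R * 'rV[R]_n => box_flow i o p.1 p.2) (0, x) (1, 0) =
  (r * (flow_speed 0 (box_coord x ord0 i) * box_amp i o (box_coord x))) *: delta_mx ord0 i.
Proof.
move=> x1; have C1b := C1at_box_time (0, x).
apply: etrans (diff_affine_comp _ _ _ (C1at_box_flow_aux i o (0, x))) _.
rewrite -scalerA; congr (_ *: _).
apply: etrans (diff_compC1 _ C1b (C1at_unit_box_flow i o (0, box_coord x))) _.
rewrite -diff_unit_box_flow_time //; congr ('d _ _ _).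
have c2 := C1at_comp (fin_dim_rV n) (C1at_snd (0 : R, x)) (C1at_box_coord x).
have c1 := C1at_fst (0 : R, x).
apply: etrans (congr1 (fun h => h (1, 0)) (diff_pair (C1at_diff c1) (C1at_diff c2))) _.
congr (_, _).
  by rewrite (@diff_lin _ _ _ fst) // => y; exact: cvg_fst.
apply: etrans (diff_compC1 _ (C1at_snd (0 : R, x)) (C1at_box_coord x)) _.
rewrite diff_box_coord (@diff_lin _ _ _ snd) /= ?scaler0 // => y; exact: cvg_snd.
Qed.

Lemma diff_box_flow_center i j t v : j != i ->
  'd (box_flow i (Some j) t) x0 v = v + (t * v ord0 j) *: delta_mx ord0 i.
Proof.
move=> ji.
have ca : C1at (unit_box_flow i (Some j) t) (box_coord x0).
  apply: (C1at_comp (f := fun y => (t, y)) (fin_dim_prod fin_dim_R (fin_dim_rV n)) _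
    (C1at_unit_box_flow i (Some j) (t, box_coord x0))).
  by apply: C1at_pair; [exact: (C1at_cst t _)|exact: C1at_id].
have cb := C1at_comp (fin_dim_rV n) (C1at_box_coord x0) ca.
apply: etrans (diff_affine_comp _ _ _ cb) _.
rewrite (diff_compC1 v (C1at_box_coord x0) ca) box_coord_center diff_unit_box_flow_center //.
rewrite diff_box_coord scalerDr !scalerA mulfV ?gt_eqF // scale1r; congr (_ + _ *: _).
by rewrite mxE mulrCA mulVKf ?gt_eqF.
Qed.

Lemma box_flow_center i j t : box_flow i (Some j) t x0 = x0.
Proof.
rewrite /box_flow box_coord_center (_ : unit_box_flow _ _ _ _ = 0) ?scaler0 ?addr0 //.
apply/rowP => k; rewrite unit_box_flowE !mxE /box_amp /= mxE mul0r mulr0 flow0.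
by case: ifP.
Qed.

Lemma unit_box_compact : compact unit_box.
Proof.
apply: bounded_closed_compact.
  exists (`|x0| + r); split; first by rewrite num_real.
  move=> M HM x Kx; apply: le_trans (ltW HM).
  rewrite -[x]box_coordK; apply: le_trans (ler_normD _ _) _.
  rewrite lerD2l normrZ gtr0_norm // (ler_piMr (ltW r0)) //.
  rewrite [leLHS]/Num.norm /= mx_normrE; apply/bigmax_leP; split=> //= -[a b] _ /=.
  rewrite (ord1 a) -(@expr_le1 _ 2) // real_normK ?num_real //; exact: Kx.
have -> : unit_box = \bigcap_(j in [set: 'I_n])
    ((fun x => (box_coord x ord0 j) ^+ 2) @^-1` [set y | y <= 1]).
  by apply/seteqP; split=> x /= H j; [move=> _; exact: H|exact: H].
apply: closed_bigI => j _; apply: closed_comp; last exact: closed_le.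
move=> x _.
have cc : C1at (fun x => box_coord x ord0 j) x.
  exact: (C1at_comp (fin_dim_rV n) (C1at_box_coord x) (C1at_rVcoord j _)).
exact: (C1at_cont (C1at_mul cc cc)).
Qed.

End AffineBoxFlow.

Section BoxMove.
Context {R : realType} {n : nat} {T : topologicalType}.
Variable (A : set (chart 'rV[R]_n T)).
Hypothesis (atA : C1_atlas setT A) (hT : hausdorff_space T).

Record is_move (w : R -> T -> T) : Prop := {
  move_C1 : forall p, C1_near (setT `*` setT) (prod_atlas (@vect_atlas R R) A) A
    (fun tp : R * T => w tp.1 tp.2) p;
  move0 : forall p, w 0 p = p;
  moveK : forall t p, w (- t) (w t p) = p
}.

Variables (c : chart 'rV[R]_n T) (x0 : 'rV[R]_n) (r : R).

Definition chart_box := [/\ A c, 0 < r & unit_box x0 r `<=` chart_map c @` chart_dom c].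

Definition box_move i o (t : R) (p : T) : T :=
  if `[< chart_dom c p >] then chart_inv c (box_flow x0 r i o t (chart_map c p)) else p.

Hypothesis boxc : chart_box.

(** The flow preserves the image of the chart: it maps the cube, which lies in that image, to
    itself, and fixes all other points. *)
Lemma box_move_dom i o t p : chart_dom c p ->
  chart_dom c (box_move i o t p) /\
  chart_map c (box_move i o t p) = box_flow x0 r i o t (chart_map c p).
Proof.
case: boxc => Ac r0 Kc cp; rewrite /box_move asboolT //.
have [[q cq <-]|nK] := pselect ((chart_map c @` chart_dom c) (box_flow x0 r i o t (chart_map c p))).
  by rewrite (chart_mapK (atlas_chart atA Ac)).
case: nK; have [Kp|nKp] := pselect (unit_box x0 r (chart_map c p)).
  by apply: Kc; exact: box_flow_in.
by rewrite box_flow_out //; exists p.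
Qed.

Lemma box_moveK i o t p : o != Some i -> box_move i o (- t) (box_move i o t p) = p.
Proof.
case: boxc => Ac r0 Kc oi.
have [cp|cp] := pselect (chart_dom c p); last by rewrite /box_move !asboolF // asboolF.
have [d1 m1] := box_move_dom i o t cp.
rewrite {1}/box_move asboolT // m1 box_flowK //.
exact: (chart_mapK (atlas_chart atA Ac)).
Qed.

Lemma box_move0 i o p : box_move i o 0 p = p.
Proof.
case: boxc => Ac r0 Kc.
rewrite /box_move; case: asboolP => // cp.
by rewrite box_flow0 // (chart_mapK (atlas_chart atA Ac)).
Qed.

(** A compact set in a Hausdorff space. Its complement is thus a neighbourhood of every point
    outside the chart, and the move is the identity there. *)
Lemma box_image_closed : closed (chart_inv c @` unit_box x0 r).
Proof.
case: boxc => Ac r0 Kc; have cc := atlas_chart atA Ac.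
apply: (compact_closed hT); apply: continuous_compact; last exact: unit_box_compact.
apply: continuous_in_subspaceT => x; rewrite inE => /Kc[q cq <-].
move=> W; rewrite (chart_mapK cc) // => Wq.
have := chart_inv_near cc cq Wq.
by apply: filterS => y /(_ I)[].
Qed.

Lemma box_move_near i o t p : chart_dom c p ->
  {for (t, p), continuous (fun tp : R * T => box_move i o tp.1 tp.2)} /\
  is_ext (setT `*` setT) (fun tp : R * T => box_move i o tp.1 tp.2)
    (prod_chart (vect_chart R) c) c (t, p) (fun y => box_flow x0 r i o y.1 y.2).
Proof.
case: boxc => Ac r0 Kc cp; have cc := atlas_chart atA Ac.
have [d1 m1] := box_move_dom i o t cp.
have nc : nbhs p (chart_dom c) by apply: open_nbhs_nbhs; split=> //; exact: (chart_dom_open cc).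
split.
  have ncp : \forall q \near (t, p), chart_inv c (box_flow x0 r i o q.1 (chart_map c q.2)) =
      box_move i o q.1 q.2.
    near=> q; have cq : chart_dom c q.2 by near: q; exact: (near_snd (p := (t, p)) nc).
    by rewrite /box_move asboolT.
  apply: (near_eq_continuous ncp).
  apply: (@continuous_comp _ _ _ (fun q : R * T => box_flow x0 r i o q.1 (chart_map c q.2))
    (chart_inv c)).
    apply: (@continuous_comp _ _ _ (fun q : R * T => (q.1, chart_map c q.2))
      (fun y => box_flow x0 r i o y.1 y.2)); last exact: (C1at_cont (C1at_box_flow x0 r i o (t, chart_map c p))).
    apply: (@cvg_pair _ _ _ (nbhs (t, p)) (nbhs t) (nbhs (chart_map c p))).
      exact: cvg_fst.
    move=> W /(chart_map_cont cc cp) nW; exact: (near_snd (p := (t, p)) nW).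
  rewrite /= -m1 => W; rewrite (chart_mapK cc) // => Wq.
  have := chart_inv_near cc d1 Wq.
  by apply: filterS => y /(_ I)[].
split; first exact: C1at_box_flow.
have nT : nbhs p [set: T] by exact: filterT.
have := chart_inv_near cc cp nT.
move=> /(@near_snd _ _ (t, chart_map c p)); apply: filterS => -[s y] /= /(_ I)[y1 y2 _] _.
by have [_ ->] := box_move_dom i o s y1; rewrite y2.
Unshelve. all: by end_near. Qed.

Lemma box_is_move i o : o != Some i -> is_move (box_move i o).
Proof.
case: (boxc) => Ac r0 Kc oi; have cc := atlas_chart atA Ac.
have atR := C1_atlas_vect (@fin_dim_R R).
have atRA := C1_atlas_prod atR atA.
split.
- move=> [t p]; have [cp|cp] := pselect (chart_dom c p).
    have [cont ext] := box_move_near i o t cp.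
    have [d1 m1] := box_move_dom i o t cp.
    apply: (C1_near_intro atRA atA cont _ _ ext); last by split.
    by split=> //; exists (vect_chart R) => //; exists c.
  apply: (C1_near_eq atRA _ (C1_near_snd atR atA (t, p))).
  have : \forall q \near p, ~ (chart_inv c @` unit_box x0 r) q.
    apply: open_nbhs_nbhs; split; first by apply: closed_openC; exact: box_image_closed.
    by move=> [y /Kc[q cq <-]]; rewrite (chart_mapK cc) // => qp; rewrite qp in cq.
  move=> H; have := near_snd (p := (t, p)) H.
  apply: filterS => -[s q] /= nq; rewrite /box_move; case: asboolP => // cq.
  rewrite box_flow_out //; first by rewrite (chart_mapK cc).
  by move=> Kq; apply: nq; exists (chart_map c q) => //; rewrite (chart_mapK cc).
- exact: box_move0.
- by move=> t p; exact: box_moveK.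
Qed.

End BoxMove.

(** * Action on tangent planes *)

Section Onto.
Context {R : realType}.

(** The second clause of [submersion] at a single point, which can be composed and transferred
    separately from regularity. *)
Definition onto {E1 E2 : normedModType R} {T1 T2 : topologicalType}
    (A1 : set (chart E1 T1)) (A2 : set (chart E2 T2)) (f : T1 -> T2) (p : T1) :=
  forall w, tangent_space A2 (f p) w ->
    exists2 v, tangent_space A1 p v & differential A1 A2 f p v w.

Section OneMap.
Context {E1 E2 : normedModType R} {T1 T2 : topologicalType}.
Context {X1 : set E1} {X2 : set E2}.
Context {A1 : set (chart E1 T1)} {A2 : set (chart E2 T2)}.
Hypotheses (at1 : C1_atlas X1 A1) (at2 : C1_atlas X2 A2).

Lemma ontoP (f : T1 -> T2) p c d : C1_near X1 A1 A2 f p ->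
  chart_at A1 p c -> chart_at A2 (f p) d ->
  onto A1 A2 f p <-> forall w, exists v, Dexpr f c d p v = w.
Proof.
move=> cf cp dp; split.
  move=> of_ w; have [w' tw' w'd] := tangent_lift at2 w dp.
  have [v tv [_ /(_ c d cp dp) E]] := of_ _ tw'.
  by exists (v c); rewrite -w'd E.
move=> H w tw; have [e Ee] := H (w d).
have [v tv ve] := tangent_lift at1 e cp.
by exists v => //; apply: (differential_intro at1 at2 cf cp dp) => //; rewrite ve.
Qed.

End OneMap.

Section TwoMaps.
Context {E1 E2 E3 : normedModType R} {T1 T2 T3 : topologicalType}.
Context {X1 : set E1} {X2 : set E2} {X3 : set E3}.
Context {A1 : set (chart E1 T1)} {A2 : set (chart E2 T2)} {A3 : set (chart E3 T3)}.
Hypotheses (at1 : C1_atlas X1 A1) (at2 : C1_atlas X2 A2) (at3 : C1_atlas X3 A3).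

Lemma onto_comp (f : T1 -> T2) (f' : T2 -> T3) p :
  C1_near X1 A1 A2 f p -> C1_near X2 A2 A3 f' (f p) ->
  onto A1 A2 f p -> onto A2 A3 f' (f p) -> onto A1 A3 (f' \o f) p.
Proof.
move=> cf cf' o1 o2 w tw; have [u tu du] := o2 w tw.
have [v tv dv] := o1 u tu; exists v => //.
exact: (differential_comp at1 at2 at3 cf cf' tv dv du).
Qed.

Lemma onto_outer (f : T1 -> T2) (f' : T2 -> T3) p :
  C1_near X1 A1 A2 f p -> C1_near X2 A2 A3 f' (f p) ->
  onto A1 A3 (f' \o f) p -> onto A2 A3 f' (f p).
Proof.
move=> cf cf' o1 w tw; have [v tv dv] := o1 w tw.
have [u du] := differential_ex at1 at2 cf tv.
exists u; first by case: du.
have [w' dw'] := differential_ex at2 at3 cf' du.1.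
by rewrite -(differential_uniq at1 at3 (differential_comp at1 at2 at3 cf cf' tv du dw') dv).
Qed.

End TwoMaps.
End Onto.

Section Planes.
Context {R : realType} {n : nat} {T : topologicalType}.
Variable (A : set (chart 'rV[R]_n T)).
Hypothesis (atA : C1_atlas setT A).

Definition C1_self (f : T -> T) := forall p, C1_near setT A A f p.

Lemma C1_self_id : C1_self id.
Proof. by move=> p; exact: C1_near_id. Qed.

Lemma C1_self_comp f g : C1_self f -> C1_self g -> C1_self (g \o f).
Proof. by move=> cf cg p; exact: (C1_near_comp atA atA (cf p) (cg _)). Qed.

Definition tangent_plane (s : T * set (chart 'rV[R]_n T -> 'rV[R]_n)) :=
  s.2 `<=` tangent_space A s.1.

Lemma plane_map_tangent f s : tangent_plane (plane_map A A f s).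
Proof. by move=> w [v _ []]. Qed.

Lemma plane_map_comp f g s : C1_self f -> C1_self g -> tangent_plane s ->
  plane_map A A (g \o f) s = plane_map A A g (plane_map A A f s).
Proof.
move=> cf cg ts; rewrite /plane_map /=; congr (_, _); apply/seteqP; split=> u /=.
  move=> [v sv dv]; have [w dw] := differential_ex atA atA (cf s.1) (ts _ sv).
  exists w; first by exists v.
  have [u' du'] := differential_ex atA atA (cg (f s.1)) dw.1.
  by rewrite (differential_uniq atA atA dv
     (differential_comp atA atA atA (cf s.1) (cg _) (ts _ sv) dw du')).
move=> [w [v sv dv] dw]; exists v => //.
exact: (differential_comp atA atA atA (cf s.1) (cg _) (ts _ sv) dv dw).
Qed.

Lemma differential_id p v : tangent_space A p v -> differential A A id p v v.
Proof.
move=> tv; have [c Ac cp] := atlas_cover atA p.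
apply: (differential_intro atA atA (C1_near_id atA p) (conj Ac cp) (conj Ac cp)) => //.
by rewrite (Dexpr_id atA).
Qed.

Lemma plane_map_id s : tangent_plane s -> plane_map A A id s = s.
Proof.
case: s => p P ts; rewrite /plane_map /=; congr (_, _); apply/seteqP; split=> v /=.
  move=> [w Pw dw].
  by rewrite (differential_uniq atA atA dw (differential_id (ts _ Pw))).
by move=> Pv; exists v => //; apply: differential_id; exact: ts.
Qed.

(** Planes become row spaces of matrices, on which differentials act by right multiplication; the
    reduction by transvections then applies to them. *)
Definition chart_plane {k} c p (B : 'M[R]_(k, n)) : set (chart 'rV[R]_n T -> 'rV[R]_n) :=
  [set v | tangent_space A p v /\ (v c <= B)%MS].

Lemma chart_plane_eqmx {k k'} c p (B : 'M[R]_(k, n)) (B' : 'M[R]_(k', n)) :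
  (B :=: B')%MS -> chart_plane c p B = chart_plane c p B'.
Proof. by move=> BB; apply/seteqP; split=> v [tv vc]; split=> //; move: vc; rewrite BB. Qed.

Lemma tangent_chart_plane {k} c p (B : 'M[R]_(k, n)) : tangent_plane (p, chart_plane c p B).
Proof. by move=> v []. Qed.

Lemma Grassmannian_chart k c p P : chart_at A p c -> Grassmannian A k (p, P) ->
  exists2 B : 'M[R]_(k, n), \rank B = k & P = chart_plane c p B.
Proof.
move=> cp [e [/= te fe ->]].
pose B : 'M[R]_(k, n) := \matrix_i e i c.
have rB i : row i B = e i c by rewrite rowK.
have mulB (a : 'I_k -> R) : (\sum_i a i *: e i) c = (\row_i a i) *m B.
  by rewrite mulmx_sum_row fct_sumE; apply: eq_bigr => i _; rewrite mxE rB.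
exists B.
  apply/eqP/row_freeP; apply/row_freeP/inj_row_free => a aB.
  have E0 : \sum_i a ord0 i *: e i = 0.
    apply: (tangent_ext cp); first exact: (tangent_sum atA).
    - have := tangent_sum atA (fun=> 0) te.
      by rewrite big1 // => i _; rewrite scale0r.
    rewrite mulB -[RHS]/(0 : 'rV[R]_n) -aB; congr (_ *m _).
    by apply/rowP => i; rewrite mxE.
  by apply/rowP => i; rewrite (fe _ E0) mxE.
apply/seteqP; split=> v /=.
  move=> [a _ <-]; split; first exact: (tangent_sum atA).
  by rewrite mulB submxMl.
move=> [tv /submxP[a vB]]; exists (fun i => a ord0 i) => //.
apply: (tangent_ext cp) => //; first exact: (tangent_sum atA).
by rewrite mulB vB; congr (_ *m _); apply/rowP => i; rewrite mxE.
Qed.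

Lemma plane_map_chart {k} f p c d (B : 'M[R]_(k, n)) : C1_near setT A A f p ->
  chart_at A p c -> chart_at A (f p) d ->
  plane_map A A f (p, chart_plane c p B) =
  (f p, chart_plane d (f p) (B *m lin1_mx (Dexpr f c d p))).
Proof.
move=> cf cp fp; rewrite /plane_map /=; congr (_, _); apply/seteqP.
have [D DE] := Dexpr_lin atA atA cf cp fp.
rewrite DE; split=> w /=.
  move=> [v [tv vB] [tw /(_ c d cp fp) wv]]; split=> //.
  have -> : w d = D (v c) by rewrite wv -[derivative_on _ _ _]/(Dexpr f c d p) DE.
  by rewrite -mul_rV_lin1 submxMr.
move=> [tw /submxP[a wB]].
have [v tv vc] := tangent_lift atA (a *m B) cp.
exists v; first by split=> //; rewrite vc submxMl.
apply: (differential_intro atA atA cf cp fp) => //.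
by rewrite wB mulmxA mul_rV_lin1 DE vc.
Qed.

Lemma Dexpr_unitmx f g p c d : C1_near setT A A f p -> C1_near setT A A g (f p) ->
  cancel f g -> chart_at A p c -> chart_at A (f p) d ->
  lin1_mx (Dexpr f c d p) \in unitmx.
Proof.
move=> cf cg fg cp fp.
have cp' : chart_at A (g (f p)) c by rewrite fg.
have gfid : g \o f = id by apply/funext => q; exact: fg.
have [D DE] := Dexpr_lin atA atA cf cp fp.
have [D' DE'] := Dexpr_lin atA atA cg fp cp'.
have /mulmx1_unit[] // : lin1_mx D *m lin1_mx D' = 1%:M.
  apply/row_matrixP => i; rewrite row_mul rowE mul_rV_lin1 mul_rV_lin1 row1 -DE' -DE.
  by rewrite -(Dexpr_comp atA atA atA _ cf cg cp fp cp') gfid (Dexpr_id atA).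
by rewrite DE.
Qed.

Lemma plane_map_rank {k} f g p c d (B : 'M[R]_(k, n)) : C1_near setT A A f p ->
  C1_near setT A A g (f p) -> cancel f g -> chart_at A p c -> chart_at A (f p) d ->
  exists2 B' : 'M[R]_(k, n), \rank B' = \rank B &
    plane_map A A f (p, chart_plane c p B) = (f p, chart_plane d (f p) B').
Proof.
move=> cf cg fg cp fp; exists (B *m lin1_mx (Dexpr f c d p)); last exact: plane_map_chart.
by rewrite mxrankMfree // row_free_unit; exact: (Dexpr_unitmx cf cg).
Qed.

(** A change of charts is the action of [id] on planes, read in two different charts. *)
Lemma chart_plane_change {k} p c d (B : 'M[R]_(k, n)) : chart_at A p c -> chart_at A p d ->
  exists2 B' : 'M[R]_(k, n), \rank B' = \rank B & chart_plane c p B = chart_plane d p B'.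
Proof.
move=> cp dp; have cid := C1_near_id atA p.
have [B' rB' E] := plane_map_rank B cid cid (fun=> erefl) cp dp.
exists B' => //; rewrite plane_map_id in E; last exact: tangent_chart_plane.
by case: E.
Qed.

End Planes.

(** * Compositions of moves and their action on planes *)

Section Words.
Context {R : realType} {n : nat} {T : topologicalType}.
Variable (A : set (chart 'rV[R]_n T)).
Hypothesis (atA : C1_atlas setT A).
Implicit Types (ws : seq (R -> T -> T)) (tau : nat -> R).

(** The head of the list acts last. The times form a sequence indexed by [nat], read up to the
    length of the word, so that concatenation merely shifts indices. *)
Fixpoint word_map ws tau (p : T) : T :=
  if ws is w :: ws' then w (tau 0) (word_map ws' (fun j => tau j.+1) p) else p.

Lemma word_map_cat ws ws' tau p : word_map (ws ++ ws') tau p =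
  word_map ws tau (word_map ws' (fun j => tau (size ws + j)%N) p).
Proof. by elim: ws tau p => //= w ws IH tau p; rewrite IH. Qed.

Lemma word_map_eq ws tau tau' p : (forall j, (j < size ws)%N -> tau j = tau' j) ->
  word_map ws tau p = word_map ws tau' p.
Proof.
elim: ws tau tau' => //= w ws IH tau tau' tt; rewrite tt //.
by rewrite (IH _ (fun j => tau' j.+1)) // => j js; exact: tt.
Qed.

Fixpoint all_moves ws : Prop :=
  if ws is w :: ws' then is_move A w /\ all_moves ws' else True.

Lemma all_moves_cat ws ws' : all_moves ws -> all_moves ws' -> all_moves (ws ++ ws').
Proof. by elim: ws => //= w ws IH [mw ms] ms'; split=> //; exact: IH. Qed.

Lemma word_map0 ws tau p : all_moves ws -> (forall j, (j < size ws)%N -> tau j = 0) ->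
  word_map ws tau p = p.
Proof.
elim: ws tau p => //= w ws IH tau p [mw mws] t0.
by rewrite IH // => [|j js]; rewrite t0 // (move0 mw).
Qed.

(** The times depend on a parameter in any [E]: constant times give the regularity of one
    diffeomorphism, and the coordinates of a vector give that of the family. *)
Lemma C1_word_map {E : normedModType R} ws (tau : E -> nat -> R) x : fin_dim E ->
  all_moves ws -> (forall j e, C1at (tau ^~ j) e) ->
  C1_near (setT `*` setT) (prod_atlas (@vect_atlas R E) A) A
    (fun tp : E * T => word_map ws (tau tp.1) tp.2) x.
Proof.
move=> fE; have atE := C1_atlas_vect fE.
have atR := C1_atlas_vect (@fin_dim_R R).
have atEA := C1_atlas_prod atE atA; have atRA := C1_atlas_prod atR atA.
elim: ws tau x => [|w ws IH] tau x /=.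
  by move=> _ _; exact: (C1_near_snd atE atA).
move=> [mw mws] ct.
have c1 : C1_near (setT `*` setT) (prod_atlas (@vect_atlas R E) A) (@vect_atlas R R)
    (fun tp : E * T => tau tp.1 0) x.
  exact: (C1_near_comp atEA atE (C1_near_fst atE atA x) (C1_near_vect (ct 0 x.1))).
have c2 := IH (fun e j => tau e j.+1) x mws (fun j => ct j.+1).
exact: (C1_near_comp atEA atRA (C1_near_pair atEA c1 c2) (move_C1 mw _)).
Qed.

Lemma C1_word_self ws tau : all_moves ws -> C1_self A (word_map ws tau).
Proof.
move=> mws p; have atR := C1_atlas_vect (@fin_dim_R R).
have atRA := C1_atlas_prod atR atA.
have c1 := C1_near_cst atA atR (0 : R) p.
have c2 := C1_near_id atA p.
have ct : forall j e, C1at ((fun _ : R => tau) ^~ j) e by move=> j e; exact: (C1at_cst (tau j) e).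
exact: (C1_near_comp atA atRA (C1_near_pair atA c1 c2)
  (C1_word_map ((0 : R), p) (@fin_dim_R R) mws ct)).
Qed.

Lemma C1_move_self w t : is_move A w -> C1_self A (w t).
Proof. by move=> mw; exact: (@C1_word_self [:: w] (fun=> t)). Qed.

Lemma word_map_inv ws tau : all_moves ws ->
  exists g, [/\ cancel (word_map ws tau) g, cancel g (word_map ws tau) & C1_self A g].
Proof.
elim: ws tau => [|w ws IH] tau /=.
  by exists id; split=> //; exact: C1_self_id.
move=> [mw mws]; have [g [g1 g2 g3]] := IH (fun j => tau j.+1) mws.
exists (g \o w (- tau 0)); split.
- by move=> p /=; rewrite (moveK mw).
- by move=> p /=; rewrite g2 -{1}[tau 0]opprK (moveK mw).
by apply: C1_self_comp => //; exact: C1_move_self.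
Qed.

End Words.

Section Steps.
Context {R : realType} {n : nat} {T : topologicalType}.
Variable (A : set (chart 'rV[R]_n T)).
Hypothesis (atA : C1_atlas setT A).
Variables (J : finType) (mv : J -> R -> T -> T).
Hypothesis (mv_move : forall j, is_move A (mv j)).

Local Notation plane := (T * set (chart 'rV[R]_n T -> 'rV[R]_n))%type.
Implicit Types (s : plane) (L : nat).

Fixpoint steps L s s' : Prop :=
  if L is L'.+1 then s = s' \/ exists j t,
    `|t| <= 1 /\ steps L' (plane_map A A (mv j t) s) s'
  else s = s'.

Lemma steps_refl L s : steps L s s.
Proof. by case: L => //= L; left. Qed.

Lemma steps_mono L L' s s' : (L <= L')%N -> steps L s s' -> steps L' s s'.
Proof.
elim: L L' s => [|L IH] [|L'] s //=; first by move=> _; left.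
move=> LL [H|[j [t [t1 H]]]]; first by left.
by right; exists j, t; split=> //; exact: IH H.
Qed.

Lemma steps_trans L L' s s' s'' : steps L s s' -> steps L' s' s'' -> steps (L + L') s s''.
Proof.
elim: L s => [|L IH] s /=; first by move=> ->.
move=> [->|[j [t [t1 H]]]] H'; first exact: (steps_mono (leq_addl L.+1 L')).
by right; exists j, t; split=> //; exact: IH.
Qed.

Lemma step1 j t s : `|t| <= 1 -> steps 1 s (plane_map A A (mv j t) s).
Proof. by move=> t1; right; exists j, t. Qed.

Lemma plane_map_moveK j t s : tangent_plane A s ->
  plane_map A A (mv j (- t)) (plane_map A A (mv j t) s) = s.
Proof.
move=> ts.
have cm u : C1_self A (mv j u) := C1_move_self atA u (mv_move j).
rewrite -(plane_map_comp atA (cm t) (cm (- t)) ts).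
have -> : mv j (- t) \o mv j t = id by apply/funext => p; exact: (moveK (mv_move j)).
exact: (plane_map_id atA).
Qed.

(** Reversing a move changes the sign of its time, so the bounds on time and number are kept. *)
Lemma steps_sym L s s' : tangent_plane A s -> steps L s s' -> steps L s' s.
Proof.
elim: L s => [|L IH] s ts; first by move=> /= ->.
move=> [->|[j [t [t1 H]]]]; first exact: steps_refl.
rewrite -addn1; apply: (steps_trans (IH _ (@plane_map_tangent _ _ _ _ _ s) H)).
rewrite -{2}(plane_map_moveK j t ts); apply: step1; by rewrite normrN.
Qed.

Definition round : seq (R -> T -> T) := [seq mv j | j <- enum J].

Fixpoint rounds L : seq (R -> T -> T) := if L is L'.+1 then rounds L' ++ round else [::].

Lemma all_moves_map (r : seq J) : all_moves A [seq mv j | j <- r].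
Proof. by elim: r => //= j r IH; split. Qed.

Lemma all_moves_rounds L : all_moves A (rounds L).
Proof. by elim: L => //= L IH; apply: all_moves_cat => //; exact: all_moves_map. Qed.

(** The other moves of the round get time 0 and are the identity. A single step thus costs a whole
    round, whose composition does not depend on the step to be realised. *)
Lemma round_move j t : exists tau, [/\ (forall i, tau i = if i == index j (enum J) then t else 0) &
  word_map round tau = mv j t].
Proof.
exists (fun i => if i == index j (enum J) then t else 0); split=> //.
apply/funext => p; rewrite /round.
have jJ : j \in enum J by rewrite mem_enum.
have [r1 [r2 [jr1 E]]] : exists r1 r2, j \notin r1 /\ enum J = r1 ++ j :: r2.
  exists (take (index j (enum J)) (enum J)), (drop (index j (enum J)).+1 (enum J)).
  split; first by rewrite in_take_leq ?ltnn // index_size.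
  by rewrite -[LHS](cat_take_drop (index j (enum J))) (drop_nth j) ?index_mem // nth_index.
have ij : index j (enum J) = size r1 by rewrite E index_cat (negbTE jr1) /= eqxx addn0.
rewrite ij E map_cat word_map_cat /= size_map addn0 eqxx.
rewrite (word_map0 (A := A)); last 2 first.
- exact: all_moves_map.
- by move=> i; rewrite size_map => ir; rewrite ltn_eqF.
congr (mv j t _); rewrite (word_map0 (A := A)) //; first exact: all_moves_map.
by move=> i _; rewrite gtn_eqF // addnS ltnS leq_addr.
Qed.

Lemma steps_rounds L s s' : tangent_plane A s -> steps L s s' ->
  exists tau, (forall i, `|tau i| <= 1) /\ plane_map A A (word_map (rounds L) tau) s = s'.
Proof.
elim: L s => [|L IH] s ts.
  move=> /= <-; exists (fun=> 0); split=> [i|]; first by rewrite normr0.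
  exact: (plane_map_id atA ts).
have main t j : `|t| <= 1 -> steps L (plane_map A A (mv j t) s) s' ->
    exists tau, (forall i, `|tau i| <= 1) /\ plane_map A A (word_map (rounds L.+1) tau) s = s'.
  move=> t1 H; have [tau [tau1 <-]] := IH _ (@plane_map_tangent _ _ _ _ _ s) H.
  have [tau' [tau'E tau'w]] := round_move j t.
  (* The last round of the word acts first, so it realises the first step; the earlier entries keep
     the times of the remaining steps. *)
  exists (fun i => if (i < size (rounds L))%N then tau i else tau' (i - size (rounds L))%N).
  split.
    by move=> i; case: ifP => // _; rewrite tau'E; case: ifP => // _; rewrite normr0.
  have wE : word_map (rounds L.+1) (fun i => if (i < size (rounds L))%N then tau i
      else tau' (i - size (rounds L))%N) = word_map (rounds L) tau \o mv j t.
    apply/funext => p; rewrite /= word_map_cat -tau'w.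
    have e1 : (fun j => if (size (rounds L) + j < size (rounds L))%N
       then tau (size (rounds L) + j)%N
       else tau' (size (rounds L) + j - size (rounds L))%N) = tau'.
      by apply/funext => i; rewrite ltnNge leq_addr /= addKn.
    rewrite e1.
    by apply: word_map_eq => i ->.
  rewrite wE (plane_map_comp atA) //; first exact: (C1_move_self atA).
  exact: (C1_word_self atA _ (all_moves_rounds L)).
move=> [ss|[j [t [t1 H]]]]; last exact: main H.
(* When [s = s'] there is still one round to fill: a move at time 0 does it, unless [J] is empty, in
   which case the round is empty too. *)
have [j0|noJ] := pselect (exists j : J, True).
  have [j _] := j0; apply: (main 0 j); first by rewrite normr0.
  have -> : mv j 0 = id by apply/funext => p; exact: (move0 (mv_move j)).
  by rewrite (plane_map_id atA) // ss; exact: steps_refl.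
have r0 : round = [::].
  rewrite /round; case E : (enum J) => [|j r] //; exfalso.
  by apply: noJ; exists j.
have [tau [tau1 E]] := IH s ts (eq_ind _ (fun x => steps L s x) (steps_refl L s) _ ss).
by exists tau; split=> //=; rewrite r0 cats0.
Qed.

End Steps.

(** * Transitivity on the Grassmannians *)

Section BoxSystem.
Context {R : realType} {n : nat} {T : topologicalType}.
Variable (A : set (chart 'rV[R]_n T)).
Hypothesis (atA : C1_atlas setT A) (hT : hausdorff_space T).

(** The chart preimage of a Euclidean ball of radius [r / 3]: setting coordinates to 0 one after
    another does not leave it, and each takes a time at most 1 by [unit_box_flow_null]. *)
Definition inner_box (c : chart 'rV[R]_n T) x0 r : set T :=
  [set q | chart_dom c q /\ \sum_j (box_coord x0 r (chart_map c q) ord0 j) ^+ 2 < 9^-1].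

Lemma inner_box_open c x0 r : A c -> open (inner_box c x0 r).
Proof.
move=> Ac; have cc := atlas_chart atA Ac; rewrite openE => q [cq qr].
have C1q : C1at (fun x => \sum_j (box_coord x0 r x ord0 j) ^+ 2) (chart_map c q).
  apply: C1at_sum => j _.
  have cj : C1at (fun x => box_coord x0 r x ord0 j) (chart_map c q).
    exact: (C1at_comp (fin_dim_rV n) (C1at_box_coord x0 r _) (C1at_rVcoord j _)).
  exact: C1at_ext (C1at_mul cj cj).
have nq : nbhs (\sum_j (box_coord x0 r (chart_map c q) ord0 j) ^+ 2) [set y | y < 9^-1].
  exact: lt_nbhsl.
have := chart_map_cont cc cq (C1at_cont C1q nq).
have nc : nbhs q (chart_dom c) by apply: open_nbhs_nbhs; split=> //; exact: (chart_dom_open cc).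
by move: nc; apply: filterS2.
Qed.

Lemma box_at p : exists (c : chart 'rV[R]_n T) (x0 : 'rV[R]_n) (r : R),
  [/\ chart_box A c x0 r, chart_dom c p & chart_map c p = x0].
Proof.
have [c Ac cp] := atlas_cover atA p; have cc := atlas_chart atA Ac.
have nT : nbhs p [set: T] by exact: filterT.
have := chart_inv_near cc cp nT; move/nbhs_normP => [e /= e0 He].
have e2 : 0 < e / 2 by rewrite divr_gt0.
exists c, (chart_map c p), (e / 2); split=> //; split=> // x Kx.
have [|h1 h2 _] := He x _ I; last by exists (chart_inv c x).
rewrite /= -[X in _ - X](box_coordK (chart_map c p) e2) opprD addrA subrr sub0r normrN normrZ.
rewrite gtr0_norm //; apply: (@le_lt_trans _ _ (e / 2)); last by lra.
rewrite ler_piMr ?(ltW e2) //.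
rewrite [leLHS]/Num.norm /= mx_normrE; apply/bigmax_leP; split=> //= -[a b] _ /=.
rewrite (ord1 a) -(@expr_le1 _ 2) // real_normK ?num_real //; exact: Kx.
Qed.

Variables (N : nat) (bc : 'I_N -> chart 'rV[R]_n T) (bx : 'I_N -> 'rV[R]_n)
  (br : 'I_N -> R) (bp : 'I_N -> T).
Hypotheses (boxes : forall a, chart_box A (bc a) (bx a) (br a))
  (bp_dom : forall a, chart_dom (bc a) (bp a))
  (bp_map : forall a, chart_map (bc a) (bp a) = bx a)
  (inner_cover : forall q, exists a, inner_box (bc a) (bx a) (br a) q).

(* The trivial move [None] makes the number of parameters positive. *)
Definition move_index : finType := option ('I_N * 'I_n * option 'I_n).

(** For [o = Some i] the amplitude would vary with the coordinate being moved, and [-t] would not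
    invert [t]; these indices get the identity. *)
Definition moves (m : move_index) : R -> T -> T :=
  if m is Some (a, i, o) then
    if o == Some i then (fun _ p => p) else box_move (bc a) (bx a) (br a) i o
  else fun _ p => p.

Lemma trivial_move : is_move A (fun _ : R => @id T).
Proof.
split=> // p.
exact: (C1_near_snd (C1_atlas_vect (@fin_dim_R R)) atA p).
Qed.

Lemma moves_are_moves m : is_move A (moves m).
Proof.
case: m => [[[a i] o]|] /=; last exact: trivial_move.
by case: eqVneq => [_|oi]; [exact: trivial_move|exact: (box_is_move atA hT)].
Qed.

Lemma center_chart a : chart_at A (bp a) (bc a).
Proof. by split; [case: (boxes a)|exact: bp_dom]. Qed.

Lemma inner_chart a q : inner_box (bc a) (bx a) (br a) q -> chart_at A q (bc a).
Proof. by move=> [cq _]; split=> //; case: (boxes a). Qed.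

Lemma moves_C1 m t p : C1_near setT A A (moves m t) p.
Proof. exact: (C1_move_self atA t (moves_are_moves m)). Qed.

Lemma moves_cancel m t : cancel (moves m t) (moves m (- t)).
Proof. by move=> p; exact: (moveK (moves_are_moves m)). Qed.

Variable k : nat.

(** On the way to the centre only the rank of the plane is tracked. Its direction is normalised
    afterwards, at the centre, where the transvections fix the point. *)
Lemma steps_to_axes a (s : seq 'I_n) q (B : 'M[R]_(k, n)) :
  inner_box (bc a) (bx a) (br a) q ->
  exists q' (B' : 'M[R]_(k, n)),
    [/\ inner_box (bc a) (bx a) (br a) q', \rank B' = \rank B,
      forall j, box_coord (bx a) (br a) (chart_map (bc a) q') ord0 j =
        if j \in s then 0 else box_coord (bx a) (br a) (chart_map (bc a) q) ord0 j &
      steps A moves (size s) (q, chart_plane A (bc a) q B) (q', chart_plane A (bc a) q' B')].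
Proof.
elim: s q B => [|i s IH] q B bq; first by exists q, B.
have [cq sq] := bq; have [Ac r0 _] := boxes a.
have [t t1 tE] := unit_box_flow_null i sq.
pose q1 := moves (Some (a, i, None)) t q.
have [d1 m1] := box_move_dom atA (boxes a) i None t cq.
have x1 j : box_coord (bx a) (br a) (chart_map (bc a) q1) ord0 j =
    if j == i then 0 else box_coord (bx a) (br a) (chart_map (bc a) q) ord0 j.
  by rewrite /q1 /= m1 box_flow_coord // tE mxE.
have bq1 : inner_box (bc a) (bx a) (br a) q1.
  split=> //; apply: le_lt_trans sq; apply: ler_sum => j _.
  by rewrite x1; case: ifP => // _; rewrite expr0n sqr_ge0.
have [B1 rB1 E1] := plane_map_rank atA B (moves_C1 (Some (a, i, None)) t q)
  (moves_C1 (Some (a, i, None)) (- t) q1) (moves_cancel _ t) (inner_chart bq) (inner_chart bq1).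
have [q' [B' [bq' rB' xq' st]]] := IH q1 B1 bq1.
exists q', B'; split=> //; first by rewrite rB'.
  move=> j; rewrite xq' inE x1.
  by case: eqP => [->|_]; case: ifP => //.
right; exists (Some (a, i, None)), t; split=> //.
by rewrite E1.
Qed.

Lemma steps_to_center a q (B : 'M[R]_(k, n)) : inner_box (bc a) (bx a) (br a) q ->
  exists2 B' : 'M[R]_(k, n), \rank B' = \rank B &
    steps A moves n (q, chart_plane A (bc a) q B) (bp a, chart_plane A (bc a) (bp a) B').
Proof.
move=> bq; have [q' [B' [bq' rB' xq']]] := steps_to_axes (enum 'I_n) B bq.
have [Ac r0 _] := boxes a; have cc := atlas_chart atA Ac.
rewrite size_enum_ord => st.
have x0 : box_coord (bx a) (br a) (chart_map (bc a) q') = 0.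
  by apply/rowP => j; rewrite xq' mem_enum inE mxE.
have q'E : q' = bp a.
  have [cq' _] := bq'.
  rewrite -[LHS](chart_mapK cc cq') -[RHS](chart_mapK cc (bp_dom a)) bp_map.
  by rewrite -[chart_map _ q'](box_coordK (bx a) r0) x0 scaler0 addr0.
by exists B' => //; rewrite -q'E.
Qed.

Lemma transvection_step a i j t (B : 'M[R]_(k, n)) : i != j ->
  plane_map A A (moves (Some (a, i, Some j)) t) (bp a, chart_plane A (bc a) (bp a) B) =
  (bp a, chart_plane A (bc a) (bp a) (B *m transvection i j t)).
Proof.
move=> ij; have [Ac r0 _] := boxes a; have cc := atlas_chart atA Ac.
have ji : Some j != Some i by apply: contraNneq ij => -[->].
have ji' : j != i by rewrite eq_sym.
have mE : moves (Some (a, i, Some j)) t = box_move (bc a) (bx a) (br a) i (Some j) t.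
  by rewrite /= (negbTE ji).
have [d1 m1] := box_move_dom atA (boxes a) i (Some j) t (bp_dom a).
have fixp : box_move (bc a) (bx a) (br a) i (Some j) t (bp a) = bp a.
  by rewrite -[LHS](chart_mapK cc d1) m1 bp_map box_flow_center -(bp_map a) (chart_mapK cc).
have cf := moves_C1 (Some (a, i, Some j)) t (bp a).
rewrite mE in cf *.
have cp := center_chart a.
have fp : chart_at A (box_move (bc a) (bx a) (br a) i (Some j) t (bp a)) (bc a) by rewrite fixp.
rewrite (plane_map_chart atA B cf cp fp) fixp; congr (_, chart_plane _ _ _ (_ *m _)).
have ext : is_ext setT (box_move (bc a) (bx a) (br a) i (Some j) t) (bc a) (bc a) (bp a)
    (box_flow (bx a) (br a) i (Some j) t).
  split; first exact: C1at_box_flow_t.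
  have nT : nbhs (bp a) [set: T] by exact: filterT.
  have := chart_inv_near cc (bp_dom a) nT.
  apply: filterS => y /(_ I)[y1 y2 _] _.
  by have [_ ->] := box_move_dom atA (boxes a) i (Some j) t y1; rewrite y2.
rewrite (DexprE (atlas_fat atA) cc cc (bp_dom a) fp.2 cf.1 ext) bp_map.
apply/row_matrixP => l.
rewrite [LHS]rowE [RHS]rowE mul_rV_lin1 row_mul_transvection.
exact: diff_box_flow_center.
Qed.

Lemma reducible_steps a L (B B' : 'M[R]_(k, n)) : reducible L B B' ->
  steps A moves L (bp a, chart_plane A (bc a) (bp a) B)
    (bp a, chart_plane A (bc a) (bp a) B').
Proof.
elim: L B => [|L IH] B /=; first by move=> H; rewrite (chart_plane_eqmx _ _ _ H).
move=> [H|[i [j [t [ij t1 H]]]]]; first by left; rewrite (chart_plane_eqmx _ _ _ H).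
right; exists (Some (a, i, Some j)), t; split=> //.
by rewrite (transvection_step _ _ _ ij); exact: IH.
Qed.

Definition std_plane a := (bp a, chart_plane A (bc a) (bp a) (pid_mx k : 'M[R]_(k, n))).

(** [n] moves to reach the centre, then the count of [reducible_pid]. *)
Let L1 := (n + (k * n + n * 2))%N.

Lemma steps_to_std a q (B : 'M[R]_(k, n)) : \rank B = k -> inner_box (bc a) (bx a) (br a) q ->
  steps A moves L1 (q, chart_plane A (bc a) q B) (std_plane a).
Proof.
move=> rB bq; have [B' rB' st] := steps_to_center B bq.
apply: steps_trans st _; apply: reducible_steps; apply: reducible_pid.
by rewrite rB'.
Qed.

Hypothesis kn : (k <= n)%N.

(** A [k]-plane at a common point leads to both standard planes; the first of the two paths is
    reversed. *)
Lemma std_overlap a b q : inner_box (bc a) (bx a) (br a) q ->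
  inner_box (bc b) (bx b) (br b) q -> steps A moves (L1 + L1) (std_plane a) (std_plane b).
Proof.
move=> aq bq.
have rB : \rank (pid_mx k : 'M[R]_(k, n)) = k by rewrite rank_pid_mx.
have [B' rB' E] := chart_plane_change atA (pid_mx k : 'M[R]_(k, n)) (inner_chart aq) (inner_chart bq).
rewrite rB in rB'.
apply: (@steps_trans _ _ _ _ _ _ _ _ _ (q, chart_plane A (bc a) q (pid_mx k : 'M[R]_(k, n)))).
  apply: (steps_sym atA moves_are_moves); first exact: tangent_chart_plane.
  exact: steps_to_std.
by rewrite E; exact: steps_to_std.
Qed.

Hypothesis conT : connected [set: T].

(** The union [U] of the inner boxes reachable from [a] and the union [V] of the others are open,
    cover the space, and are disjoint by [std_overlap]. *)
Lemma std_connected a b : exists L, steps A moves L (std_plane a) (std_plane b).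
Proof.
pose rel b := exists L, steps A moves L (std_plane a) (std_plane b).
pose U := [set q | exists2 b, rel b & inner_box (bc b) (bx b) (br b) q].
pose V := [set q | exists2 b, ~ rel b & inner_box (bc b) (bx b) (br b) q].
have openUV (P : 'I_N -> Prop) : open [set q | exists2 b, P b & inner_box (bc b) (bx b) (br b) q].
  rewrite openE => q [b' Pb' bq].
  have : nbhs q (inner_box (bc b') (bx b') (br b')).
    by apply: open_nbhs_nbhs; split=> //; apply: inner_box_open; case: (boxes b').
  by apply: filterS => q' bq'; exists b'.
have UV : U = ~` V.
  apply/seteqP; split=> q.
    move=> [b1 [L st] b1q] [b2 nr b2q]; apply: nr; exists (L + (L1 + L1))%N.
    by apply: steps_trans st _; exact: std_overlap b1q b2q.
  move=> nV; have [b1 b1q] := inner_cover q.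
  by have [r1|nr1] := pselect (rel b1); [exists b1|case: nV; exists b1].
have center_inner b' : inner_box (bc b') (bx b') (br b') (bp b').
  split; first exact: bp_dom.
  rewrite bp_map box_coord_center big1 ?invr_gt0 // => j _.
  by rewrite mxE expr0n.
have UT : U = [set: T].
  apply: (conT (B := U)).
  - by exists (bp a), a => //; exists 0%N.
  - by exists U; [exact: openUV|rewrite setTI].
  - by exists U; [rewrite UV closedC; exact: openUV|rewrite setTI].
have : U (bp b) by rewrite UT.
move=> [b' [L st] b'q]; exists (L + (L1 + L1))%N.
apply: steps_trans st _; exact: (std_overlap b'q).
Qed.

(** There are finitely many pairs of boxes, so the lengths provided by connectedness have a
    maximum. *)
Lemma steps_Grassmannian : exists L, forall s s',
  Grassmannian A k s -> Grassmannian A k s' -> steps A moves L s s'.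
Proof.
have /choice[f fP] : forall ab : 'I_N * 'I_N, exists L,
    steps A moves L (std_plane ab.1) (std_plane ab.2).
  by move=> [a b]; exact: std_connected.
exists (L1 + (\max_ab f ab + L1))%N => -[p P] [p' P'] gP gP'.
have [a ap] := inner_cover p; have [a' ap'] := inner_cover p'.
have [B rB ->] := Grassmannian_chart atA (inner_chart ap) gP.
have [B' rB' ->] := Grassmannian_chart atA (inner_chart ap') gP'.
apply: steps_trans (steps_to_std rB ap) _.
apply: (@steps_trans _ _ _ _ _ _ _ _ _ (std_plane a')).
  by apply: steps_mono (fP (a, a')); exact: leq_bigmax.
apply: (steps_sym atA moves_are_moves); first exact: tangent_chart_plane.
exact: steps_to_std.
Qed.

End BoxSystem.

(** * Submersivity at the identity *)

Lemma continuous_prod_at {R : realType} {S : topologicalType} (t : S) (I : Type) (r : seq I)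
    (f : I -> S -> R) : (forall i, {for t, continuous (f i)}) ->
  {for t, continuous (fun s => \prod_(i <- r) f i s)}.
Proof.
move=> cf; elim: r => [|i r IH].
  apply: (@near_eq_continuous _ _ (cst (1 : R) : S -> R)); last exact: cst_continuous.
  by apply: nearW => s; rewrite big_nil.
apply: (@near_eq_continuous _ _ (fun s => f i s * \prod_(i <- r) f i s)).
  by apply: nearW => s; rewrite big_cons.
by apply: cvgM; [exact: cf|exact: IH].
Qed.

Lemma continuous_det_at {R : realType} {S : topologicalType} (t : S) n (M : S -> 'M[R]_n) :
  (forall i j, {for t, continuous (fun s => M s i j)}) ->
  {for t, continuous (fun s => \det (M s))}.
Proof.
move=> cM; rewrite /determinant.
apply: (@continuous_sum_at R _ R) => s; apply: cvgM; first exact: cvg_cst.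
by apply: continuous_prod_at => i; exact: cM.
Qed.

Section Partial.
Context {R : realType} {E F G : normedModType R}.

Lemma C1at_partial (f : E * F -> G) t x : fin_dim E -> fin_dim F ->
  C1at f (t, x) -> C1at (fun u => f (u, x)) t.
Proof.
move=> fE fF cf.
have cg : C1at (fun u : E => (u, x)) t.
  by apply: C1at_pair; [exact: C1at_id|exact: (C1at_cst x t)].
exact: (C1at_comp (fin_dim_prod fE fF) cg cf).
Qed.

Lemma diff_partial (f : E * F -> G) t x v : C1at f (t, x) ->
  'd (fun u => f (u, x)) t v = 'd f (t, x) (v, 0).
Proof.
move=> cf.
have ci := C1at_id t; have cx := C1at_cst x t.
have cg : C1at (fun u : E => (u, x)) t by exact: (C1at_pair ci cx).
apply: etrans (diff_compC1 v cg cf) _; congr ('d f _ _).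
apply: etrans (congr1 (fun h => h v) (diff_pair (C1at_diff ci) (C1at_diff cx))) _.
congr (_, _); last by rewrite diff_cst.
by rewrite (@diff_lin _ _ _ idfun) // => y; exact: (@cvg_id E).
Qed.

End Partial.

Section Coordinates.
Context {R : realType} {m : nat}.

Definition coords (s : 'rV[R]_m) (j : nat) : R :=
  if insub j is Some j' then s ord0 (j' : 'I_m) else 0.

Lemma coordsE s (j : 'I_m) : coords s j = s ord0 j.
Proof. by rewrite /coords valK. Qed.

Lemma C1at_coords j (s : 'rV[R]_m) : C1at (coords ^~ j) s.
Proof.
rewrite /coords; case: insubP => [j' _ _|_]; first exact: C1at_rVcoord.
exact: (C1at_cst (0 : R) s).
Qed.

Lemma coords_delta u (j : 'I_m) i : coords (u *: delta_mx ord0 j) i = if i == j then u else 0.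
Proof.
rewrite /coords; case: insubP => [i' _ <-|].
  by rewrite !mxE eqxx -val_eqE /=; case: eqP => _; rewrite ?mulr1 ?mulr0.
by rewrite -leqNgt => mi; case: eqP => // ij; rewrite ij leqNgt ltn_ord in mi.
Qed.

End Coordinates.

Section FiniteBoxes.
Context {R : realType} {n : nat} {T : topologicalType}.
Variable (A : set (chart 'rV[R]_n T)).
Hypothesis (atA : C1_atlas setT A) (hT : hausdorff_space T) (cT : compact [set: T]).

(** Compactness in its near-covering form, applied to the filter of the properties shared by all
    lists that contain a given finite one. *)
Lemma finite_subcover (U : T -> set T) : (forall p, open (U p)) -> (forall p, U p p) ->
  exists s : seq T, forall q, exists2 p, p \in s & U p q.
Proof.
move=> oU Up; pose F (Q : set (seq T)) := exists s0 : seq T,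
  forall s, {subset s0 <= s} -> Q s.
have FF : Filter F.
  constructor.
  - by exists [::].
  - move=> P Q [s0 h0] [s1 h1]; exists (s0 ++ s1) => s ss; split.
      by apply: h0 => x xs; apply: ss; rewrite mem_cat xs.
    by apply: h1 => x xs; apply: ss; rewrite mem_cat xs orbT.
  - by move=> P Q PQ [s0 h0]; exists s0 => s /h0; exact: PQ.
have [|s0 h0] := (compact_near_coveringP _).1 cT _ F (fun s q => exists2 p, p \in s & U p q) FF.
  move=> x _; exists (U x, [set s : seq T | x \in s]) => /=.
    split; first by apply: open_nbhs_nbhs; split.
    by exists [:: x] => s; apply; rewrite inE.
  by move=> [q s] /= [Uq xs]; exists x.
by exists s0 => q; apply: (h0 s0).
Qed.

Lemma finite_boxes : exists (N : nat) (bc : 'I_N -> chart 'rV[R]_n T) (bx : 'I_N -> 'rV[R]_n)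
    (br : 'I_N -> R) (bp : 'I_N -> T),
  [/\ forall a, chart_box A (bc a) (bx a) (br a),
      forall a, chart_dom (bc a) (bp a),
      forall a, chart_map (bc a) (bp a) = bx a &
      forall q, exists a, inner_box (bc a) (bx a) (br a) q].
Proof.
have /choice[f fP] : forall p, exists d : chart 'rV[R]_n T * 'rV[R]_n * R,
    [/\ chart_box A d.1.1 d.1.2 d.2, chart_dom d.1.1 p & chart_map d.1.1 p = d.1.2].
  by move=> p; have [c [x0 [r H]]] := box_at atA p; exists (c, x0, r).
pose U p := inner_box (f p).1.1 (f p).1.2 (f p).2.
have openU p : open (U p) by apply: (inner_box_open atA); have [[]] := fP p.
have Up p : U p p.
  have [_ cp cpE] := fP p.
  split=> //; rewrite cpE box_coord_center big1 ?invr_gt0 // => j _.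
  by rewrite mxE expr0n.
have [s cs] := finite_subcover openU Up.
exists (size s), (fun a => (f (tnth (in_tuple s) a)).1.1),
  (fun a => (f (tnth (in_tuple s) a)).1.2), (fun a => (f (tnth (in_tuple s) a)).2),
  (fun a => tnth (in_tuple s) a).
split=> [a|a|a|q].
- by have [] := fP (tnth (in_tuple s) a).
- by have [] := fP (tnth (in_tuple s) a).
- by have [] := fP (tnth (in_tuple s) a).
have [p ps Upq] := cs q.
have /tnthP[a aE] : p \in in_tuple s by [].
by exists a; rewrite -aE.
Qed.

End FiniteBoxes.

Section OntoMoves.
Context {R : realType} {n : nat} {T : topologicalType}.
Variable (A : set (chart 'rV[R]_n T)).
Hypothesis (atA : C1_atlas setT A) (hT : hausdorff_space T).
Variables (N : nat) (bc : 'I_N -> chart 'rV[R]_n T) (bx : 'I_N -> 'rV[R]_n)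
  (br : 'I_N -> R) (bp : 'I_N -> T).
Hypotheses (boxes : forall a, chart_box A (bc a) (bx a) (br a))
  (inner_cover : forall q, exists a, inner_box (bc a) (bx a) (br a) q).

Local Notation mv := (moves bc bx br).
Let m := #|@move_index n N|.

Definition all_round (s : 'rV[R]_m) (q : T) : T := word_map (round mv) (coords s) q.

Let mvP j : is_move A (mv j) := moves_are_moves atA hT boxes j.

Lemma C1_all_round x : C1_near (setT `*` setT) (prod_atlas (@vect_atlas R 'rV[R]_m) A) A
  (fun tp : 'rV[R]_m * T => all_round tp.1 tp.2) x.
Proof.
apply: (C1_word_map atA) => //; first exact: fin_dim_rV.
- exact: (all_moves_map mvP).
- by move=> j e; exact: C1at_coords.
Qed.

Lemma all_round_axis (j : @move_index n N) : exists i : 'I_m,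
  forall u, all_round (u *: delta_mx ord0 i) = mv j u.
Proof.
have jm : (index j (enum (@move_index n N)) < m)%N by rewrite /m cardE index_mem mem_enum.
exists (Ordinal jm) => u.
have [tau [tauE <-]] := round_move mvP j u.
apply/funext => q; rewrite /all_round; congr (word_map _ _ _).
by apply/funext => i; rewrite coords_delta tauE.
Qed.

Lemma all_round0 q : all_round 0 q = q.
Proof.
rewrite /all_round (word_map0 (A := A)) //; first exact: (all_moves_map mvP).
by move=> j _; rewrite /coords; case: insubP => // i _ _; rewrite mxE.
Qed.

(** At [s = 0] the translations of one box around [q0] already move the point in [n] independent
    directions. This is witnessed by a nonzero determinant, which persists for nearby parameters and
    points jointly. *)
Lemma near_onto_all_round (q0 : T) : \forall sq \near ((0 : 'rV[R]_m), q0 : T),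
  onto (@vect_atlas R 'rV[R]_m) A (all_round ^~ sq.2) sq.1.
Proof.
have [a bq0] := inner_cover q0.
have atm := C1_atlas_vect (fin_dim_rV m) : C1_atlas setT (@vect_atlas R 'rV[R]_m).
have atmA := C1_atlas_prod atm atA.
have [Ac r0 _] := boxes a; have cc := atlas_chart atA Ac.
have [cq0 sq0] := bq0.
set c := bc a in Ac cc cq0 *.
pose x0 := chart_map c q0.
have [cont ext] := C1_all_round (0, q0).
have pc : chart_at (prod_atlas (@vect_atlas R 'rV[R]_m) A) (0, q0) (prod_chart (vect_chart 'rV[R]_m) c).
  by split=> //; exists (vect_chart 'rV[R]_m) => //; exists c.
have dc : chart_at A (all_round 0 q0) c by rewrite all_round0.
have [g [cg eg]] := ext _ _ pc dc.
rewrite /= -/x0 in cg eg.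
(* At (0, x0), the derivative of [g] in the direction of the parameter of the
   i-th translation in the box [a] is a nonzero multiple of [e_i]. *)
have /choice[idx idxP] : forall i : 'I_n, exists k : 'I_m,
    forall u, all_round (u *: delta_mx ord0 k) = mv (Some (a, i, None)) u.
  by move=> i; exact: all_round_axis.
(* Positive because [q0] lies in the inner box, where neither the speed of the line flow nor the
   damping vanishes. *)
pose kappa i := br a * (flow_speed 0 (box_coord (bx a) (br a) x0 ord0 i) *
  box_amp i None (box_coord (bx a) (br a) x0)).
have xi1 i : (box_coord (bx a) (br a) x0 ord0 i) ^+ 2 < 9^-1 /\
    sumsq_but i (box_coord (bx a) (br a) x0) < 9^-1.
  move: sq0; rewrite -/c -/x0 (bigD1 i) //= -/(sumsq_but _ _).
  have : 0 <= (box_coord (bx a) (br a) x0 ord0 i) ^+ 2 by exact: sqr_ge0.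
  have : 0 <= sumsq_but i (box_coord (bx a) (br a) x0).
    by apply: sumr_ge0 => j _; exact: sqr_ge0.
  by move=> h1 h2 h3; split; lra.
have kappa0 i : 0 < kappa i.
  have [h1 h2] := xi1 i.
  rewrite /kappa mulr_gt0 // mulr_gt0 //; first by apply: flow_speed_gt0; lra.
  by rewrite /box_amp mul1r sqpos_gt0 ?exprn_gt0 // subr_gt0; lra.
have dg i : 'd g (0, x0) (delta_mx ord0 (idx i), 0) = kappa i *: delta_mx ord0 i.
  have [h1 h2] := xi1 i.
  rewrite -diff_box_flow_time; last by lra.
  rewrite -(diff_partial _ (C1at_box_flow (bx a) (br a) i None (0, x0))).
  rewrite -(diff_partial _ cg).
  pose l (u : R) : 'rV[R]_m := u *: delta_mx ord0 (idx i).
  have sl : linear l by move=> b u v; rewrite /l scalerDl scalerA.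
  pose sM := GRing.isLinear.Build _ _ _ _ _ sl.
  pose sL : {linear R -> 'rV[R]_m} := HB.pack l sM.
  have cl : continuous sL by exact: scalel_continuous.
  have l0 : sL 0 = 0 by rewrite linear0.
  have cgp : C1at (fun s => g (s, x0)) (sL 0).
    by rewrite l0; exact: (C1at_partial (fin_dim_rV m) (fin_dim_rV n) cg).
  have := diff_compC1 (1 : R) (C1at_lin (0 : R) cl) cgp.
  rewrite l0 (diff_lin _ cl) -[sL 1]/(1 *: delta_mx ord0 (idx i)) scale1r => <-.
  pose fl (u : R) := (fun p : R * 'rV[R]_n => box_flow (bx a) (br a) i None p.1 p.2) (u, x0).
  have E : \forall u \near (0 : R), fl u = ((fun s => g (s, x0)) \o sL) u.
    have eg0 : \forall s \near (0 : 'rV[R]_m), g (s, x0) = chart_map c (all_round s q0).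
      have [[U V] /= [nU nV] UV] := eg.
      apply: filterS nU => s Us; rewrite (UV (s, x0)) //=.
        by rewrite (chart_mapK cc).
      by split=> //=; exact: (nbhs_singleton nV).
    have nl : \forall u \near (0 : R), g (sL u, x0) = chart_map c (all_round (sL u) q0).
      by rewrite -l0 in eg0; exact: (cl 0 _ eg0).
    apply: filterS nl => u nlu; apply: etrans (esym nlu).
    rewrite -[sL u]/(u *: delta_mx ord0 (idx i)) idxP /=.
    by have [_ ->] := box_move_dom atA (boxes a) i None u cq0.
  have cb : C1at fl 0.
    exact: (C1at_partial fin_dim_R (fin_dim_rV n) (C1at_box_flow (bx a) (br a) i None (0, x0))).
  have [_ EE] := near_eq_diff E (C1at_diff cb).
  exact (congr1 (fun h => h 1) EE).
(* The [n] selected parameters out of [m] give a square minor of the derivative; its invertibility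
   gives surjectivity. *)
pose Mx y : 'M[R]_n := \matrix_i 'd g y (delta_mx ord0 (idx i), 0).
have Mx0 : \det (Mx (0, x0)) != 0.
  have -> : Mx (0, x0) = diag_mx (\row_i kappa i).
    apply/matrixP => i j; rewrite !mxE dg !mxE eqxx /= eq_sym.
    by case: eqVneq => _; rewrite ?mulr1 ?mulr1n ?mulr0 ?mulr0n.
  rewrite det_diag; apply/prodf_neq0 => i _; rewrite mxE gt_eqF //.
have cdet : {for (0, x0), continuous (fun y => \det (Mx y))}.
  apply: continuous_det_at => i j.
  have [_ /(_ (delta_mx ord0 (idx i), 0)) cd] := C1at_pt cg.
  have -> : (fun s => Mx s i j) = (fun v : 'rV[R]_n => v ord0 j) \o
      (fun s => 'd g s (delta_mx ord0 (idx i), 0)) by apply/funext => s; rewrite /= mxE.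
  by apply: continuous_comp; [exact: cd|exact: coord_continuous].
have ndet : \forall y \near (0, x0), \det (Mx y) != 0.
  have N0 : nbhs (\det (Mx (0, x0))) [set r | r != 0].
    by apply: open_nbhs_nbhs; split => //; exact: open_neq.
  exact: (cdet _ N0).
(* The derivative at a nearby point is read off the same [g], so [g] must still be C^1 there and
   represent the family in a neighbourhood of that point. *)
have good : \forall y \near (0, x0), [/\ \det (Mx y) != 0, C1at g y &
   \forall z \near y, g z = chart_map c (all_round z.1 (chart_inv c z.2))].
  have eg' : \forall y \near (0, x0), g y = chart_map c (all_round y.1 (chart_inv c y.2)).
    by apply: filterS eg => y; apply.
  near=> y; split; first by near: y.
  - by near: y; exact (C1at_near cg).
  - by near: y; exact (near_join eg').
have ndom : \forall sq \near ((0 : 'rV[R]_m), q0 : T), chart_dom c sq.2 /\ chart_dom c (all_round sq.1 sq.2).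
  have o1 : nbhs q0 (chart_dom c) by apply: open_nbhs_nbhs; split=> //; exact: (chart_dom_open cc).
  have o2 : nbhs (all_round 0 q0) (chart_dom c) by rewrite all_round0.
  have h1 := near_snd (p := ((0 : 'rV[R]_m), q0)) o1.
  have h2 : \forall sq \near ((0 : 'rV[R]_m), q0 : T), chart_dom c (all_round sq.1 sq.2) := cont _ o2.
  by near=> sq; split; near: sq.
have ngood : \forall sq \near ((0 : 'rV[R]_m), q0 : T), [/\ \det (Mx (sq.1, chart_map c sq.2)) != 0,
    C1at g (sq.1, chart_map c sq.2) & \forall z \near (sq.1, chart_map c sq.2),
     g z = chart_map c (all_round z.1 (chart_inv c z.2))].
  have [[U V] /= [nU nV] UV] := good.
  have nV' : nbhs q0 [set q | V (chart_map c q)] := chart_map_cont cc cq0 nV.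
  exists (U, [set q | V (chart_map c q)]); first by split; [exact: nU|exact: nV'].
  move=> [s q] [Us Vq]; exact: (UV (s, chart_map c q) (conj Us Vq)).
near=> sq.
have [dq dEq] : chart_dom c sq.2 /\ chart_dom c (all_round sq.1 sq.2) by near: sq.
have [Mn cgs egs] : [/\ \det (Mx (sq.1, chart_map c sq.2)) != 0,
    C1at g (sq.1, chart_map c sq.2) & \forall z \near (sq.1, chart_map c sq.2),
     g z = chart_map c (all_round z.1 (chart_inv c z.2))] by near: sq.
set s := sq.1; set q := sq.2.
have vs : chart_at (@vect_atlas R 'rV[R]_m) s (vect_chart 'rV[R]_m) by [].
have dEq' : chart_at A (all_round s q) c by [].
have cpart : C1_near setT (@vect_atlas R 'rV[R]_m) A (all_round ^~ q) s.
  have c2 := C1_near_cst atm atA q s.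
  exact: (C1_near_comp atm atmA (C1_near_pair atm (C1_near_id atm s) c2) (C1_all_round (s, q))).
apply/(ontoP atm atA cpart vs dEq') => w.
have exts : is_ext setT (all_round ^~ q) (vect_chart 'rV[R]_m) c s (fun u => g (u, chart_map c q)).
  split; first exact: (C1at_partial (fin_dim_rV m) (fin_dim_rV n) cgs).
  have [[U V] /= [nU nV] UV] := egs.
  apply: filterS nU => u Uu _; rewrite (UV (u, chart_map c q)) //=.
    by rewrite (chart_mapK cc).
  by split=> //=; exact: (nbhs_singleton nV).
rewrite (DexprE (atlas_fat atm) (atlas_chart atm vs.1) cc vs.2 dEq cpart.1 exts).
pose b := w *m invmx (Mx (s, chart_map c q)).
exists (\sum_i b ord0 i *: delta_mx ord0 (idx i)).
rewrite -[chart_map _ s]/s (diff_partial _ cgs).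
have -> : (\sum_i b ord0 i *: delta_mx ord0 (idx i) : 'rV[R]_m, 0 : 'rV[R]_n) =
  \sum_i b ord0 i *: (delta_mx ord0 (idx i) : 'rV[R]_m, 0 : 'rV[R]_n).
  elim/big_ind2: _ => // [x1 x2 y1 y2 <- <-|i _].
    by rewrite -[RHS]/(_, _) /= addr0.
  by rewrite -[RHS]/(_, _) /= scaler0.
rewrite linear_sum; under eq_bigr => i _ do rewrite linearZ.
have <- : b *m Mx (s, chart_map c q) = w.
  by rewrite mulmxKV // unitmxE unitfE.
by rewrite mulmx_sum_row; apply: eq_bigr => i _; rewrite rowK.
Unshelve. all: by end_near. Qed.

Lemma onto_all_round (cT : compact [set: T]) : exists2 e : R, 0 < e &
  forall s : 'rV[R]_m, `|s| <= e -> forall q, onto (@vect_atlas R 'rV[R]_m) A (all_round ^~ q) s.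
Proof.
pose P (s : 'rV[R]_m) (q : T) := onto (@vect_atlas R 'rV[R]_m) A (all_round ^~ q) s.
have nP q0 : [set: T] q0 -> \forall q \near q0 & s \near (0 : 'rV[R]_m), P s q.
  move=> _; have [[U V] /= [nU nV] UV] := near_onto_all_round q0.
  exists (V, U); first by split; [exact: nV|exact: nU].
  by move=> [q s] /= [Vq Us]; exact: (UV (s, q) (conj Us Vq)).
have H : nbhs (0 : 'rV[R]_m) [set s | [set: T] `<=` P s].
  exact: ((compact_near_coveringP _).1 cT _ (nbhs (0 : 'rV[R]_m)) P (nbhs_filter _) nP).
(* Half the radius passes from an open ball to the closed condition [|s| <= e]. *)
move/nbhs_normP: H => [e /= e0 He]; exists (e / 2); first by rewrite divr_gt0.
move=> s se q; apply: He => //=.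
by rewrite sub0r normrN; apply: le_lt_trans se _; lra.
Qed.

End OntoMoves.

(** * The closed ball as a manifold with boundary *)

Section HigherOrder.
Context {R : realType} {E : normedModType R}.
Variables (U : set E) (oU : open U).
Implicit Types F : normedModType R.

Lemma open_near (x : E) (P : set E) : U x -> (forall y, U y -> P y) -> \forall y \near x, P y.
Proof. by move=> Ux UP; apply: (filterS UP); exact: open_nbhs_nbhs. Qed.

Lemma Ck_eq {F} k (f g : E -> F) : (forall x, U x -> f x = g x) -> Ck k U f -> Ck k U g.
Proof.
elim: k f g => [|k IH] f g fg /=.
  move=> cf x Ux; apply: near_eq_continuous (cf x Ux).
  exact: open_near.
move=> [df cf]; have nfg x : U x -> \forall y \near x, f y = g y.
  by move=> Ux; exact: open_near.
split=> [x Ux|v]; first by have [] := near_eq_diff (nfg x Ux) (df x Ux).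
apply: IH (cf v) => x Ux.
by have [_ ->] := near_eq_diff (nfg x Ux) (df x Ux).
Qed.

Lemma Ck_pred {F} k (f : E -> F) : Ck k.+1 U f -> Ck k U f.
Proof.
elim: k f => [|k IH] f [df cf].
  by move=> x Ux; exact: differentiable_continuous (df x Ux).
by split=> // v; exact: IH.
Qed.

Lemma Ck_cst {F} k (a : F) : Ck k U (cst a).
Proof.
elim: k a => [|k IH] a /=; first by move=> x _; exact: cst_continuous.
split=> [x _|v]; first exact: differentiable_cst.
by apply: Ck_eq (IH 0) => x _; rewrite diff_cst.
Qed.

Lemma Ck_lin {F} k (f : {linear E -> F}) : continuous f -> Ck k U f.
Proof.
case: k => [|k] cf /=; first by move=> x _; exact: cf.
split=> [x _|v]; first exact: linear_differentiable.
by apply: Ck_eq (Ck_cst k (f v)) => x _; rewrite diff_lin.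
Qed.

Lemma Ck_add {F} k (f g : E -> F) : Ck k U f -> Ck k U g -> Ck k U (fun x => f x + g x).
Proof.
elim: k f g => [|k IH] f g /=.
  by move=> cf cg x Ux; apply: cvgD; [exact: cf|exact: cg].
move=> [df cf] [dg cg]; split=> [x Ux|v].
  exact (differentiableD (df x Ux) (dg x Ux)).
apply: Ck_eq (IH _ _ (cf v) (cg v)) => x Ux.
exact (esym (congr1 (fun h => h v) (diffD (df x Ux) (dg x Ux)))).
Qed.

Lemma Ck_mul k (f g : E -> R) : Ck k U f -> Ck k U g -> Ck k U (fun x => f x * g x).
Proof.
elim: k f g => [|k IH] f g.
  by move=> cf cg x Ux; apply: cvgM; [exact: cf|exact: cg].
move=> cf' cg'; have cf := Ck_pred cf'; have cg := Ck_pred cg'.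
case: cf' cg' => [df ddf] [dg ddg]; split=> [x Ux|v].
  exact (differentiableM (df x Ux) (dg x Ux)).
apply: Ck_eq (Ck_add (IH _ _ cf (ddg v)) (IH _ _ cg (ddf v))) => x Ux.
exact (esym (congr1 (fun h => h v) (diffM (df x Ux) (dg x Ux)))).
Qed.

Lemma Ck_inv k (f : E -> R) : (forall x, U x -> f x != 0) -> Ck k U f ->
  Ck k U (fun x => (f x)^-1).
Proof.
move=> f0; elim: k => [|k IH].
  by move=> cf x Ux; apply: cvgV; [exact: f0|exact: cf].
move=> cf'; have cf := IH (Ck_pred cf'); case: cf' => [df ddf]; split=> [x Ux|v].
  exact (differentiableV (df x Ux) (f0 x Ux)).
apply: Ck_eq (Ck_mul (Ck_mul (Ck_cst k (-1 : R)) (Ck_mul cf cf)) (ddf v)) => x Ux.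
apply: etrans (esym (congr1 (fun h => h v) (diffV (df x Ux) (f0 x Ux)))).
by rewrite -[RHS]/(- (f x) ^- 2 * _) mulN1r -expr2 exprVn.
Qed.

Lemma Ck_sum {F} k (I : Type) (r : seq I) (f : I -> E -> F) :
  (forall i, Ck k U (f i)) -> Ck k U (fun x => \sum_(i <- r) f i x).
Proof.
move=> cf; elim: r => [|i r IH].
  by apply: Ck_eq (Ck_cst k 0) => x _; rewrite big_nil.
by apply: Ck_eq (Ck_add (cf i) IH) => x _; rewrite big_cons.
Qed.

Lemma Ck_comp_lin {F F'} k (l : {linear F -> F'}) (f : E -> F) : continuous l ->
  Ck k U f -> Ck k U (l \o f).
Proof.
move=> cl; elim: k f => [|k IH] f /=.
  by move=> cf x Ux; apply: continuous_comp; [exact: cf|exact: cl].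
move=> [df ddf]; have dl y := linear_differentiable (f := l) y cl.
split=> [x Ux|v]; first exact: (differentiable_comp (df x Ux) (dl _)).
apply: Ck_eq (IH _ (ddf v)) => x Ux.
apply: etrans (esym (congr1 (fun h => h v) (diff_comp (df x Ux) (dl _)))).
by rewrite /= (diff_lin _ cl).
Qed.

End HigherOrder.

Section RowVectors.
Context {R : realType} {m : nat} (U : set 'rV[R]_m) (oU : open U).

Lemma Ck_rVcoord k (j : 'I_m) : Ck k U (fun y : 'rV[R]_m => y ord0 j).
Proof.
have sl : linear (fun y : 'rV[R]_m => y ord0 j : R) by move=> a u v; rewrite !mxE.
pose sM := GRing.isLinear.Build _ _ _ _ _ sl.
pose sL : {linear _ -> _} := HB.pack (fun y : 'rV[R]_m => y ord0 j : R) sM.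
apply: (Ck_lin oU k (f := sL)); exact: coord_continuous.
Qed.

Lemma Ck_row {n} k (f : 'rV[R]_m -> 'rV[R]_n) :
  (forall j, Ck k U (fun y => f y ord0 j)) -> Ck k U f.
Proof.
move=> cf.
have H j : Ck k U (fun y => f y ord0 j *: (delta_mx ord0 j : 'rV[R]_n)).
  have sl : linear (fun a : R => a *: (delta_mx ord0 j : 'rV[R]_n)).
    by move=> a u v; rewrite scalerDl scalerA.
  pose sM := GRing.isLinear.Build _ _ _ _ _ sl.
  pose sL : {linear _ -> _} := HB.pack (fun a : R => a *: (delta_mx ord0 j : 'rV[R]_n)) sM.
  apply: (Ck_comp_lin oU (l := sL) _ (cf j)); exact: scalel_continuous.
apply: (Ck_eq oU) (Ck_sum oU (index_enum 'I_n) H) => y _.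
exact/esym/row_sum_delta.
Qed.

End RowVectors.

(** * The inversion between the unit ball and the half-space *)

Section Cayley.
Context {R : realType} {m : nat} (i0 : 'I_m).
Implicit Types x y t : 'rV[R]_m.

Definition sqnorm x : R := \sum_j x ord0 j ^+ 2.

Local Notation e0 := (delta_mx ord0 i0 : 'rV[R]_m).

(* The inversion of centre [-e0] exchanging the unit ball and the half-space. *)
Definition cayley y : 'rV[R]_m := - e0 + (2 / sqnorm (y + e0)) *: (y + e0).

Lemma sqnorm_ge0 x : 0 <= sqnorm x.
Proof. by apply: sumr_ge0 => j _; exact: sqr_ge0. Qed.

Lemma sqnorm_eq0 x : (sqnorm x == 0) = (x == 0).
Proof.
apply/eqP/eqP => [x0|->]; last by rewrite /sqnorm big1 // => j _; rewrite mxE expr0n.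
apply/rowP => j; rewrite mxE; apply/eqP; rewrite -sqrf_eq0; apply/eqP.
exact: (psumr_eq0P (P := predT) (F := fun j => x ord0 j ^+ 2) (fun j _ => sqr_ge0 _) x0).
Qed.

Lemma sqnormZ a x : sqnorm (a *: x) = a ^+ 2 * sqnorm x.
Proof. by rewrite /sqnorm mulr_sumr; apply: eq_bigr => j _; rewrite mxE exprMn. Qed.

Lemma sqnormDe0 a x : sqnorm (x + a *: e0) = sqnorm x + 2 * a * x ord0 i0 + a ^+ 2.
Proof.
rewrite /sqnorm (bigD1 i0) //= [in RHS](bigD1 i0) //= !mxE !eqxx /= mulr1.
have -> : \sum_(j < m | j != i0) (x + a *: e0) ord0 j ^+ 2 = \sum_(j < m | j != i0) x ord0 j ^+ 2.
  by apply: eq_bigr => j ji; rewrite !mxE (negbTE ji) /= mulr0 addr0.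
by ring.
Qed.

Lemma sqnormDe x : sqnorm (x + e0) = sqnorm x + 2 * x ord0 i0 + 1.
Proof. by rewrite -[e0]scale1r sqnormDe0 mulr1 expr1n. Qed.

Lemma sqnormN x : sqnorm (- x) = sqnorm x.
Proof. by rewrite -scaleN1r sqnormZ sqrrN expr1n mul1r. Qed.

Lemma sqnormDe_gt0 x : x != - e0 -> 0 < sqnorm (x + e0).
Proof. by move=> x0; rewrite lt_neqAle sqnorm_ge0 andbT eq_sym sqnorm_eq0 addr_eq0. Qed.

(** The sign of [y_0] decides whether [cayley y] lies in the ball, so the half-space is sent into
    the ball; [cayley_coord] gives the converse direction for the same involution. *)
Lemma sqnorm_cayley y : y != - e0 ->
  1 - sqnorm (cayley y) = 4 * y ord0 i0 / sqnorm (y + e0).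
Proof.
move=> y0; have q0 := sqnormDe_gt0 y0.
have -> : cayley y = (2 / sqnorm (y + e0)) *: (y + e0) + (- 1) *: e0.
  by rewrite scaleN1r addrC.
rewrite sqnormDe0 sqnormZ !mxE !eqxx /=.
by field; rewrite gt_eqF.
Qed.

Lemma cayley_coord y : y != - e0 ->
  cayley y ord0 i0 = (1 - sqnorm y) / sqnorm (y + e0).
Proof.
move=> y0; have q0 := sqnormDe_gt0 y0.
rewrite /cayley !mxE !eqxx /=; apply/eqP; rewrite -subr_eq0; apply/eqP.
have -> : - 1%:R + 2 / sqnorm (y + e0) * (y ord0 i0 + 1%:R) - (1 - sqnorm y) / sqnorm (y + e0) =
   (2 * y ord0 i0 + 1 + sqnorm y - sqnorm (y + e0)) / sqnorm (y + e0).
  by field; rewrite gt_eqF.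
by rewrite sqnormDe; field; rewrite -sqnormDe gt_eqF.
Qed.

Lemma cayley_neq y : y != - e0 -> cayley y != - e0.
Proof.
move=> y0; have q0 := sqnormDe_gt0 y0.
rewrite -subr_eq0 opprK addrAC addNr add0r scaler_eq0 negb_or.
by rewrite mulf_neq0 ?invr_eq0 ?gt_eqF //= addr_eq0.
Qed.

Lemma cayleyK y : y != - e0 -> cayley (cayley y) = y.
Proof.
move=> y0; have q0 := sqnormDe_gt0 y0.
have E : cayley y + e0 = (2 / sqnorm (y + e0)) *: (y + e0) by rewrite /cayley addrAC addNr add0r.
rewrite {1}/cayley E sqnormZ scalerA.
have -> : 2 / ((2 / sqnorm (y + e0)) ^+ 2 * sqnorm (y + e0)) * (2 / sqnorm (y + e0)) = 1.
  by field; rewrite gt_eqF.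
by rewrite scale1r addrC addrK.
Qed.

(** The transition between the two charts: an inversion in the unit sphere followed by the linear
    map that keeps the coordinate [i0] and negates the others. It is singular at 0 only, which
    represents the centre of the other inversion. *)
Lemma cayley_opp y : y != - e0 -> y != 0 ->
  cayley (- cayley y) = (sqnorm y)^-1 *: ((2 * y ord0 i0) *: e0 - y).
Proof.
move=> y0 yn0; have q0 := sqnormDe_gt0 y0.
have s0 : 0 < sqnorm y by rewrite lt_neqAle sqnorm_ge0 andbT eq_sym sqnorm_eq0.
have q : sqnorm (- cayley y + e0) = 4 * sqnorm y / sqnorm (y + e0).
  rewrite (sqnormDe (- cayley y)) sqnormN mxE cayley_coord //.
  have -> : sqnorm (cayley y) = 1 - 4 * y ord0 i0 / sqnorm (y + e0).
    by rewrite -sqnorm_cayley // opprB addrC subrK.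
  apply/eqP; rewrite -subr_eq0; apply/eqP.
  have -> : 1 - 4 * y ord0 i0 / sqnorm (y + e0) + 2 * - ((1 - sqnorm y) / sqnorm (y + e0)) + 1 -
      4 * sqnorm y / sqnorm (y + e0) =
    2 * (sqnorm (y + e0) - (sqnorm y + 2 * y ord0 i0 + 1)) / sqnorm (y + e0).
    by field; rewrite gt_eqF.
  by rewrite -sqnormDe subrr mulr0 mul0r.
apply/rowP => j; rewrite {1}/cayley q !mxE eqxx /=.
have qE : sqnorm (y + e0) = sqnorm y + 2 * y ord0 i0 + 1 := sqnormDe y.
apply/eqP; rewrite -subr_eq0; apply/eqP.
set d : R := (j == i0)%:R.
(* The difference of the two sides is a multiple of the relation [qE]. Until here [sqnorm (y + e0)]
   is an independent unknown, as [field] requires. *)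
transitivity ((sqnorm (y + e0) - (sqnorm y + 2 * y ord0 i0 + 1)) / sqnorm y * d); last first.
  by rewrite qE subrr mul0r mul0r.
by field; rewrite !gt_eqF.
Qed.

Lemma C1at_sqnorm {E : normedModType R} (f : E -> 'rV[R]_m) (z : E) : C1at f z ->
  C1at (fun z => sqnorm (f z)) z.
Proof.
move=> cf; apply: C1at_sum => j _.
have cj := C1at_comp (fin_dim_rV m) cf (C1at_rVcoord j (f z)).
exact: C1at_ext (C1at_mul cj cj).
Qed.

Lemma C1at_cayley y : y != - e0 -> C1at cayley y.
Proof.
move=> y0.
have cy : C1at (fun y => y + e0) y by apply: C1at_add; [exact: C1at_id|exact: (C1at_cst e0 y)].
apply: C1at_add; first exact: (C1at_cst (- e0) y).
have cs : C1at (fun y => 2 / sqnorm (y + e0)) y.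
  apply: C1at_mul; first exact: (C1at_cst (2 : R) y).
  apply: C1at_inv; first by rewrite gt_eqF // sqnormDe_gt0.
  exact: C1at_sqnorm.
apply: C1at_coord => j.
have cj := C1at_comp (fin_dim_rV m) cy (C1at_rVcoord j _).
by apply: C1at_ext (C1at_mul cs cj) => z; rewrite [RHS]mxE.
Qed.

Lemma Cinfty_transition : Cinfty [set~ (0 : 'rV[R]_m)]
  (fun y => (sqnorm y)^-1 *: ((2 * y ord0 i0) *: e0 - y)).
Proof.
move=> k.
have oU : open [set~ (0 : 'rV[R]_m)] by apply: closed_openC; exact: (accessible_closed_set1 (hausdorff_accessible (@norm_hausdorff _ _))).
apply: (Ck_row oU) => j.
have cs : Ck k [set~ (0 : 'rV[R]_m)] (fun y => (sqnorm y)^-1).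
  apply: (Ck_inv oU); first by move=> y /eqP; rewrite sqnorm_eq0.
  apply: (Ck_sum oU) => l.
  exact: (Ck_mul oU (Ck_rVcoord oU k l) (Ck_rVcoord oU k l)).
have c1 := Ck_mul oU (Ck_cst oU k (2 * (j == i0)%:R : R)) (Ck_rVcoord oU k i0).
have c2 := Ck_mul oU (Ck_cst oU k (-1 : R)) (Ck_rVcoord oU k j).
apply: (Ck_eq oU) (Ck_mul oU cs (Ck_add oU c1 c2)) => y _.
rewrite !mxE eqxx /= mulN1r; congr (_ * (_ - _)); ring.
Qed.

End Cayley.

(** * The closed ball and its two charts *)

Section Disc.
Context {R : realType} {m : nat} (i0 : 'I_m) (hi0 : i0 = 0%N :> nat).
Implicit Types (x y t : 'rV[R]_m) (b : bool).

Local Notation e0 := (delta_mx ord0 i0 : 'rV[R]_m).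
Local Notation HS := (half_space R m).

Lemma half_spaceP y : HS y <-> 0 <= y ord0 i0.
Proof.
split=> [|y0 i i00]; first by apply.
by suff -> : i = i0 by []; apply: val_inj; rewrite /= hi0.
Qed.

Lemma half_space_interior y : 0 < y ord0 i0 -> HS° y.
Proof.
move=> y0; have N0 : nbhs (y ord0 i0) [set r | 0 < r] by exact: lt_nbhsr.
have H : \forall z \near y, 0 < (z : 'rV[R]_m) ord0 i0 by exact: (@coord_continuous _ _ _ ord0 i0 y _ N0).
by apply: filterS H => z /= z0; apply/half_spaceP; exact: ltW.
Qed.

Lemma half_space_fat : HS `<=` closure (HS°).
Proof.
move=> y /half_spaceP y0 B /nbhs_normP[e /= e0' Be].
exists (y + (e / 2) *: e0); split.
  apply: half_space_interior; rewrite !mxE !eqxx mulr1 ltr_wpDl // divr_gt0 //.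
apply: Be; rewrite /= opprD addrA subrr sub0r normrN normrZ gtr0_norm ?divr_gt0 //.
apply: (@le_lt_trans _ _ (e / 2)); last by lra.
rewrite ler_piMr ?divr_ge0 ?(ltW e0') //.
rewrite [leLHS]/Num.norm /= mx_normrE; apply/bigmax_leP; split=> //= -[a c] _ /=.
by rewrite mxE; case: andb; rewrite ?normr1 ?normr0.
Qed.

Definition disc : set 'rV[R]_m := [set t | sqnorm t <= 1].

Definition disc_space : topologicalType := set_type disc.

Lemma disc0 : (0 : 'rV[R]_m) \in disc.
Proof. by rewrite inE /disc /= /sqnorm big1 // => j _; rewrite mxE expr0n. Qed.

(** Off the disc the value is the origin by default, so continuity is always stated relative to
    [disc]. *)
Definition disc_proj t : disc_space := insubd (exist _ 0 disc0 : set_type disc) t.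

Definition disc_val (h : disc_space) : 'rV[R]_m := set_val h.

Lemma disc_valP h : sqnorm (disc_val h) <= 1.
Proof. by case: h => t /= ht; have := ht; rewrite inE. Qed.

Lemma disc_projK t : disc t -> disc_val (disc_proj t) = t.
Proof. by move=> dt; rewrite /disc_val /disc_proj /set_val /= insubdK // inE. Qed.

Lemma disc_valK h : disc_proj (disc_val h) = h.
Proof. exact: valKd. Qed.

Lemma disc_val_inj : injective disc_val.
Proof. exact: val_inj. Qed.

Lemma disc_val_continuous : continuous disc_val.
Proof. exact: initial_continuous. Qed.

Lemma disc_nbhs h (W : set disc_space) : nbhs h W ->
  exists B : set 'rV[R]_m, [/\ open B, B (disc_val h) & disc_val @^-1` B `<=` W].
Proof. by move=> [_ /= [[B oB <-] Bh] sBW]; exists B. Qed.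

Lemma disc_proj_near t (W : set disc_space) : disc t -> nbhs (disc_proj t) W ->
  \forall u \near t, disc u -> W (disc_proj u).
Proof.
move=> dt /disc_nbhs[B [oB Bt BW]]; rewrite disc_projK // in Bt.
have := open_nbhs_nbhs (conj oB Bt).
by apply: filterS => u Bu du; apply: BW; rewrite /= disc_projK.
Qed.

Lemma within_continuousI {E : normedModType R} (S : set E) (f : E -> disc_space) :
  (forall (x : E) W, S x -> nbhs (f x) W -> \forall y \near x, S y -> W (f y)) ->
  {within S, continuous f}.
Proof.
move=> H; rewrite continuous_subspace_in => x /[!inE] Sx W Wx.
have H' : nbhs_subspace (A := S) x (f @^-1` W) by rewrite -nbhs_subspace_in //; exact: H.
exact: H'.
Qed.

Lemma disc_hausdorff : hausdorff_space disc_space.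
Proof.
move=> p q pq; apply: disc_val_inj; apply: (@norm_hausdorff _ 'rV[R]_m) => A B nA nB.
have [h [Ah Bh]] := pq _ _ (disc_val_continuous nA) (disc_val_continuous nB).
by exists (disc_val h).
Qed.

Lemma disc_compact : compact [set: disc_space].
Proof.
have cd : compact disc.
  apply: bounded_closed_compact.
    exists 1; split; first exact: num_real.
    move=> M M1 t dt; apply: le_trans (ltW M1).
    rewrite [leLHS]/Num.norm /= mx_normrE; apply/bigmax_leP; split=> //= -[a j] _ /=.
    rewrite (ord1 a) -(@expr_le1 _ 2) // real_normK ?num_real //.
    apply: le_trans dt; rewrite /sqnorm (bigD1 j) //= lerDl.
    by apply: sumr_ge0 => l _; exact: sqr_ge0.
  have -> : disc = @sqnorm R m @^-1` [set r | r <= 1] by [].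
  apply: closed_comp; last exact: closed_le.
  move=> t _; exact: (C1at_cont (C1at_sqnorm (C1at_id t))).
have <- : disc_proj @` disc = [set: disc_space].
  apply/seteqP; split=> // h _; exists (disc_val h); first exact: disc_valP.
  exact: disc_valK.
apply: continuous_compact cd; apply: within_continuousI => t W dt.
exact: disc_proj_near.
Qed.

Lemma disc_second_countable : @second_countable disc_space.
Proof.
pose P : pseudoPMetricType R := HB.pack (set_type disc)
  (isPointed.Build (set_type disc) (exist _ 0 disc0 : set_type disc)).
exact: (@compact_second_countable R P disc_compact).
Qed.

(* Reflecting in the origin moves the centre [-e0] of the inversion to [e0]. *)
Definition antipode b t : 'rV[R]_m := if b then - t else t.

Lemma antipodeK b : involutive (antipode b).
Proof. by case: b => t //=; rewrite opprK. Qed.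

Lemma sqnorm_antipode b t : sqnorm (antipode b t) = sqnorm t.
Proof. by case: b => //=; rewrite sqnormN. Qed.

Lemma C1at_antipode b t : C1at (antipode b) t.
Proof. by case: b; [apply: C1at_opp|]; exact: C1at_id. Qed.

Definition disc_chart b : chart 'rV[R]_m disc_space :=
  Chart [set h | antipode b (disc_val h) != - e0]
    (fun h => cayley i0 (antipode b (disc_val h)))
    (fun y => disc_proj (antipode b (cayley i0 y))).

Definition disc_atlas : set (chart 'rV[R]_m disc_space) := [set disc_chart b | b in [set: bool]].

Lemma half_space_neq y : HS y -> y != - e0.
Proof.
move=> /half_spaceP; apply: contraTneq => ->.
by rewrite !mxE !eqxx /= -ltNge oppr_lt0 ltr01.
Qed.

Lemma cayley_disc b y : HS y -> disc (antipode b (cayley i0 y)).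
Proof.
move=> Hy; have y0 := half_space_neq Hy; rewrite /disc /= sqnorm_antipode -subr_ge0.
rewrite sqnorm_cayley // divr_ge0 ?sqnorm_ge0 // mulr_ge0 //.
exact/half_spaceP.
Qed.

Lemma cayley_half_space y : disc y -> y != - e0 -> HS (cayley i0 y).
Proof.
move=> dy y0; apply/half_spaceP; rewrite cayley_coord // divr_ge0 ?sqnorm_ge0 //.
by rewrite subr_ge0.
Qed.

Lemma disc_chart_val b y : HS y ->
  disc_val (chart_inv (disc_chart b) y) = antipode b (cayley i0 y).
Proof. by move=> Hy; rewrite disc_projK //; exact: cayley_disc. Qed.

Lemma disc_chart_inv b y : HS y -> chart_dom (disc_chart b) (chart_inv (disc_chart b) y) /\
  chart_map (disc_chart b) (chart_inv (disc_chart b) y) = y.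
Proof.
move=> Hy; have y0 := half_space_neq Hy.
rewrite /= !disc_projK; try exact: cayley_disc.
by rewrite antipodeK; split; [exact: cayley_neq|exact: cayleyK].
Qed.

Lemma disc_chart_image b : chart_map (disc_chart b) @` chart_dom (disc_chart b) = HS.
Proof.
apply/seteqP; split=> [_ [h hd <-]|y Hy].
  apply: cayley_half_space => //.
  by rewrite /disc /= sqnorm_antipode; exact: disc_valP.
by have [d E] := disc_chart_inv b Hy; exists (chart_inv (disc_chart b) y).
Qed.

Lemma disc_is_chart b : is_chart HS (disc_chart b).
Proof.
split.
- have oN : open [set~ - e0].
    by apply: closed_openC; exact: (accessible_closed_set1 (hausdorff_accessible (@norm_hausdorff _ _))).
  rewrite (_ : chart_dom _ = (antipode b \o disc_val) @^-1` [set~ - e0]); last first.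
    by apply/seteqP; split=> h /= /eqP.
  apply: open_comp => // h _; apply: continuous_comp; first exact: disc_val_continuous.
  exact: (C1at_cont (C1at_antipode b _)).
- by exists setT; [exact: openT|rewrite setTI disc_chart_image].
- by move=> h hd; rewrite /= cayleyK // antipodeK disc_valK.
- apply: continuous_in_subspaceT => h; rewrite inE => hd.
  apply: (@continuous_comp _ _ _ (antipode b \o disc_val) (cayley i0)).
    apply: continuous_comp; first exact: disc_val_continuous.
    exact: (C1at_cont (C1at_antipode b _)).
  exact: (C1at_cont (C1at_cayley hd)).
rewrite disc_chart_image; apply: within_continuousI => y W Hy Wy.
have near_proj := disc_proj_near (cayley_disc b Hy) Wy.
have cc : {for y, continuous (antipode b \o cayley i0)}.
  apply: continuous_comp; first exact: (C1at_cont (C1at_cayley (half_space_neq Hy))).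
  exact: (C1at_cont (C1at_antipode b _)).
have H : \forall z \near y, disc (antipode b (cayley i0 z)) -> W (disc_proj (antipode b (cayley i0 z))).
  exact: (cc _ near_proj).
by apply: filterS H => z Hz HSz; apply: Hz; exact: cayley_disc.
Qed.

Lemma disc_smooth_atlas : smooth_atlas HS disc_atlas.
Proof.
split.
- by move=> _ [b _ <-]; exact: disc_is_chart.
(* Each chart misses one point of the ball, and the missed points [-e0] and [e0] are distinct. *)
- move=> h; have [he|he] := eqVneq (disc_val h) (- e0); last first.
    by exists (disc_chart false) => //; exists false.
  exists (disc_chart true); first by exists true.
  rewrite /= he opprK eq_sym -subr_eq0 -opprD oppr_eq0 -mulr2n -scaler_nat scaler_eq0 negb_or pnatr_eq0 /=.
  by apply/eqP => /rowP/(_ i0); rewrite !mxE !eqxx /= => /eqP; rewrite oner_eq0.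
move=> _ _ [b _ <-] [b' _ <-] _ [h [hb hb'] <-].
have [bb|bb] := eqVneq b b'.
  exists id, setT; split=> //; first exact: openT.
    by move=> k; apply: (Ck_lin openT k (f := idfun)) => y; exact: cvg_id.
  move=> _ [h' [h'b h'b'] <-] _.
  by rewrite -bb /= cayleyK // antipodeK disc_valK.
(* Two different values of [b] compose to the reflection in the origin, which reduces the transition
   to [cayley_opp]. *)
have rr t : antipode b' (antipode b t) = - t.
  by move: bb; case: b {hb}; case: b' {hb'} => //= _; rewrite opprK.
have y0 h' : antipode b (disc_val h') != - e0 -> antipode b' (disc_val h') != - e0 ->
    cayley i0 (antipode b (disc_val h')) != 0.
  move=> h1 h2; apply: contraNneq h2 => c0.
  have -> : disc_val h' = antipode b (cayley i0 0) by rewrite -c0 cayleyK // antipodeK.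
  rewrite rr /cayley add0r.
  have -> : sqnorm e0 = 1.
    rewrite /sqnorm (bigD1 i0) //= big1 => [|j ji]; first by rewrite !mxE !eqxx expr1n addr0.
    by rewrite !mxE (negbTE ji) /= expr0n.
  by rewrite divr1 scaler_nat mulr2n addKr.
exists (fun y => (sqnorm y)^-1 *: ((2 * y ord0 i0) *: e0 - y)), [set~ 0]; split.
- by apply: closed_openC; exact: (accessible_closed_set1 (hausdorff_accessible (@norm_hausdorff _ _))).
- by move/eqP; apply/negP; exact: y0.
- exact: Cinfty_transition.
move=> _ [h' [h'b h'b'] <-] _ /=.
have hs : HS (cayley i0 (antipode b (disc_val h'))).
  by rewrite -(disc_chart_image b); exists h'.
rewrite (disc_projK (cayley_disc b hs)) rr cayley_opp //.
  exact: half_space_neq.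
exact: y0.
Qed.

Definition disc_manifold : manifold_with_boundary R m :=
  Manifold disc_hausdorff disc_second_countable disc_smooth_atlas.

Lemma disc_C1_atlas : C1_atlas HS (atlas disc_manifold).
Proof. exact: (smooth_atlas_C1 (fin_dim_rV m) half_space_fat disc_smooth_atlas). Qed.

Lemma disc_val_ext (h : disc_manifold) b : chart_dom (disc_chart b) h ->
  is_ext HS disc_val (disc_chart b) (vect_chart 'rV[R]_m) h (fun y => antipode b (cayley i0 y)).
Proof.
move=> hd; have hs : HS (chart_map (disc_chart b) h) by rewrite -(disc_chart_image b); exists h.
split.
  apply: (C1at_comp (fin_dim_rV m) (C1at_cayley (half_space_neq hs)) (C1at_antipode b _)).
by near=> y => Hy; rewrite disc_chart_val.
Unshelve. all: by end_near. Qed.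

Lemma disc_val_C1 (h : disc_manifold) :
  C1_near HS (atlas disc_manifold) (@vect_atlas R 'rV[R]_m) disc_val h.
Proof.
have [_ [b _ <-] hd] := atlas_cover disc_C1_atlas h.
apply: (C1_near_intro disc_C1_atlas (C1_atlas_vect (fin_dim_rV m)) _ _ _ (disc_val_ext hd)).
- exact: disc_val_continuous.
- by split=> //; exists b.
- by [].
Qed.

(** The chart expression of the inclusion extends across the boundary to [antipode b \o cayley i0],
    which has a C^1 local inverse. Surjectivity thus holds at boundary points as well, and
    submersivity passes from the vector space of parameters to the ball. *)
Lemma disc_val_onto (h : disc_manifold) :
  onto (atlas disc_manifold) (@vect_atlas R 'rV[R]_m) disc_val h.
Proof.
have [c Ac hd] := atlas_cover disc_C1_atlas h; have [b _ cE] := Ac.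
have atm : C1_atlas setT (@vect_atlas R 'rV[R]_m) := C1_atlas_vect (fin_dim_rV m).
have dh : chart_at (@vect_atlas R 'rV[R]_m) (disc_val h) (vect_chart 'rV[R]_m) by [].
apply: (iffRL (ontoP disc_C1_atlas atm (disc_val_C1 h) (conj Ac hd) dh)).
rewrite -cE in Ac hd *.
rewrite (DexprE half_space_fat (is_chart_C1 (disc_is_chart b)) (atlas_chart atm (erefl _)) hd _ _ (disc_val_ext hd)) //; last exact: disc_val_continuous.
set x := antipode b (disc_val h) in hd *.
have x0 : x != - e0 := hd.
rewrite -[chart_map _ h]/(cayley i0 x) => w.
have cx := C1at_cayley x0; have ccx := C1at_cayley (cayley_neq x0).
have cr := C1at_antipode b (disc_val h).
have nid : \forall t \near disc_val h,
    (id : 'rV[R]_m -> 'rV[R]_m) t = ((fun y => antipode b (cayley i0 y)) \o (cayley i0 \o antipode b)) t.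
  have oN : nbhs x [set~ - e0].
    apply: open_nbhs_nbhs; split; last exact/eqP.
    by apply: closed_openC; exact: (accessible_closed_set1 (hausdorff_accessible (@norm_hausdorff _ _))).
  have H : \forall t \near disc_val h, antipode b t <> - e0 by exact: (C1at_cont cr oN).
  apply: filterS H => t /eqP tN.
  by rewrite /= cayleyK // antipodeK.
have c1 : C1at (cayley i0 \o antipode b) (disc_val h) := C1at_comp (fin_dim_rV m) cr cx.
have c2 : C1at (fun y => antipode b (cayley i0 y)) (cayley i0 x).
  exact: (C1at_comp (fin_dim_rV m) ccx (C1at_antipode b _)).
exists ('d (cayley i0 \o antipode b) (disc_val h) w).
have := diff_compC1 w c1 c2; rewrite -[(cayley i0 \o antipode b) (disc_val h)]/(cayley i0 x) => <-.
have [_ ->] := near_eq_diff nid (C1at_diff (C1at_id (disc_val h))).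
by rewrite (@diff_lin _ _ _ idfun) // => y; exact: (@cvg_id 'rV[R]_m).
Qed.

Lemma disc_interior t : sqnorm t < 1 -> exists2 h : disc_manifold,
  manifold_interior disc_manifold h & disc_val h = t.
Proof.
move=> t1; exists (disc_proj t); last by apply: disc_projK; exact: ltW.
have t0 : t != - e0.
  apply: contraTneq t1 => ->; rewrite -leNgt sqnormN /sqnorm (bigD1 i0) //=.
  rewrite !mxE !eqxx expr1n lerDl; apply: sumr_ge0 => j _; exact: sqr_ge0.
exists (disc_chart false); split; first by exists false.
  by rewrite /= disc_projK //; exact: ltW.
rewrite /= disc_projK; last exact: ltW.
apply: half_space_interior; rewrite cayley_coord // divr_gt0 ?subr_gt0 //.
exact: sqnormDe_gt0.
Qed.

End Disc.

(** * The family *)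

Section PartialSubmersion.
Context {R : realType} {E1 E2 E3 : normedModType R} {T1 T2 T3 : topologicalType}.
Context {X1 : set E1} {X2 : set E2} {X3 : set E3}.
Context {A1 : set (chart E1 T1)} {A2 : set (chart E2 T2)} {A3 : set (chart E3 T3)}.
Hypotheses (at1 : C1_atlas X1 A1) (at2 : C1_atlas X2 A2) (at3 : C1_atlas X3 A3).

(** The derivative is block triangular with the identity on the second factor: [w2] prescribes the
    second component, and the first one corrects [w3] by the image of [(0, w2)]. *)
Lemma onto_graph (f : T1 * T2 -> T3) h p :
  C1_near (X1 `*` X2) (prod_atlas A1 A2) A3 f (h, p) ->
  C1_near X1 A1 A3 (fun h => f (h, p)) h ->
  onto A1 A3 (fun h => f (h, p)) h ->
  onto (prod_atlas A1 A2) (prod_atlas A2 A3) (fun hp => (hp.2, f hp)) (h, p).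
Proof.
move=> cf cfp ofp; have at12 := C1_atlas_prod at1 at2; have at23 := C1_atlas_prod at2 at3.
have [c1 Ac1 c1h] := atlas_cover at1 h; have [c2 Ac2 c2p] := atlas_cover at2 p.
have [c3 Ac3 c3f] := atlas_cover at3 (f (h, p)).
have C1 := atlas_chart at1 Ac1; have C2 := atlas_chart at2 Ac2; have C3 := atlas_chart at3 Ac3.
have c12 : chart_at (prod_atlas A1 A2) (h, p) (prod_chart c1 c2).
  by split=> //; exists c1 => //; exists c2.
have c23 : chart_at (prod_atlas A2 A3) (p, f (h, p)) (prod_chart c2 c3).
  by split=> //; exists c2 => //; exists c3.
have cev : C1_near (X1 `*` X2) (prod_atlas A1 A2) (prod_atlas A2 A3) (fun hp => (hp.2, f hp)) (h, p).
  exact: (C1_near_pair at12 (C1_near_snd at1 at2 (h, p)) cf).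
apply: (iffRL (ontoP at12 at23 cev c12 c23)).
have [g [cg eg]] := cf.2 _ _ c12 (conj Ac3 c3f).
rewrite -[chart_map _ _]/(chart_map c1 h, chart_map c2 p) in cg eg.
have ext : is_ext (X1 `*` X2) (fun hp : T1 * T2 => (hp.2, f hp)) (prod_chart c1 c2)
    (prod_chart c2 c3) (h, p) (fun y => (y.2, g y)).
  split; first by apply: C1at_pair => //; exact: C1at_snd.
  have nT : nbhs p [set: T2] by exact: filterT.
  have := near_snd (p := (chart_map c1 h, chart_map c2 p)) (chart_inv_near C2 c2p nT).
  move: eg; apply: filterS2 => y H1 H2 Xy.
  by rewrite /= (H1 Xy); have [_ -> _] := H2 Xy.2.
have C12 := atlas_chart at12 c12.1; have C23 := atlas_chart at23 c23.1.
rewrite (DexprE (atlas_fat at12) C12 C23 c12.2 c23.2 cev.1 ext).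
have extp : is_ext X1 (fun h => f (h, p)) c1 c3 h (fun y => g (y, chart_map c2 p)).
  split; first exact: (C1at_partial (atlas_fin at1) (atlas_fin at2) cg).
  have [[U V] /= [nU nV] UV] := eg.
  apply: filterS nU => y Uy X1y.
  rewrite (UV (y, chart_map c2 p)) /=; first by rewrite (chart_mapK C2).
    by split=> //=; exact: (nbhs_singleton nV).
  by split=> //=; exact: (chart_map_model C2).
have ofp' := iffLR (ontoP at1 at3 cfp (conj Ac1 c1h) (conj Ac3 c3f)) ofp.
rewrite (DexprE (atlas_fat at1) C1 C3 c1h c3f cfp.1 extp) in ofp'.
move=> [w2 w3]; set x := (chart_map c1 h, chart_map c2 p).
have [v1 v1E] := ofp' (w3 - 'd g x (0, w2)).
exists (v1, w2).
have ds := C1at_diff (C1at_snd x).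
apply: etrans (congr1 (fun h => h (v1, w2)) (diff_pair ds (C1at_diff cg))) _.
congr (_, _).
  by rewrite (@diff_lin _ _ _ snd) // => y; exact: cvg_snd.
have -> : (v1, w2) = (v1, 0) + (0, w2) by rewrite -[RHS]/(v1 + 0, 0 + w2) addr0 add0r.
by rewrite linearD -(diff_partial v1 cg) v1E subrK.
Qed.

End PartialSubmersion.

Section VectorMaps.
Context {R : realType}.

Lemma onto_vect (E F : normedModType R) (f : E -> F) x : fin_dim E -> fin_dim F ->
  C1at f x -> (forall w, exists v, 'd f x v = w) ->
  onto (@vect_atlas R E) (@vect_atlas R F) f x.
Proof.
move=> fE fF cf H; have atE := C1_atlas_vect fE; have atF := C1_atlas_vect fF.
have cE : chart_at (@vect_atlas R E) x (vect_chart E) by [].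
have cF : chart_at (@vect_atlas R F) (f x) (vect_chart F) by [].
apply: (iffRL (ontoP atE atF (C1_near_vect cf) cE cF)).
have ext : is_ext setT f (vect_chart E) (vect_chart F) x f by split=> //; exact: nearW.
by rewrite (DexprE (atlas_fat atE) (atlas_chart atE cE.1) (atlas_chart atF cF.1)
  cE.2 cF.2 (C1at_cont cf) ext).
Qed.

Lemma C1at_submx (m1 m2 : nat) (a : R) (t : 'rV[R]_(m1 + m2)) :
  C1at (fun t : 'rV[R]_(m1 + m2) => a *: lsubmx t) t /\
  C1at (fun t : 'rV[R]_(m1 + m2) => a *: rsubmx t) t.
Proof.
by split; apply: C1at_scale; apply: C1at_lin;
  [exact: continuous_lsubmx|exact: continuous_rsubmx].
Qed.

End VectorMaps.

Section Family.
Context {R : realType} {n : nat} {T : topologicalType}.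
Variable (A : set (chart 'rV[R]_n T)).
Hypothesis (atA : C1_atlas setT A) (hT : hausdorff_space T) (cT : compact [set: T]).
Variables (N : nat) (bc : 'I_N -> chart 'rV[R]_n T) (bx : 'I_N -> 'rV[R]_n)
  (br : 'I_N -> R).
Hypotheses (boxes : forall a, chart_box A (bc a) (bx a) (br a)).

Local Notation mv := (moves bc bx br).
Let mvP j : is_move A (mv j) := moves_are_moves atA hT boxes j.
Let m1 := #|@move_index n N|.
Variable L : nat.
Let m2 := size (rounds mv L).

Let atm m : C1_atlas setT (@vect_atlas R 'rV[R]_m) := C1_atlas_vect (fin_dim_rV m).

(* [e] is small, so that the first factor is submersive in its parameters, and
   [K] is large, so that the parameters in [[-1, 1]] of the second factor come
   from points of the open unit ball. *)
Definition diffeo_family (e K : R) (t : 'rV[R]_(m1 + m2)) (p : T) : T :=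
  all_round bc bx br (e *: lsubmx t) (word_map (rounds mv L) (coords (K *: rsubmx t)) p).

Variables (e K : R).

Lemma C1_family_joint x : C1_near (setT `*` setT)
  (prod_atlas (@vect_atlas R 'rV[R]_(m1 + m2)) A) A
  (fun tp : 'rV[R]_(m1 + m2) * T => diffeo_family e K tp.1 tp.2) x.
Proof.
have atP := C1_atlas_prod (atm (m1 + m2)) atA.
have c1 : C1_near (setT `*` setT) (prod_atlas (@vect_atlas R 'rV[R]_(m1 + m2)) A)
    (@vect_atlas R 'rV[R]_m1) (fun tp : 'rV[R]_(m1 + m2) * T => e *: lsubmx tp.1) x.
  exact: (C1_near_comp atP (atm _) (C1_near_fst (atm _) atA x)
    (C1_near_vect (C1at_submx e x.1).1)).
have ct j (t : 'rV[R]_(m1 + m2)) : C1at ((fun t => coords (K *: rsubmx t)) ^~ j) t.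
  exact: (C1at_comp (fin_dim_rV m2) (C1at_submx K t).2 (C1at_coords j _)).
have c2 := C1_word_map atA x (fin_dim_rV (m1 + m2)) (all_moves_rounds mvP L) ct.
exact: (C1_near_comp atP (C1_atlas_prod (atm _) atA) (C1_near_pair atP c1 c2)
  (C1_all_round atA hT boxes _)).
Qed.

Lemma C1_family_at p t :
  C1_near setT (@vect_atlas R 'rV[R]_(m1 + m2)) A (fun t => diffeo_family e K t p) t.
Proof.
have c2 := C1_near_cst (atm (m1 + m2)) atA p t.
exact: (C1_near_comp (atm _) (C1_atlas_prod (atm _) atA)
  (C1_near_pair (atm _) (C1_near_id (atm _) t) c2) (C1_family_joint (t, p))).
Qed.

Lemma diffeo_family_inv t : C1_self A (diffeo_family e K t) /\
  exists g, [/\ cancel (diffeo_family e K t) g, cancel g (diffeo_family e K t) & C1_self A g].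
Proof.
have m_1 := all_moves_map mvP (enum (@move_index n N)); have m_2 := all_moves_rounds mvP L.
have [g1 [g11 g12 cg1]] := word_map_inv atA (coords (e *: lsubmx t)) m_1.
have [g2 [g21 g22 cg2]] := word_map_inv atA (coords (K *: rsubmx t)) m_2.
split.
  exact: (C1_self_comp atA (C1_word_self atA _ m_2) (C1_word_self atA _ m_1)).
exists (g2 \o g1); split.
- by move=> p; rewrite /diffeo_family /= /all_round g11 g21.
- by move=> p; rewrite /diffeo_family /= /all_round g22 g12.
exact: C1_self_comp.
Qed.

(** Along the affine subspace [t + (s, 0)] the point [q] is fixed and the family is [all_round] at
    [q] after an affine isomorphism of the parameters. Surjectivity on this subspace gives it on the
    whole space, by [onto_outer]. *)
Lemma diffeo_family_onto t p : 0 < e ->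
  onto (@vect_atlas R 'rV[R]_m1) A
    ((all_round bc bx br) ^~ (word_map (rounds mv L) (coords (K *: rsubmx t)) p)) (e *: lsubmx t) ->
  onto (@vect_atlas R 'rV[R]_(m1 + m2)) A (fun t => diffeo_family e K t p) t.
Proof.
move=> e0; set q := word_map _ _ p => oE.
pose iota (s : 'rV[R]_m1) : 'rV[R]_(m1 + m2) := t + row_mx s 0.
pose aff (s : 'rV[R]_m1) : 'rV[R]_m1 := e *: lsubmx t + e *: s.
have iota0 : iota 0 = t by rewrite /iota row_mx0 addr0.
have aff0 : aff 0 = e *: lsubmx t by rewrite /aff scaler0 addr0.
have comE : (fun t => diffeo_family e K t p) \o iota = (all_round bc bx br) ^~ q \o aff.
  apply/funext => s; rewrite /diffeo_family /= /iota /aff.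
  have -> : lsubmx (t + row_mx s 0) = lsubmx t + s by rewrite linearD /= row_mxKl.
  have -> : rsubmx (t + row_mx s 0) = rsubmx t by rewrite linearD /= row_mxKr addr0.
  by rewrite scalerDr.
have ca s : C1at aff s by apply: C1at_affine; exact: C1at_id.
have ci s : C1at iota s.
  apply: C1at_add; first exact: (C1at_cst t s).
  apply: C1at_coord => j; case: (split_ordP j) => k ->.
    by apply: C1at_ext (C1at_rVcoord k s) => s'; rewrite row_mxEl.
  by apply: C1at_ext (C1at_cst (0 : R) s) => s'; rewrite row_mxEr mxE.
have cE s : C1_near setT (@vect_atlas R 'rV[R]_m1) A ((all_round bc bx br) ^~ q) s.
  have c2 := C1_near_cst (atm m1) atA q s.
  exact: (C1_near_comp (atm _) (C1_atlas_prod (atm _) atA)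
    (C1_near_pair (atm _) (C1_near_id (atm _) s) c2) (C1_all_round atA hT boxes (s, q))).
have oc : onto (@vect_atlas R 'rV[R]_m1) A ((fun t => diffeo_family e K t p) \o iota) 0.
  rewrite comE; apply: (onto_comp (atm _) (atm _) atA (C1_near_vect (ca 0)) (cE _)).
    apply: onto_vect; [exact: fin_dim_rV|exact: fin_dim_rV|exact: ca|].
    by move=> w; exists (e^-1 *: w); rewrite diff_affine scalerA divff ?gt_eqF // scale1r.
  by rewrite aff0.
have := onto_outer (atm _) (atm _) atA (C1_near_vect (ci 0)) _ oc.
by rewrite iota0; apply; exact: C1_family_at.
Qed.

End Family.

Lemma setT_fat {T : topologicalType} : [set: T] `<=` closure ([set: T]°).
Proof. by rewrite interiorT; exact: subset_closure. Qed.

Lemma C1_atlas_manifold (R : realType) (n : nat) (M : manifold_without_boundary R n) :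
  C1_atlas setT (atlas M).
Proof. exact: (smooth_atlas_C1 (fin_dim_rV n) setT_fat (@manifold_atlas _ _ _ M)). Qed.

Lemma disc_norm (R : realType) m (t : 'rV[R]_m) : sqnorm t <= 1 -> `|t| <= 1.
Proof.
move=> dt; rewrite [leLHS]/Num.norm /= mx_normrE; apply/bigmax_leP; split=> //= -[a j] _ /=.
rewrite (ord1 a) -(@expr_le1 _ 2) // real_normK ?num_real //.
apply: le_trans dt; rewrite /sqnorm (bigD1 j) //= lerDl.
by apply: sumr_ge0 => l _; exact: sqr_ge0.
Qed.

Lemma norm_lsubmx (R : realType) m1 m2 (t : 'rV[R]_(m1 + m2)) : `|lsubmx t| <= `|t|.
Proof.
rewrite [leLHS]/Num.norm [leRHS]/Num.norm /= !mx_normrE; apply/bigmax_leP.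
split=> [|[a j] _ /=]; first by apply: bigmax_ge_id.
by rewrite mxE; apply: le_trans (le_bigmax _ _ (a, lshift m2 j)).
Qed.

Section Scaling.
Context {R : realType}.

(** Each of the [m1 + m2] coordinates has absolute value at most [K^-1], and
    [(m1 + m2) / K^2 < K / K^2 <= 1]. The strict bound places the parameter in the interior of the
    ball. *)
Lemma sqnorm_scaled m1 m2 (tau : nat -> R) (K : R) : (m1 + m2)%:R < K -> 1 <= K ->
  (forall i, `|tau i| <= 1) ->
  sqnorm (row_mx 0 (K^-1 *: \row_(j < m2) tau j) : 'rV[R]_(m1 + m2)) < 1.
Proof.
move=> mK K1 tau1; have K0 : 0 < K by lra.
apply: (@le_lt_trans _ _ (\sum_(j < m1 + m2) K ^- 2)).
  apply: ler_sum => j _; case: (split_ordP j) => k ->.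
    by rewrite row_mxEl mxE expr0n /= invr_ge0 sqr_ge0.
  rewrite row_mxEr !mxE exprMn exprVn ler_piMr ?invr_ge0 ?sqr_ge0 //.
  by rewrite -(real_normK (num_real _)) expr_le1.
rewrite sumr_const card_ord -[_ *+ _]mulr_natl ltr_pdivrMr ?exprn_gt0 // mul1r.
apply: lt_le_trans mK _; rewrite expr2 ler_peMr //; exact: ltW.
Qed.

End Scaling.

Theorem theorem1p2 (R : realType) (n : nat)
  (M : manifold_without_boundary R n)
  (compactM : compact [set: M]) (connectedM : connected [set: M]) :
  exists (m : nat) (H : manifold_with_boundary R m) (psi : H -> M -> M),
    [/\ compact [set: H],
        C1_family psi,
        submersion (prod_atlas (atlas H) (atlas M))
          (prod_atlas (atlas M) (atlas M))
          (fun hp : H * M => (hp.2, psi hp.1 hp.2)) &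
        forall k : nat, (k <= n)%N ->
          set_surj (manifold_interior H `*` Grassmannian (atlas M) k)
            (Grassmannian (atlas M) k `*` Grassmannian (atlas M) k)
            (fun hs => (hs.2, plane_map (atlas M) (atlas M) (psi hs.1) hs.2))].
Proof.
have atM := C1_atlas_manifold M; have hM := @manifold_hausdorff _ _ _ M.
have [N [bc [bx [br [bp [boxes bpd bpm cover]]]]]] := finite_boxes atM compactM.
have [e e0 oE] := onto_all_round atM hM boxes cover compactM.
have mvP j := moves_are_moves atM hM boxes j.
have /choice[f fP] : forall k : 'I_n.+1, exists L, forall s s',
    Grassmannian (atlas M) k s -> Grassmannian (atlas M) k s' ->
    steps (atlas M) (moves bc bx br) L s s'.
  move=> k; have kn : (k <= n)%N by rewrite -ltnS ltn_ord.
  exact: (steps_Grassmannian atM hM boxes bpd bpm cover kn connectedM).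
(* [psi] may not depend on [k], so one number of rounds must serve all dimensions from 0 to [n]. *)
pose L := (\max_k f k)%N.
pose m1 := #|@move_index n N|; pose m2 := size (rounds (moves bc bx br) L).
(* The charts of the ball single out a first coordinate, so there must be a parameter even when
   [n = 0] or there is no box. *)
have m0 : (0 < m1 + m2)%N.
  by rewrite addn_gt0; apply/orP; left; apply/card_gt0P; exists None.
pose i0 := Ordinal m0; have hi0 : i0 = 0%N :> nat by [].
pose K : R := (m1 + m2).+1%:R.
pose H := disc_manifold (R := R) hi0.
pose psi (h : H) : M -> M := diffeo_family (bc := bc) (bx := bx) (br := br) (L := L) e K (disc_val h).
have atH : C1_atlas (half_space R (m1 + m2)) (atlas H) := disc_C1_atlas hi0.
have atP : C1_atlas setT (@vect_atlas R 'rV[R]_(m1 + m2)) := C1_atlas_vect (fin_dim_rV _).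
have atHM := C1_atlas_prod atH atM.
have cpsi x : C1_near (half_space R (m1 + m2) `*` setT) (prod_atlas (atlas H) (atlas M)) (atlas M)
    (fun hp : H * M => psi hp.1 hp.2) x.
  have c1 := C1_near_comp atHM atH (C1_near_fst atH atM x) (disc_val_C1 x.1).
  exact: (C1_near_comp atHM (C1_atlas_prod atP atM)
    (C1_near_pair atHM c1 (C1_near_snd atH atM x)) (C1_family_joint atM hM boxes e K _)).
exists (m1 + m2)%N, H, psi; split.
- exact: disc_compact.
- split; last by apply/(C1_mapP atHM atM).
  move=> h; have [cf [g [g1 g2 cg]]] := diffeo_family_inv atM hM boxes e K (disc_val h).
  split; first exact/(C1_mapP atM atM).
  by exists g; split=> //; exact/(C1_mapP atM atM).
- have atMM := C1_atlas_prod atM atM.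
  split.
    apply/(C1_mapP atHM atMM) => x.
    exact: (C1_near_pair atHM (C1_near_snd atH atM x) (cpsi x)).
  move=> [h p].
  have cval := disc_val_C1 h.
  have cfam := C1_family_at atM hM boxes e K p (disc_val h).
  have cpart : C1_near (half_space R (m1 + m2)) (atlas H) (atlas M)
      (fun h => (fun hp : H * M => psi hp.1 hp.2) (h, p)) h.
    exact: (C1_near_comp atH atP cval cfam).
  apply: (onto_graph atH atM atM (cpsi (h, p)) cpart).
  have fo : onto (@vect_atlas R 'rV[R]_(m1 + m2)) (atlas M)
      (fun t => diffeo_family e K t p) (disc_val h).
    apply: (diffeo_family_onto atM hM boxes e0); apply: oE.
    (* In the unit ball all coordinates are at most 1 in absolute value, so the scaled first block
       stays in the range [|s| <= e] of uniform submersivity. *)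
    rewrite normrZ gtr0_norm // ler_piMr ?(ltW e0) //.
    apply: le_trans (norm_lsubmx _) _; apply: disc_norm; exact: disc_valP.
  exact: (onto_comp atH atP atM cval cfam (@disc_val_onto R _ i0 hi0 h) fo).
move=> k kn [s s'] [/= gs gs'].
have kn' : (k < n.+1)%N by rewrite ltnS.
have st : steps (atlas M) (moves bc bx br) L s s'.
  apply: steps_mono (fP (Ordinal kn') s s' gs gs').
  exact: (leq_bigmax (Ordinal kn')).
have ts : tangent_plane (atlas M) s.
  have [c Ac cp] := atlas_cover atM s.1.
  have gs1 : Grassmannian (atlas M) k (s.1, s.2) by case: s gs {st cp}.
  have [B _ PB] := Grassmannian_chart atM (conj Ac cp) gs1.
  by rewrite /tangent_plane PB; exact: tangent_chart_plane.
have [tau [tau1 tauE]] := steps_rounds atM mvP ts st.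
(* The submersive block is 0, which makes [all_round] the identity; the scaling by [K] in the family
   restores the times [tau] in the other block. *)
pose t : 'rV[R]_(m1 + m2) := row_mx 0 (K^-1 *: \row_(j < m2) tau j).
have K0 : K != 0 by rewrite pnatr_eq0.
have [|h hint ht] := disc_interior hi0 (t := t).
  apply: sqnorm_scaled tau1; first by rewrite ltr_nat.
  by rewrite ler1n.
exists (h, s); first by split.
rewrite /= /psi ht; congr (_, _); rewrite -tauE; congr (plane_map _ _ _ _).
apply/funext => p; rewrite /diffeo_family /t row_mxKl row_mxKr scaler0 (all_round0 atM hM boxes).
apply: word_map_eq => j jm; rewrite (coordsE _ (Ordinal jm)) !mxE /=.
by rewrite mulVKf.
Qed.
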